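(* Let $p$ be an odd prime, $n\ge1$, and let $F$ be a field with $\operatorname{char}(F)\ne p$ and $\mu_p\not\subseteq F$. Let $L=F(\mu_p)$, $M=F(\mu_{p^n})$, $E=M\cap F(p)$, $J=F(p)(\mu_p)$ and $G_F=\mathrm{Gal}(F(p)/F)$. The subgroups of $H^1(G_F,\widetilde{\mu_{p^n}})$ are in one-to-one correspondence with the abelian $p^n$ field extensions $S$ of $E$ such that $S$ is Galois over $F$ and $\mathrm{Gal}(E/F)$ acts on $\mathrm{Gal}(S/E)$ via $\alpha\theta^{-1}$. They are also in one-to-one correspondence with the abelian $p^n$ field extensions $T$ of $M$ such that $T$ is Galois over $F$, $T\subseteq J$, and $\mathrm{Gal}(M/L)$ acts on $\mathrm{Gal}(T/M)$ via $\alpha$.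
   Context: All fields lie in a fixed algebraic closure of $F$. An abelian $p^n$ extension of a field $K$ is a (possibly infinite) Galois extension of $K$ whose Galois group is abelian and $p^n$-torsion. For a field $K$, $K(p)$ denotes the maximal $p$-extension of $K$ (compositum of all finite Galois extensions of $K$ of $p$-power degree). Let $\mathcal G=\mathrm{Gal}(L(p)/F)$, $G_L=\mathrm{Gal}(L(p)/L)$, $N=\mathrm{Gal}(L(p)/F(p))$, so $G_F=\mathcal G/N$. The cyclotomic character $\alpha:\mathcal G\to(\mathbb Z/p^n\mathbb Z)^*$ is defined by $g(\omega)=\omega^{\alpha(g)}$ for $\omega\in\mu_{p^n}$, and $\theta:\mathcal G\to(\mathbb Z/p^n\mathbb Z)^*$ is the unique character with $\theta|_N=\alpha|_N$ and $\theta|_{G_L}=1$ (namely $\theta=\alpha^{p^{n-1}}$). The character $\alpha$ factors through $\mathrm{Gal}(M/F)$, and $\alpha\theta^{-1}$ factors through $\mathrm{Gal}(M/F)$ and through $\mathrm{Gal}(E/F)$; the induced characters are denoted by the same symbols. $\widetilde{\mu_{p^n}}$ is the group $\mu_{p^n}$ with twisted $\mathcal G$-action $g*\omega=g(\omega)^{\theta(g)^{-1}}$; $N$ acts trivially, so it is a $G_F$-module. Cohomology is continuous cohomology. If $K\subseteq T$ are Galois over $F$ with $\mathrm{Gal}(T/K)$ abelian, $\mathrm{Gal}(K/F)$ (and its subgroups) acts on $\mathrm{Gal}(T/K)$ by conjugation by lifts; it acts via a character $\chi$ if $g\cdot\sigma=\sigma^{\chi(g)}$ for all $g,\sigma$.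 *)

(* Defs.v *)
From HB Require Import structures.
From mathcomp Require Import all_boot all_order all_algebra all_fingroup all_field.
From mathcomp Require Import boolp classical_sets functions.
Set Implicit Arguments.
Unset Strict Implicit.
Unset Printing Implicit Defensive.
Import GRing.Theory.
Local Open Scope classical_set_scope.
Local Open Scope ring_scope.

(* All fields are subfields, seen as sets, of one algebraically closed field
   Omega. *)
Section Extensions.
Variable Omega : closedFieldType.
Implicit Types (K T B X : set Omega) (sigma : Omega -> Omega).

Definition is_subfield K : Prop := divring_closed [in K].

Definition gen_field X : set Omega := smallest is_subfield X.

Definition mu (m : nat) : set Omega := [set w | w ^+ m = 1].

(* T / K is algebraic, normal and separable: every element of T is a root of
   a polynomial over K which splits in T without multiple roots. *)
Definition galois_ext K T : Prop :=
  [/\ is_subfield K, is_subfield T, K `<=` T &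
      forall x, x \in T -> exists s : seq Omega,
        [/\ \prod_(a <- s) ('X - a%:P) \is a polyOver [in K],
            uniq s, {in s, forall a, a \in T} & x \in s]].

(* T has a basis with d elements over K *)
Definition ext_degree K T (d : nat) : Prop :=
  exists2 e : 'I_d -> Omega, (forall i, e i \in T) &
    forall x, x \in T -> exists! a : {ffun 'I_d -> Omega},
      (forall i, a i \in K) /\ x = \sum_i a i * e i.

Definition max_p_ext (p : nat) K : set Omega :=
  gen_field (K `|` [set x | exists T : set Omega,
    [/\ galois_ext K T, exists k, ext_degree K T (p ^ k) & x \in T]]).

(* Gal(T/K). A field automorphism of T is encoded as a map on Omega which is
   the identity outside T, so that two automorphisms of T are equal exactly
   when the maps encoding them are; the group law is composition. For
   K `<=` K' one has gal_group T K' `<=` gal_group T K. *)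
Definition gal_group T K : set (Omega -> Omega) :=
  [set sigma | [/\ set_bij T T sigma,
                   {in T &, {morph sigma : x y / x + y}},
                   {in T &, {morph sigma : x y / x * y}},
                   {in K, sigma =1 id} &
                   forall x, x \notin T -> sigma x = x]].

(* The restriction to K of an automorphism that stabilizes K. *)
Definition res_gal K sigma : Omega -> Omega :=
  fun x => if x \in K then sigma x else x.

(* A chosen element of Gal(T/B) that agrees with sigma on K. *)
Definition lift_gal T B K sigma : Omega -> Omega :=
  xget sigma [set tau | gal_group T B tau /\ {in K, tau =1 sigma}].

Definition abelian_ext (m : nat) K T : Prop :=
  [/\ galois_ext K T,
      forall sigma tau, gal_group T K sigma -> gal_group T K tau ->
        sigma \o tau = tau \o sigma &
      forall sigma, gal_group T K sigma -> iter m sigma = id].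

(* For B `<=` K `<=` T: g in Gal(K/B) sends sigma in Gal(T/K) to
   h sigma h^-1, where h in Gal(T/B) is a lift of g; this has to be
   sigma^(chi g). *)
Definition acts_via (m : nat) B K T
    (chi : (Omega -> Omega) -> {unit 'Z_m}) : Prop :=
  forall g h sigma, gal_group K B g -> gal_group T B h -> {in K, h =1 g} ->
    gal_group T K sigma -> h \o sigma = iter (val (chi g)) sigma \o h.

(* The exponent by which g acts on mu_m. The value does not depend on the
   field containing mu_m on which the automorphism g is considered. *)
Definition cyclo (m : nat) (g : Omega -> Omega) : {unit 'Z_m} :=
  xget 1%g [set a : {unit 'Z_m} | forall w, mu m w -> g w = w ^+ val a].

End Extensions.

(* Continuous cohomology in degree one of a group G of automorphisms, with
   values in a multiplicative subgroup V of Omega with the discrete topology,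
   on which G acts through act. *)
Section H1.
Variable Omega : closedFieldType.
Let aut := Omega -> Omega.
Variables (G : set aut) (V : set Omega) (act : aut -> Omega -> Omega).
Implicit Types (b c d : aut -> Omega) (C : set (aut -> Omega)).

(* Local constancy for the Krull topology: a basis of neighbourhoods of g is
   given by the automorphisms that agree with g on a finite set. Elements of
   Gal(T/K) are the identity outside T, hence points of s outside T impose no
   condition. *)
Definition krull_continuous c : Prop :=
  forall g, G g -> exists s : seq Omega,
    forall h, G h -> {in s, h =1 g} -> c h = c g.

Definition Z1 c : Prop :=
  [/\ forall g, G g -> V (c g), krull_continuous c &
      forall g h, G g -> G h -> c (g \o h) = c g * act g (c h)].

Definition B1 b : Prop :=
  exists2 v, V v & forall g, G g -> b g = act g v / v.

(* The class of c modulo coboundaries. Only values on G matter: cocycles with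
   the same restriction to G have the same class. *)
Definition H1_class c : set (aut -> Omega) :=
  [set d | Z1 d /\ B1 (fun g => d g / c g)].

Definition H1 : set (set (aut -> Omega)) := [set H1_class c | c in Z1].

(* Subgroups of H1, whose law is [c][d] = [cd]. *)
Definition H1_subgroup (A : set (set (aut -> Omega))) : Prop :=
  [/\ A `<=` H1, A (H1_class (fun=> 1)) &
      forall c d, Z1 c -> Z1 d -> A (H1_class c) -> A (H1_class d) ->
        A (H1_class (fun g => c g / d g))].

End H1.

Section Correspondence.
Variables (Omega : closedFieldType) (p n : nat) (F : set Omega).
Let aut := Omega -> Omega.
Variable theta : aut -> {unit 'Z_(p ^ n)}.

Definition fieldL := gen_field (F `|` mu p).
Definition fieldM := gen_field (F `|` mu (p ^ n)).
Definition fieldE := fieldM `&` max_p_ext p F.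
Definition fieldJ := gen_field (max_p_ext p F `|` mu p).

(* the group Gal(L(p)/F) and its subgroups Gal(L(p)/L), Gal(L(p)/F(p)) *)
Definition calG : set aut := gal_group (max_p_ext p fieldL) F.
Definition groupGL : set aut := gal_group (max_p_ext p fieldL) fieldL.
Definition groupN : set aut := gal_group (max_p_ext p fieldL) (max_p_ext p F).

Definition GF : set aut := gal_group (max_p_ext p F) F.

Definition alpha : aut -> {unit 'Z_(p ^ n)} := @cyclo Omega (p ^ n).

(* These conditions determine theta on calG; its values elsewhere are not
   used. *)
Definition is_theta : Prop :=
  [/\ forall g h, calG g -> calG h -> theta (g \o h) = (theta g * theta h)%g,
      forall g, groupN g -> theta g = alpha g &
      forall g, groupGL g -> theta g = 1%g].

Definition to_calG (K : set Omega) : aut -> aut :=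
  lift_gal (max_p_ext p fieldL) F K.

(* The character of Gal(E/F) induced by alpha theta^-1. *)
Definition alpha_theta_inv (g : aut) : {unit 'Z_(p ^ n)} :=
  (alpha (to_calG fieldE g) * (theta (to_calG fieldE g))^-1)%g.

(* The twisted action of GF on mu_(p^n); Gal(L(p)/F(p)) acts trivially, so the
   choice of the lift to Gal(L(p)/F) is irrelevant. *)
Definition twisted_act (g : aut) (w : Omega) : Omega :=
  let g' := to_calG (max_p_ext p F) g in
  g' w ^+ val (theta g')^-1%g.

Definition H1_twisted_subgroup (A : set (set (aut -> Omega))) : Prop :=
  H1_subgroup GF (mu (p ^ n)) twisted_act A.

Definition extensions_of_E : set (set Omega) :=
  [set S | [/\ abelian_ext (p ^ n) fieldE S, galois_ext F S &
               acts_via F fieldE S alpha_theta_inv]].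

Definition extensions_of_M : set (set Omega) :=
  [set T | [/\ abelian_ext (p ^ n) fieldM T, galois_ext F T,
               T `<=` fieldJ & acts_via fieldL fieldM T alpha]].

(* The group Gal(F(p)/E) acts trivially on the twisted mu_(p^n), so a class
   restricts to a homomorphism on it, which is the restriction of any
   representing cocycle; the field attached to A is the fixed field of the
   common kernel of these homomorphisms for the classes in A. *)
Definition field_over_E (A : set (set (aut -> Omega))) : set Omega :=
  [set x | x \in max_p_ext p F /\
    forall g, gal_group (max_p_ext p F) fieldE g ->
      (forall C c, A C -> C c -> c g = 1) -> g x = x].

(* The same for the homomorphisms on Gal(J/M) obtained by inflation. *)
Definition field_over_M (A : set (set (aut -> Omega))) : set Omega :=
  [set x | x \in fieldJ /\
    forall g, gal_group fieldJ fieldM g ->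
      (forall C c, A C -> C c -> c (res_gal (max_p_ext p F) g) = 1) ->
      g x = x].

End Correspondence.

(* Main.v *)
(* Put q = p^n. Since [L : F] is prime to p, F(p) and L meet in F, so every
   element of G_F lifts to an automorphism g of Omega over L, and on such
   lifts the twisted action on mu_q is the natural one. The group
   Aut(Omega/L) acts on mu_q through units congruent to 1 mod p, hence, p
   being odd, through a cyclic p-group C, and the kernel consists of the
   automorphisms fixing E (equivalently M). For this action H^1(C, mu_q) =
   H^2(C, mu_q) = 0, so restriction identifies H^1(G_F, twisted mu_q) with
   the equivariant homomorphisms from Gal(F(p)/E) = Gal(J/M) to mu_q. By
   Pontryagin duality and the compactness of Galois groups, a subgroup of
   these homomorphisms is determined by its common kernel, and the common
   kernels are the closed normal subgroups whose quotient is abelian, killed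
   by q and acted upon through the character on mu_q. The Galois
   correspondence turns them into the fields S and T. *)
Require Import Defs.
From HB Require Import structures.
From mathcomp Require Import all_boot all_order all_algebra all_fingroup all_field.
From mathcomp Require Import boolp classical_sets functions.
From mathcomp Require Import filter all_solvable all_character ring zify.
Set Implicit Arguments.
Unset Strict Implicit.
Unset Printing Implicit Defensive.
Import GRing.Theory.
Local Open Scope classical_set_scope.
Local Open Scope ring_scope.

(** * Subfields and minimal polynomials *)

(** Everything rests on one arithmetic fact: for [a] equal to 1 modulo the odd prime [p], the sum 1
    + a + ... + a^(m-1) has the same [p]-adic valuation as [m]. If t, an automorphism over L, acts
    on mu_q as the power [a], then t^i(z)/z is t(z)/z raised to such a sum, and c(t^i) is c(t)
    raised to it. The fact therefore gives a generator of C, the kernel of the action and both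
    cohomological statements, without the structure of the units modulo p^n and without H^2: a
    homomorphism is extended to a cocycle by an explicit formula. That E and M have the same
    stabilizer over L needs mu_q inside J. This comes from theta, which on Gal(L(p)/J) both equals
    alpha and is trivial. The two correspondences are instances of one, for a base B, a field K
    above it, an ambient field X and a character chi: (F, E, F(p), alpha theta^-1) and (L, M, J,
    alpha). Two facts stay outside it: every S of the first family lies in F(p), and every T inside
    J that is Galois over L is Galois over F. *)

Section Subfields.
Variable Omega : closedFieldType.
Implicit Types (K X : set Omega) (x y : Omega).

Lemma subfieldP K : is_subfield K <->
  [/\ K 1, forall x y, K x -> K y -> K (x - y) &
      forall x y, K x -> K y -> K (x / y)].
Proof.
split=> [[h1 hB hV]|[h1 hB hV]]; split.
- by move: h1; rewrite inE.
- by move=> x y /mem_set hx /mem_set hy; have := hB _ _ hx hy; rewrite inE.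
- by move=> x y /mem_set hx /mem_set hy; have := hV _ _ hx hy; rewrite inE.
- by rewrite inE.
- by move=> x y; rewrite !inE; exact: hB.
- by move=> x y; rewrite !inE; exact: hV.
Qed.

Section Closure.
Variables (K : set Omega) (hK : is_subfield K).

Lemma sf1 : K 1. Proof. by case/subfieldP: hK. Qed.
Lemma sfB x y : K x -> K y -> K (x - y).
Proof. by case/subfieldP: hK => _ + _; exact. Qed.
Lemma sf_div x y : K x -> K y -> K (x / y).
Proof. by case/subfieldP: hK => _ _; exact. Qed.
Lemma sf0 : K 0. Proof. by rewrite -(subrr 1); apply: sfB; exact: sf1. Qed.
Lemma sfN x : K x -> K (- x).
Proof. by move=> ?; rewrite -sub0r; apply: sfB => //; exact: sf0. Qed.
Lemma sfD x y : K x -> K y -> K (x + y).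
Proof. by move=> ? ?; rewrite -[y]opprK; apply: sfB => //; exact: sfN. Qed.
Lemma sfV x : K x -> K x^-1.
Proof. by move=> ?; rewrite -div1r; apply: sf_div => //; exact: sf1. Qed.
Lemma sfM x y : K x -> K y -> K (x * y).
Proof. by move=> ? ?; rewrite -[y]invrK; apply: sf_div => //; exact: sfV. Qed.
Lemma sf_sum (I : Type) (r : seq I) (P : pred I) (f : I -> Omega) :
  (forall i, P i -> K (f i)) -> K (\sum_(i <- r | P i) f i).
Proof. by move=> h; apply: big_ind => //; [exact: sf0|exact: sfD]. Qed.

End Closure.

Lemma gen_subfield X : is_subfield (gen_field X).
Proof.
apply/subfieldP; split=> [Y []|x y hx hy Y hY|x y hx hy Y hY].
- by move=> hY _; exact: sf1.
- by apply: sfB; [case: hY|exact: hx|exact: hy].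
- by apply: sf_div; [case: hY|exact: hx|exact: hy].
Qed.

Lemma sub_gen_field X : X `<=` gen_field X.
Proof. by move=> x hx Y [_]; apply. Qed.

Lemma mem_gen_field X x : X x -> gen_field X x.
Proof. exact: sub_gen_field. Qed.

Lemma gen_min K X : is_subfield K -> X `<=` K -> gen_field X `<=` K.
Proof. by move=> hK hX x; apply. Qed.

Lemma subfieldI K K' : is_subfield K -> is_subfield K' -> is_subfield (K `&` K').
Proof.
move=> hK hK'; apply/subfieldP; split.
- by split; exact: sf1.
- by move=> x y [? ?] [? ?]; split; exact: sfB.
- by move=> x y [? ?] [? ?]; split; exact: sf_div.
Qed.

Section SubfieldType.
Variables (K : set Omega) (hK : is_subfield K).
(** The phantom proof argument lets the closure structure be attached to the predicate, so that
    [sf_type] becomes a field and polynomials over a subfield given as a set have Euclidean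
    division. *)
Definition sf_pred (_ : is_subfield K) : {pred Omega} := [in K].
HB.instance Definition _ := GRing.isDivringClosed.Build Omega (sf_pred hK) hK.
Record sf_type := SfElt {sf_val : Omega; _ : sf_val \in sf_pred hK}.
HB.instance Definition _ := [isSub for sf_val].
HB.instance Definition _ := [Choice of sf_type by <:].
HB.instance Definition _ := [SubChoice_isSubIntegralDomain of sf_type by <:].
HB.instance Definition _ := [SubIntegralDomain_isSubField of sf_type by <:].
HB.instance Definition _ := GRing.RMorphism.copy sf_val (\val : sf_type -> Omega).

Lemma sf_valP (a : sf_type) : K (sf_val a).
Proof. by have := valP a; rewrite inE. Qed.

Lemma sf_val_surj x : K x -> exists a : sf_type, sf_val a = x.
Proof. by move=> /mem_set hx; exists (SfElt hx). Qed.

Lemma polyOver_set (q : {poly Omega}) :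
  (q \is a polyOver [in K]) <-> (forall i, K q`_i).
Proof.
split=> [/(@polyOverP _ (sf_pred hK)) h i|h].
  by have := h i; rewrite inE.
by apply/(@polyOverP _ (sf_pred hK)) => i; rewrite inE; exact: h.
Qed.

Lemma sf_poly_lift (q : {poly Omega}) : (forall i, K q`_i) ->
  exists q' : {poly sf_type}, q = map_poly sf_val q'.
Proof.
move=> hq.
have h i : exists a : sf_type, sf_val a = q`_i by exact: sf_val_surj.
have [f hf] := choice h.
exists (\poly_(i < size q) f i); apply/polyP => i; rewrite coef_map coef_poly.
by case: ltnP => hi; [rewrite /= hf|rewrite raddf0 nth_default].
Qed.
End SubfieldType.

(** Take an annihilating polynomial of least size: the remainder of any other one modulo it vanishes
    at [x] and is smaller, hence zero. *)
Lemma minimal_annihilator (K : fieldType) (i : {rmorphism K -> Omega}) x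
    (q : {poly K}) : q != 0 -> root (map_poly i q) x ->
  exists2 m : {poly K}, m \is monic &
    forall P, root (map_poly i P) x = (m %| P).
Proof.
move=> q0 qx.
have ex : exists k, `[< exists P : {poly K},
    [/\ P != 0, root (map_poly i P) x & size P = k] >].
  by exists (size q); apply/asboolP; exists q.
case: (ex_minnP ex) => k /asboolP [m [m0 mx sm]] kmin.
have key P : root (map_poly i P) x -> m %| P.
  move=> Px; rewrite /dvdp -[_ == _]negbK; apply/negP => r0.
  have: root (map_poly i (P %% m)) x.
    move: Px; rewrite {1}(divp_eq P m) rmorphD rmorphM /= /root hornerD hornerM.
    by rewrite (rootP mx) mulr0 add0r.
  move=> rx; have := kmin (size (P %% m)).
  have /[swap] /[apply] : `[< exists P0 : {poly K},
    [/\ P0 != 0, root (map_poly i P0) x & size P0 = size (P %% m)%R] >].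
    by apply/asboolP; exists (P %% m).
  by rewrite -sm leqNgt ltn_modp m0.
have lm : lead_coef m != 0 by rewrite lead_coef_eq0.
exists ((lead_coef m)^-1 *: m).
  by rewrite monicE lead_coefZ mulVf.
move=> P; rewrite dvdpZl ?invr_eq0 //; apply/idP/idP; first exact: key.
move=> /dvdpP [e ->]; rewrite rmorphM /root hornerM (rootP mx) mulr0 //.
Qed.

Section Minimal.
Variables (K : fieldType) (i : {rmorphism K -> Omega}) (x : Omega) (m : {poly K}).
Hypotheses (m_mon : m \is monic)
  (mP : forall P, root (map_poly i P) x = (m %| P)).

Lemma minimal_root : root (map_poly i m) x.
Proof. by rewrite mP. Qed.

Lemma minimal_size : (1 < size m)%N.
Proof.
rewrite ltnNge; apply/negP => h; have := minimal_root.
rewrite (size1_polyC h) map_polyC /root hornerC fmorph_eq0 => /eqP m0.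
by move: m_mon; rewrite (size1_polyC h) m0 monicE lead_coef0 eq_sym oner_eq0.
Qed.

(** The gcd [d] of [P] and [m] does not vanish at [x], so its cofactor in [m] does and is divisible
    by [m]; hence [d] is constant, and Bezout inverts [P] modulo [m]. *)
Lemma minimal_inverse (P : {poly K}) : ~~ root (map_poly i P) x ->
  exists U : {poly K}, m %| U * P - 1.
Proof.
move=> Px; have cop : coprimep P m.
  rewrite coprimep_def; set d := gcdp P m.
  have d_m : d %| m := dvdp_gcdr P m.
  have dx : ~~ root (map_poly i d) x.
    by apply: contra Px; rewrite !mP => /dvdp_trans; apply; exact: dvdp_gcdl.
  have [e me] := dvdpP _ _ d_m.
  have : m %| e.
    have := minimal_root; rewrite me rmorphM /= rootM (negPf dx) orbF.
    by rewrite mP -me.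
  have m0 : m != 0 by exact: monic_neq0.
  have e0 : e != 0 by apply: contraNneq m0 => e0; rewrite me e0 mul0r.
  have d0 : d != 0 by apply: contraNneq m0 => d0; rewrite me d0 mulr0.
  move=> /(dvdp_leq e0); rewrite me size_mul //.
  have : (0 < size d)%N by rewrite size_poly_gt0.
  have : (0 < size e)%N by rewrite size_poly_gt0.
  case: (size e) => [|a] //; case: (size d) => [|[|b]] //= _ _.
  by move=> *; lia.
have [[U V] /= h] := Bezout_eq1_coprimepP P m cop.
by exists U; apply/dvdpP; exists (- V); rewrite -h; ring.
Qed.

Lemma minimal_transfer (s : {rmorphism K -> Omega}) y (P : {poly K}) :
  root (map_poly s m) y -> root (map_poly i P) x -> root (map_poly s P) y.
Proof.
move=> my; rewrite mP => /dvdpP [e ->].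
by rewrite rmorphM /root hornerM (rootP my) mulr0.
Qed.
End Minimal.

End Subfields.

(** * Extension of automorphisms *)

Lemma rmorphism_of (R S : pzRingType) (f : R -> S) :
  f 1 = 1 -> {morph f : x y / x - y} -> {morph f : x y / x * y} ->
  exists g : {rmorphism R -> S}, f = g.
Proof.
move=> f1 fB fM.
pose fadd := GRing.isZmodMorphism.Build R S f fB.
pose fmul := GRing.isMonoidMorphism.Build R S f (f1, fM).
by exists (HB.pack f fadd fmul : {rmorphism R -> S}).
Qed.

Section Extension.
Variable Omega : closedFieldType.
Implicit Types (G : set (Omega * Omega)) (x y : Omega).

(** A partial field homomorphism is kept as its graph, so that Zorn's lemma applies to plain unions
    of chains. Single-valuedness reduces, by subtraction, to the last condition. *)
Definition field_graph G : Prop :=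
  [/\ G (1, 1),
      forall u v, G u -> G v -> G (u.1 - v.1, u.2 - v.2),
      forall u v, G u -> G v -> G (u.1 / v.1, u.2 / v.2) &
      forall y, G (0, y) -> y = 0].

Definition graph_dom G : set Omega := [set x | exists y, G (x, y)].

Section Graph.
Variables (G : set (Omega * Omega)) (hG : field_graph G).

Lemma graph_fun x y y' : G (x, y) -> G (x, y') -> y = y'.
Proof.
case: hG => _ hB _ h0 h h'; apply/eqP; rewrite -subr_eq0; apply/eqP/h0.
by have := hB _ _ h h'; rewrite /= subrr.
Qed.

Lemma graph_dom_subfield : is_subfield (graph_dom G).
Proof.
case: hG => h1 hB hV _; apply/subfieldP; split.
- by exists 1.
- by move=> x y [x' hx] [y' hy]; exists (x' - y'); exact: (hB _ _ hx hy).
- by move=> x y [x' hx] [y' hy]; exists (x' / y'); exact: (hV _ _ hx hy).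
Qed.

Lemma graphM x x' y y' : G (x, x') -> G (y, y') -> G (x * y, x' * y').
Proof.
case: hG => h1 _ hV _ hx hy; have hy' := hV _ _ h1 hy.
by have := hV _ _ hx hy'; rewrite /= !div1r !invrK.
Qed.

Lemma graph_rmorphism :
  exists s : {rmorphism sf_type graph_dom_subfield -> Omega},
    forall a, G (sf_val a, s a).
Proof.
have h (a : sf_type graph_dom_subfield) : exists y, G (sf_val a, y).
  by case: (sf_valP a) => y hy; exists y.
have [s hs] := choice h.
case: (hG) => h1 hB _ _.
have [|||s' ss'] := rmorphism_of (f := s) _ _ _.
- by apply: (@graph_fun 1) => //; have := hs 1; rewrite rmorph1.
- move=> a b; apply: (@graph_fun (sf_val (a - b))) => //.
  by rewrite rmorphB; exact: (hB _ _ (hs a) (hs b)).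
- move=> a b; apply: (@graph_fun (sf_val (a * b))) => //.
  by have := graphM (hs a) (hs b).
- by exists s'; rewrite -ss'.
Qed.
End Graph.

(** The homomorphism sends P(x) to P(y), which is well defined because [m] divides every [P]
    vanishing at [x]. Two embeddings of [K] are allowed: distinct ones prolong a partial
    homomorphism, equal ones send [x] to a conjugate over [K]. *)
Lemma adjoin_graph (K : fieldType) (i s : {rmorphism K -> Omega}) x y
    (m : {poly K}) :
  m \is monic -> (forall P, root (map_poly i P) x = (m %| P)) ->
  root (map_poly s m) y ->
  exists G, [/\ field_graph G, forall a, G (i a, s a), G (x, y) &
    forall u, G u -> exists P, u.1 = (map_poly i P).[x]].
Proof.
move=> m_mon mP my.
pose G := [set u | exists P : {poly K},
  u = ((map_poly i P).[x], (map_poly s P).[y])].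
have G1 : G (1, 1) by exists 1; rewrite !rmorph1 !hornerC.
have GB u v : G u -> G v -> G (u.1 - v.1, u.2 - v.2).
  by move=> [P ->] [Q ->]; exists (P - Q); rewrite !rmorphB !hornerE.
have GM u v : G u -> G v -> G (u.1 * v.1, u.2 * v.2).
  by move=> [P ->] [Q ->]; exists (P * Q); rewrite !rmorphM !hornerE.
have tr P : root (map_poly i P) x -> root (map_poly s P) y.
  by apply: minimal_transfer; last exact: my.
have G0 z : G (0, z) -> z = 0.
  by move=> [P [/esym/rootP h ->]]; apply/rootP/tr.
(* Since 0^-1 = 0, a [P] vanishing at [x] is a case of its own; otherwise 1/P(x) is U(x) for a
   polynomial [U] that also inverts P(y). *)
have GV u : G u -> G (u.1^-1, u.2^-1).
  move=> [P -> /=]; have [Px|Px] := boolP (root (map_poly i P) x).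
    rewrite (rootP Px) (rootP (tr _ Px)) !invr0.
    by exists 0; rewrite !rmorph0 !hornerC.
  have [U hU] := minimal_inverse m_mon mP Px; exists U.
  have key (t : {rmorphism K -> Omega}) z : root (map_poly t (U * P - 1)) z ->
      ((map_poly t P).[z])^-1 = (map_poly t U).[z].
    rewrite rmorphB rmorphM rmorph1 /root !hornerE subr_eq0 => /eqP h.
    have nz : (map_poly t P).[z] != 0.
      by apply/eqP => e; move: h; rewrite e mulr0 => /esym/eqP; rewrite oner_eq0.
    by apply: (mulIf nz); rewrite mulVf.
  by rewrite (key i x) ?(key s y) // ?mP //; apply: tr; rewrite mP.
exists G; split.
- split=> // u v hu hv; apply: (GM u (v.1^-1, v.2^-1)) => //; exact: GV.
- by move=> a; exists a%:P; rewrite !map_polyC !hornerC.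
- by exists 'X; rewrite !map_polyX !hornerX.
- by move=> u [P ->]; exists P.
Qed.

Section Algebraic.
Variable F : set Omega.
Hypothesis Falg : forall x, exists q : {poly Omega},
  [/\ q != 0, forall i, F q`_i & root q x].

Lemma extend_graph G : field_graph G -> F `<=` graph_dom G ->
  exists g : {rmorphism Omega -> Omega}, forall x y, G (x, y) -> g x = y.
Proof.
move=> hG FG.
pose P (A : set (Omega * Omega)) := field_graph A /\ G `<=` A \/ A = set0.
have [] := @Zorn_bigcup _ P.
  move=> C CP tot; have [[A CA A0]|no] := pselect (exists2 A, C A & A !=set0);
    last first.
    right; rewrite -subset0 => u [A CA Au]; case: no; exists A => //.
    by exists u.
  left.
  have CG B : C B -> B !=set0 -> field_graph B /\ G `<=` B.
    by move=> CB [u Bu]; case: (CP _ CB) => // B0; rewrite B0 in Bu.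
  have two u v : (\bigcup_(X in C) X) u -> (\bigcup_(X in C) X) v ->
      exists B, [/\ C B, field_graph B, B u & B v].
    move=> [B CB Bu] [B' CB' Bv]; case: (tot _ _ CB CB') => h.
      exists B'; split=> //; last exact: h.
      by case: (CG B') => //; exists v.
    exists B; split=> //; last exact: h.
    by case: (CG B) => //; exists u.
  have [fgA GA] := CG _ CA A0.
  split; last by move=> u Gu; exists A => //; exact: GA.
  split.
  - by exists A => //; case: fgA.
  - move=> u v hu hv; have [B [CB [_ hB _ _] Bu Bv]] := two _ _ hu hv.
    by exists B => //; exact: hB.
  - move=> u v hu hv; have [B [CB [_ _ hB _] Bu Bv]] := two _ _ hu hv.
    by exists B => //; exact: hB.
  - move=> y hy; have [B [CB [_ _ _ hB] Bu _]] := two _ _ hy hy.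
    exact: hB.
move=> A [PA Amax].
have [hA GA] : field_graph A /\ G `<=` A.
  case: PA => // A0; exfalso; apply: (Amax G); last by left; split.
  rewrite A0; split; first exact: sub0set.
  by move=> h; apply: (h (1, 1)); case: hG.
have tot x : graph_dom A x.
  apply: contrapT => Ax.
  have [s hs] := graph_rmorphism hA.
  have FA z : F z -> graph_dom A z.
    by move=> /FG [y Gy]; exists y; exact: GA.
  have [q [q0 qF qx]] := Falg x.
  have [q' qq'] := sf_poly_lift (graph_dom_subfield hA) (fun i => FA _ (qF i)).
  have q'0 : q' != 0 by apply: contraNneq q0 => q'0; rewrite qq' q'0 rmorph0.
  rewrite qq' in qx.
  have [m m_mon mP] := minimal_annihilator q'0 qx.
  have [y my] : exists y, root (map_poly s m) y.
    apply/closed_rootP; rewrite size_map_poly.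
    by rewrite neq_ltn (minimal_size m_mon mP) orbT.
  have [B [hB AB Bxy _]] := adjoin_graph m_mon mP my.
  have AsubB : A `<=` B.
    move=> [a b] Aab.
    have [a' aa'] : exists a' : sf_type (graph_dom_subfield hA), sf_val a' = a.
      by apply: sf_val_surj; exists b.
    have -> : b = s a' by apply: (graph_fun hA Aab); rewrite -aa'.
    by rewrite -aa'; exact: AB.
  apply: (Amax B); last by left; split=> //; apply: subset_trans AsubB.
  by split=> // h; apply: Ax; exists y; exact: h.
have [g hg] := choice tot.
case: (hA) => h1 hB _ _.
have [|||g' gg'] := rmorphism_of (f := g) _ _ _.
- exact: (graph_fun hA (hg 1)).
- by move=> a b; apply: (graph_fun hA (hg _)); exact: (hB _ _ (hg a) (hg b)).
- by move=> a b; apply: (graph_fun hA (hg _)); exact: graphM.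
- exists g' => x y /GA; rewrite -gg'; exact: (graph_fun hA (hg x)).
Qed.

Lemma extend_hom (K : set Omega) (f : Omega -> Omega) :
  is_subfield K -> F `<=` K -> f 1 = 1 ->
  (forall x y, K x -> K y -> f (x + y) = f x + f y) ->
  (forall x y, K x -> K y -> f (x * y) = f x * f y) ->
  exists g : {rmorphism Omega -> Omega}, forall x, K x -> g x = f x.
Proof.
move=> hK FK f1 fD fM.
have f0 : f 0 = 0.
  have := fD 0 0 (sf0 hK) (sf0 hK); rewrite addr0 => /eqP.
  by rewrite -[X in X == _]addr0 (inj_eq (addrI _)) eq_sym => /eqP.
have fN x : K x -> f (- x) = - f x.
  move=> Kx; have := fD x (- x) Kx (sfN hK Kx); rewrite subrr f0 => /esym/eqP.
  by rewrite addrC addr_eq0 => /eqP.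
have fV x : K x -> f x^-1 = (f x)^-1.
  move=> Kx; have [->|x0] := eqVneq x 0; first by rewrite invr0 f0 invr0.
  have := fM x x^-1 Kx (sfV hK Kx); rewrite mulfV // f1 => h.
  have fx0 : f x != 0.
    by apply/eqP => e; move/eqP: h; rewrite e mul0r oner_eq0.
  by apply: (mulfI fx0); rewrite -h mulfV.
pose G := [set u : Omega * Omega | K u.1 /\ u.2 = f u.1].
have [||g hg] := @extend_graph G.
- split.
  + by split=> //; exact: sf1.
  + move=> [u u'] [v v'] [/= Ku ->] [/= Kv ->]; split; first exact: sfB.
    by rewrite /= fD ?fN //; exact: sfN.
  + move=> [u u'] [v v'] [/= Ku ->] [/= Kv ->]; split; first exact: sf_div.
    by rewrite /= fM ?fV //; exact: sfV.
  + by move=> y [_ /= ->].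
- by move=> x Fx; exists (f x); split=> //; exact: FK.
- by exists g => x Kx; apply: hg.
Qed.

(** Surjectivity comes from finiteness: [y] is a root of a polynomial over [F], and an injective map
    fixing its coefficients permutes its finitely many roots. *)
Lemma auto_inverse (g : {rmorphism Omega -> Omega}) :
  (forall x, F x -> g x = x) ->
  exists h : {rmorphism Omega -> Omega}, cancel g h /\ cancel h g.
Proof.
move=> gF.
have surj y : exists x, g x = y.
  have [q [q0 qF qy]] := Falg y.
  have gq : map_poly g q = q.
    by apply/polyP => i; rewrite coef_map; exact: gF.
  have [r qr] := closed_field_poly_normal q.
  pose u := undup r.
  have uP x : (x \in u) = root q x.
    rewrite mem_undup qr rootZ ?lead_coef_eq0 // root_prod_XsubC //.
  have sub : {subset map g u <= u}.
    move=> _ /mapP [x xu ->]; move: xu; rewrite !uP -{2}gq.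
    by rewrite fmorph_root.
  have [||_ e] := uniq_min_size (s1 := map g u) (s2 := u) _ sub.
  - by rewrite map_inj_uniq ?undup_uniq //; exact: fmorph_inj.
  - by rewrite size_map.
  - have : y \in map g u by rewrite e uP.
    by case/mapP => x _ ->; exists x.
have [h gh] := choice surj.
have hg : cancel g h by move=> x; apply: (fmorph_inj g).
have [|||h' hh'] := rmorphism_of (f := h) _ _ _.
- by apply: (fmorph_inj g); rewrite gh rmorph1.
- by move=> a b; apply: (fmorph_inj g); rewrite rmorphB !gh.
- by move=> a b; apply: (fmorph_inj g); rewrite rmorphM !gh.
- by exists h'; rewrite -hh'.
Qed.

End Algebraic.
End Extension.

(** * Separable and Galois extensions *)

Section Separable.
Variable Omega : closedFieldType.
Implicit Types (K T X Y : set Omega) (x y z : Omega) (s t : seq Omega)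
  (g h : {rmorphism Omega -> Omega}).

(* Gal(T/K), for T Galois over K, is handled through automorphisms of Omega
   fixing K: res_gal maps them onto gal_group T K (gal_group_res). *)
Definition fixes K (f : Omega -> Omega) : Prop := forall x, K x -> f x = x.

Definition separable_over K x : Prop := exists s,
  [/\ forall i, K (\prod_(a <- s) ('X - a%:P))`_i, uniq s & x \in s].

Definition auto_stable K T : Prop :=
  forall g, fixes K g -> forall x, T x -> T (g x).

Lemma fixes_sub K K' f : K `<=` K' -> fixes K' f -> fixes K f.
Proof. by move=> sub h x /sub; exact: h. Qed.

Lemma fixes_comp K f f' : fixes K f -> fixes K f' -> fixes K (f \o f').
Proof. by move=> h h' x Kx; rewrite /= h' // h. Qed.

Lemma fixes_iter K f k : fixes K f -> fixes K (iter k f).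
Proof. by move=> h; elim: k => [|k IH] x Kx //=; rewrite IH // h. Qed.

Lemma fixed_subfield (D : set {rmorphism Omega -> Omega}) :
  is_subfield [set x | forall g, D g -> g x = x].
Proof.
apply/subfieldP; split=> [g _|x y hx hy g Dg|x y hx hy g Dg].
- exact: rmorph1.
- by rewrite rmorphB hx ?hy.
- by rewrite fmorph_div hx ?hy.
Qed.

Lemma fixes_gen X g : fixes X g -> fixes (gen_field X) g.
Proof.
move=> h x /(@gen_min _ [set x | forall g', g' = g -> g' x = x]); apply=> //.
- exact: (fixed_subfield [set g]).
- by move=> y Xy g' ->; exact: h.
Qed.

Lemma preimage_subfield K g : is_subfield K -> is_subfield [set x | K (g x)].
Proof.
move=> hK; apply/subfieldP; split=> [|x y /= hx hy|x y /= hx hy].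
- by rewrite /= rmorph1; exact: sf1.
- by rewrite rmorphB; exact: sfB.
- by rewrite fmorph_div; exact: sf_div.
Qed.

Lemma gen_stable X g : (forall x, X x -> gen_field X (g x)) ->
  forall x, gen_field X x -> gen_field X (g x).
Proof.
move=> h x; apply: (gen_min (K := [set x | gen_field X (g x)])); last exact: h.
by apply: preimage_subfield; exact: gen_subfield.
Qed.

Lemma separable_sub K K' x : K `<=` K' -> separable_over K x -> separable_over K' x.
Proof. by move=> sub [s [h ? ?]]; exists s; split=> // i; apply/sub/h. Qed.

Lemma separable_self K x : is_subfield K -> K x -> separable_over K x.
Proof.
move=> hK Kx; exists [:: x]; split=> //; last by rewrite mem_head.
move=> i; rewrite big_seq1 coefB coefX coefC; apply: sfB => //.
  by case: eqP => _; [exact: sf1|exact: sf0].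
by case: eqP => _ //; exact: sf0.
Qed.

Lemma root_conj K s g x : (forall i, K (\prod_(a <- s) ('X - a%:P))`_i) ->
  fixes K g -> x \in s -> g x \in s.
Proof.
move=> hs hg; rewrite -!root_prod_XsubC => hx.
rewrite -[X in root X](_ : map_poly g (\prod_(a <- s) ('X - a%:P)) = _).
  by rewrite fmorph_root.
by apply/polyP => i; rewrite coef_map; apply: hg.
Qed.

Lemma map_XsubC_stable (R : idomainType) (g : {rmorphism R -> R}) (s : seq R) :
  injective g -> uniq s -> {in s, forall a, g a \in s} ->
  map_poly g (\prod_(a <- s) ('X - a%:P)) = \prod_(a <- s) ('X - a%:P).
Proof.
move=> ginj us hs; rewrite rmorph_prod.
rewrite (eq_bigr (fun a => 'X - (g a)%:P)) => [|a _]; last first.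
  by rewrite rmorphB /= map_polyX map_polyC.
rewrite -(big_map g xpredT (fun a => 'X - a%:P)); apply: perm_big.
have umap : uniq (map g s) by rewrite map_inj_uniq.
apply: uniq_perm => //; have [||_ e] // := uniq_min_size (s2 := s) umap.
- by move=> _ /mapP [a /hs h ->].
- by rewrite size_map.
Qed.

Lemma prod_XsubC_coef K t : is_subfield K -> (forall x, x \in t -> K x) ->
  forall i, K (\prod_(a <- t) ('X - a%:P))`_i.
Proof.
move=> hK tK; apply/(polyOver_set hK).
suff: \prod_(a <- t) ('X - a%:P) \is a polyOver (sf_pred hK) by [].
rewrite big_seq_cond; apply: rpred_prod => a /andP [/tK ha _].
by apply: rpredB; rewrite ?polyOverX // polyOverC inE.
Qed.

Section Base.
Variable F : set Omega.
Hypothesis Falg : forall x, exists q : {poly Omega},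
  [/\ q != 0, forall i, F q`_i & root q x].

(** Write [z] as P(x) with [P] shorter than the minimal polynomial of [x]. Automorphisms over [K]
    fix [z] and carry [x] to any conjugate, so P - z has as many distinct roots as that minimal
    polynomial has degree; hence [P] is the constant [z]. *)
Lemma separable_fix1 K x z : is_subfield K -> F `<=` K -> separable_over K x ->
  gen_field (K `|` [set x]) z -> (forall g, fixes K g -> g z = z) -> K z.
Proof.
move=> hK FK [s [sK us xs]] zKx zfix.
have [S eS] := sf_poly_lift hK sK.
have Sx : root (map_poly (@sf_val _ _ hK) S) x by rewrite -eS root_prod_XsubC.
have S0 : S != 0.
  apply: contraTneq (@monic_neq0 _ _ (monic_prod_XsubC s xpredT id)) => S0.
  by rewrite negbK eS S0 rmorph0.
have [m m_mon mP] := minimal_annihilator S0 Sx.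
have m0 := monic_neq0 m_mon.
have conj y : root (map_poly (@sf_val _ _ hK) m) y ->
    exists2 g : {rmorphism Omega -> Omega}, fixes K g & g x = y.
  move=> my; have [G [hG GK Gxy _]] := adjoin_graph m_mon mP my.
  have GK' a : K a -> G (a, a) by move=> /(sf_val_surj hK) [a' <-]; exact: GK.
  have [|g hg] := extend_graph Falg hG.
    by move=> a /FK Ka; exists a; exact: GK'.
  by exists g; [move=> a /GK'; exact: hg|exact: hg].
have [P zP] : exists P : {poly sf_type hK}, z = (map_poly (@sf_val _ _ hK) P).[x].
  have [G [hG GK Gxy hP]] := adjoin_graph m_mon mP (minimal_root mP).
  have : graph_dom G z.
    apply: (gen_min (graph_dom_subfield hG) _ zKx).
    by move=> a [/(sf_val_surj hK) [a' <-]|->]; [exists (sf_val a'); exact: GK|exists x].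
  by case=> z' /hP [P /= ->]; exists P.
have {zP} [{}P sP zP] : exists2 P : {poly sf_type hK}, (size P < size m)%N &
    z = (map_poly (@sf_val _ _ hK) P).[x].
  exists (P %% m); first by rewrite ltn_modp.
  rewrite zP {1}(divp_eq P m) rmorphD rmorphM hornerD hornerM.
  by rewrite (rootP (minimal_root mP)) mulr0 add0r.
have : map_poly (@sf_val _ _ hK) m %| \prod_(a <- s) ('X - a%:P).
  by rewrite eS dvdp_map -mP.
case/dvdp_prod_XsubC => b mb; set s' := mask b s in mb.
have us' : uniq s' by exact: mask_uniq.
have ss' : size m = (size s').+1.
  by rewrite -(size_map_poly (@sf_val _ _ hK)) (eqp_size mb) size_prod_XsubC.
have Pz : map_poly (@sf_val _ _ hK) P = z%:P.
  apply/eqP; rewrite -subr_eq0; apply: contraT => nz.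
  have := max_poly_roots nz _ us'.
  have -> : all (root (map_poly (@sf_val _ _ hK) P - z%:P)) s'.
    apply/allP => y ys'.
    have [|g gK gxy] := conj y; first by rewrite (eqp_root mb) root_prod_XsubC.
    rewrite /root hornerD hornerN hornerC subr_eq0 -(zfix g gK) zP.
    rewrite -horner_map /= gxy.
    suff -> : map_poly g (map_poly (@sf_val _ _ hK) P) = map_poly (@sf_val _ _ hK) P by [].
    by apply/polyP => i; rewrite !coef_map /=; apply: gK; exact: sf_valP.
  move=> /(_ isT); rewrite ltnNge => /negP []; rewrite -ltnS -ss'.
  apply: leq_ltn_trans (size_polyD _ _) _; rewrite size_polyN gtn_max.
  rewrite size_map_poly sP /= size_polyC.
  by apply: leq_ltn_trans (leq_b1 _) _; exact: (minimal_size m_mon mP).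
have -> : z = (map_poly (@sf_val _ _ hK) P)`_0 by rewrite Pz coefC.
by rewrite coef_map; exact: sf_valP.
Qed.

Lemma separable_fix_seq s K z : is_subfield K -> F `<=` K ->
  {in s, forall x, separable_over K x} ->
  gen_field (K `|` [set` s]) z -> (forall g, fixes K g -> g z = z) -> K z.
Proof.
elim: s K => [|x s IH] K hK FK hs zKs zfix.
  by apply: (gen_min hK _ zKs) => y [].
apply: (separable_fix1 hK FK (hs _ (mem_head _ _))) => //.
set K' := gen_field _.
have KK' : K `<=` K' by move=> y Ky; rewrite /K'; apply: mem_gen_field; left.
apply: (IH K').
- exact: gen_subfield.
- exact: subset_trans KK'.
- move=> y ys; apply: separable_sub KK' _.
  by apply: hs; rewrite inE ys orbT.
- apply: (gen_min (gen_subfield _) _ zKs) => y [Ky|].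
    by apply: mem_gen_field; left; exact: KK'.
  rewrite /= inE => /orP [/eqP ->|ys]; apply: mem_gen_field; [left|by right].
  by rewrite /K'; apply: mem_gen_field; right.
- by move=> g gK'; apply: zfix; exact: fixes_sub gK'.
Qed.

Lemma separable_fix K x : is_subfield K -> F `<=` K -> separable_over K x ->
  (forall g, fixes K g -> g x = x) -> K x.
Proof.
move=> hK FK hx hfix; apply: (@separable_fix_seq [:: x] K x) => //.
  by move=> y; rewrite inE => /eqP ->.
by apply: mem_gen_field; right; rewrite /= mem_head.
Qed.

(** Automorphisms over [K] permute [t], hence fix these coefficients. This yields the separable
    polynomials of orbits and of combined elements. *)
Lemma stable_poly K s t : is_subfield K -> F `<=` K ->
  {in s, forall x, separable_over K x} -> uniq t ->
  (forall x, x \in t -> gen_field (K `|` [set` s]) x) ->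
  (forall g x, fixes K g -> x \in t -> g x \in t) ->
  forall i, K (\prod_(a <- t) ('X - a%:P))`_i.
Proof.
move=> hK FK hs ut ts tst i; apply: (separable_fix_seq hK FK hs).
  have hG : is_subfield (gen_field (K `|` [set` s])) by exact: gen_subfield.
  by apply: prod_XsubC_coef.
move=> g gK; rewrite -coef_map map_XsubC_stable //; first exact: fmorph_inj.
by move=> a; exact: tst.
Qed.

Lemma separable_orbit K x : is_subfield K -> F `<=` K -> separable_over K x ->
  exists s, [/\ forall i, K (\prod_(a <- s) ('X - a%:P))`_i, uniq s, x \in s &
    forall y, y \in s -> exists2 g : {rmorphism Omega -> Omega}, fixes K g & y = g x].
Proof.
move=> hK FK [s [sK us xs]].
pose orb y := `[< exists2 g : {rmorphism Omega -> Omega}, fixes K g & y = g x >].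
exists [seq y <- s | orb y]; split.
- apply: (@stable_poly K s) => //.
  + by move=> y ys; exists s.
  + exact: filter_uniq.
  + by move=> y; rewrite mem_filter => /andP [_ ys]; apply: mem_gen_field; right.
  + move=> g y gK; rewrite !mem_filter => /andP [/asboolP [h hK' ->] ys].
    rewrite (root_conj sK gK ys) andbT; apply/asboolP.
    by exists (g \o h) => //; exact: fixes_comp.
- exact: filter_uniq.
- rewrite mem_filter xs andbT; apply/asboolP.
  by exists idfun.
- by move=> y; rewrite mem_filter => /andP [/asboolP [g gK ->] _]; exists g.
Qed.

(** The values of [op] on two root lists form a finite set stable under automorphisms. The operation
    is left abstract to serve subtraction and division at once. *)
Lemma separable_op K (op : Omega -> Omega -> Omega) :
  is_subfield K -> F `<=` K ->
  (forall X x y, is_subfield X -> X x -> X y -> X (op x y)) ->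
  (forall g, {morph g : x y / op x y}) ->
  forall x y, separable_over K x -> separable_over K y ->
    separable_over K (op x y).
Proof.
move=> hK FK opK gop x y [s [sK us xs]] [t [tK ut yt]].
exists (undup [seq op a b | a <- s, b <- t]); split.
- apply: (@stable_poly K (s ++ t)) => //.
  + move=> z; rewrite mem_cat => /orP [zs|zt]; first by exists s.
    by exists t.
  + exact: undup_uniq.
  + move=> z; rewrite mem_undup => /allpairsP [[a b] /= [ha hb ->]].
    by apply: (opK (gen_field _)); [exact: gen_subfield| |];
       apply: mem_gen_field; right; rewrite /= mem_cat ?ha ?hb ?orbT.
  + move=> g z gK; rewrite !mem_undup => /allpairsP [[a b] /= [ha hb ->]].
    by rewrite gop; apply: allpairs_f; apply: root_conj gK _ => //.
- exact: undup_uniq.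
- by rewrite mem_undup; exact: allpairs_f.
Qed.

Lemma separable_subfield K : is_subfield K -> F `<=` K ->
  is_subfield (separable_over K).
Proof.
move=> hK FK; apply/subfieldP; split.
- by apply: separable_self => //; exact: sf1.
- apply: (separable_op (op := fun x y => x - y)) => //.
    by move=> X x y hX; exact: sfB.
  by move=> g x y; rewrite rmorphB.
- apply: (separable_op (op := fun x y => x / y)) => //.
    by move=> X x y hX; exact: sf_div.
  by move=> g x y; rewrite fmorph_div.
Qed.

Lemma galois_extP K T : is_subfield K -> F `<=` K -> galois_ext K T <->
  [/\ is_subfield T, K `<=` T, T `<=` separable_over K & auto_stable K T].
Proof.
move=> hK FK; split=> [[_ hT KT h]|[hT KT Tsep Tst]].
  have h' x : T x -> exists s, [/\ forall i, K (\prod_(a <- s) ('X - a%:P))`_i,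
      uniq s, forall a, a \in s -> T a & x \in s].
    move=> /mem_set /h [s [/(polyOver_set hK) sK us sT xs]].
    by exists s; split=> // a /sT; rewrite inE.
  split=> //.
    by move=> x /h' [s [sK us _ xs]]; exists s.
  move=> g gK x /h' [s [sK us sT xs]]; apply: sT; exact: root_conj gK xs.
split=> // x /set_mem Tx.
have [s [sK us xs hs]] := separable_orbit hK FK (Tsep _ Tx).
exists s; split=> //; first exact/(polyOver_set hK).
by move=> a /hs [g gK ->]; apply/mem_set; exact: (Tst g gK).
Qed.

Lemma galois_gen K Y : is_subfield K -> F `<=` K -> Y `<=` separable_over K ->
  auto_stable K Y -> galois_ext K (gen_field (K `|` Y)).
Proof.
move=> hK FK Ysep Yst; apply/galois_extP => //; split.
- exact: gen_subfield.
- by move=> x Kx; apply: mem_gen_field; left.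
- apply: gen_min; first exact: separable_subfield.
  by move=> x [Kx|/Ysep //]; exact: separable_self.
- move=> g gK; apply: gen_stable => x [Kx|Yx]; apply: mem_gen_field.
    by left; rewrite gK.
  by right; exact: (Yst g gK).
Qed.

End Base.
End Separable.

(** * Infinite Galois theory *)

Section Separation.
Variable Omega : closedFieldType.

Fixpoint words (T : Type) (s : seq T) n : seq (seq T) :=
  if n is n'.+1 then [seq x :: l | x <- s, l <- words s n'] else [:: [::]].

Lemma mem_words (T : eqType) (s l : seq T) :
  {subset l <= s} -> l \in words s (size l).
Proof.
elim: l => [|x l IH] ls; first by rewrite mem_head.
apply/allpairsP; exists (x, l); split=> //=; first by apply: ls; exact: mem_head.
by apply: IH => y yl; apply: ls; rewrite inE yl orbT.
Qed.

Lemma Poly_inj (l l' : seq Omega) : size l = size l' -> Poly l = Poly l' -> l = l'.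
Proof.
move=> sl e; apply: (eq_from_nth (x0 := 0)) => // i _.
by rewrite -(coef_Poly l) -(coef_Poly l') e.
Qed.

(* The polynomial in two variables prod_h (X - sum_i h(s_i) Y^i) is invariant
   under H, and its coefficients are moved by every automorphism which agrees
   on s with no element of H. *)
Lemma moved_fixed_point (H : set {rmorphism Omega -> Omega}) (X : set Omega)
    (s : seq Omega) (g : {rmorphism Omega -> Omega}) :
  is_subfield X -> (forall a, a \in s -> X a) ->
  H idfun -> (forall h h', H h -> H h' -> H (h \o h')) ->
  (forall h a, H h -> a \in s -> h a \in s) ->
  (forall h, H h -> ~ {in s, g =1 h}) ->
  exists x, [/\ X x, forall h, H h -> h x = x & g x <> x].
Proof.
move=> hX sX H1 HM Hs gH.
(* The orbit of the tuple [s] under [H], each tuple being coded as a univariate polynomial; it is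
   finite because [H] preserves [s]. *)
pose u := undup [seq Poly l | l <- words s (size s) &
  `[< exists2 h : {rmorphism Omega -> Omega}, H h & l = map h s >]].
have uP w : w \in u <->
    exists2 h : {rmorphism Omega -> Omega}, H h & w = Poly (map h s).
  rewrite mem_undup; split.
    move=> /mapP [l]; rewrite mem_filter => /andP [/asboolP [h Hh ->] _] ->.
    by exists h.
  case=> h Hh ->; apply: map_f; rewrite mem_filter; apply/andP; split.
    by apply/asboolP; exists h.
  rewrite -(size_map h s); apply: mem_words => _ /mapP [a ha ->].
  exact: Hs.
have mapPoly (h : {rmorphism Omega -> Omega}) l :
    map_poly h (Poly l) = Poly (map h l).
  apply/polyP => i; rewrite coef_map !coef_Poly /=.
  have [il|il] := ltnP i (size l); first by rewrite (nth_map 0).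
  by rewrite !nth_default ?size_map // rmorph0.
pose Q := \prod_(w <- u) ('X - w%:P).
have Qfix h : H h -> map_poly (map_poly h) Q = Q.
  move=> Hh; apply: map_XsubC_stable.
  - by apply: map_inj_poly; [exact: fmorph_inj|exact: rmorph0].
  - exact: undup_uniq.
  - move=> w /uP [h' Hh' ->]; rewrite /= mapPoly; apply/uP.
    by exists (h \o h'); [exact: HM|rewrite -map_comp].
have QX i : Q`_i \is a polyOver (sf_pred hX).
  move: i; rewrite /Q big_seq_cond.
  apply: (big_ind (fun q : {poly {poly Omega}} =>
    forall i, q`_i \is a polyOver (sf_pred hX))).
  - by move=> i; rewrite coef1; exact: rpred_nat.
  - by move=> q r hq hr i; rewrite coefM; apply: rpred_sum => j _; exact: rpredM.
  move=> w /andP [/uP [h Hh ->] _] i; rewrite coefB coefX coefC.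
  apply: rpredB; first exact: rpred_nat.
  case: ifP => _; last exact: rpred0.
  apply/polyOverP => j; rewrite coef_Poly inE.
  have [il|il] := ltnP j (size s); last first.
    by rewrite nth_default ?size_map //; exact: sf0.
  by rewrite (nth_map 0) //; apply/sX/Hs => //; exact: mem_nth.
have [i [j gij]] : exists i j, g (Q`_i)`_j <> (Q`_i)`_j.
  apply: contrapT => no.
  (* If [g] fixed every coefficient of [Q] it would permute its roots, so it would send [Poly s] to
     some [Poly (map h s)] and agree with [h] on [s]. *)
  have gQ : map_poly (map_poly g) Q = Q.
    apply/polyP => i; apply/polyP => j; rewrite !coef_map /=.
    by apply: contrapT => ne; apply: no; exists i, j.
  have vu : Poly s \in u.
    by apply/uP; exists idfun => //; rewrite map_id.
  have : map_poly g (Poly s) \in u.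
    move: vu; rewrite -!root_prod_XsubC -/Q => /rootP Qv.
    by rewrite /root -{1}gQ horner_map /= Qv rmorph0.
  move=> /uP [h Hh]; rewrite mapPoly => /Poly_inj; rewrite !size_map => /(_ erefl).
  move=> /eq_in_map e; exact: (gH h Hh).
exists (Q`_i)`_j; split=> //.
  by have /polyOverP /(_ j) := QX i; rewrite inE.
by move=> h Hh; rewrite -[in RHS](Qfix h Hh) !coef_map.
Qed.

End Separation.

Section Galois.
Variable Omega : closedFieldType.
Implicit Types (K T X : set Omega) (g h : {rmorphism Omega -> Omega}).

Fixpoint auto_iter g k : {rmorphism Omega -> Omega} :=
  if k is k'.+1 then g \o auto_iter g k' else idfun.

Lemma auto_iterE g k : auto_iter g k = iter k g :> (Omega -> Omega).
Proof. by elim: k => [|k IH] //=; rewrite IH. Qed.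

Lemma res_galE T f x : T x -> res_gal T f x = f x.
Proof. by move=> /mem_set Tx; rewrite /res_gal Tx. Qed.

Lemma res_gal_out T f x : ~ T x -> res_gal T f x = x.
Proof. by rewrite /res_gal; case: ifPn => // /set_mem Tx nTx. Qed.

Lemma res_gal_eq T (f f' : Omega -> Omega) : (forall x, T x -> f x = f' x) ->
  res_gal T f = res_gal T f'.
Proof.
move=> h; apply/funext => x; rewrite /res_gal; case: ifP => // /set_mem.
exact: h.
Qed.

Lemma res_gal_inj T (f f' : Omega -> Omega) : res_gal T f = res_gal T f' ->
  forall x, T x -> f x = f' x.
Proof. by move=> e x Tx; have := congr1 (@^~ x) e; rewrite /= !res_galE. Qed.

Lemma res_gal_comp T (f f' : Omega -> Omega) : (forall x, T x -> T (f' x)) ->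
  res_gal T (f \o f') = res_gal T f \o res_gal T f'.
Proof.
move=> h; apply/funext => x /=; have [Tx|nTx] := pselect (T x).
  by rewrite !res_galE //; apply: h.
by rewrite !res_gal_out.
Qed.

Lemma res_gal_iter T (f : Omega -> Omega) k : (forall x, T x -> T (f x)) ->
  res_gal T (iter k f) = iter k (res_gal T f).
Proof.
move=> h; elim: k => [|k IH].
  by apply/funext => x; rewrite /res_gal; case: ifP.
rewrite (_ : iter k.+1 f = f \o iter k f) // res_gal_comp ?IH // => x Tx.
by elim: k {IH} => [|k IH] //=; exact: h.
Qed.

Section Base.
Variable F : set Omega.
Hypothesis Falg : forall x, exists q : {poly Omega},
  [/\ q != 0, forall i, F q`_i & root q x].

Lemma auto_inv K g : F `<=` K -> fixes K g ->
  exists h, [/\ fixes K h, cancel g h & cancel h g].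
Proof.
move=> FK gK; have [|h [gh hg]] := auto_inverse Falg (g := g).
  by move=> x /FK; exact: gK.
by exists h; split=> // x Kx; rewrite -{1}(gK x Kx) gh.
Qed.

Lemma res_gal_gal K T g : F `<=` K -> auto_stable K T -> is_subfield T ->
  K `<=` T -> fixes K g -> gal_group T K (res_gal T g).
Proof.
move=> FK Tst hT KT gK; have [h [hK gh hg]] := auto_inv FK gK.
split.
- split.
  + by move=> x Tx; rewrite res_galE //; exact: (Tst g gK).
  + move=> x y /set_mem Tx /set_mem Ty; rewrite !res_galE //.
    exact: fmorph_inj.
  + by move=> y Ty; exists (h y); [exact: (Tst h hK)|rewrite res_galE ?hg //;
      exact: (Tst h hK)].
- by move=> x y /set_mem Tx /set_mem Ty; rewrite !res_galE ?rmorphD //; exact: sfD.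
- by move=> x y /set_mem Tx /set_mem Ty; rewrite !res_galE ?rmorphM //; exact: sfM.
- by move=> x /set_mem Kx; rewrite res_galE ?gK //; exact: KT.
- by move=> x nTx; rewrite res_gal_out // => /mem_set; rewrite (negPf nTx).
Qed.

Lemma gal_extend K T (sigma : Omega -> Omega) : F `<=` K -> K `<=` T ->
  is_subfield K -> is_subfield T -> gal_group T K sigma ->
  exists g, fixes K g /\ sigma = res_gal T g.
Proof.
move=> FK KT hK hT [sbij sD sM sK sout].
have [|||||g hg] := extend_hom Falg (K := T) (f := sigma).
- exact: hT.
- exact: subset_trans KT.
- exact: (sK 1 (mem_set (sf1 hK))).
- by move=> x y Tx Ty; apply: sD; exact: mem_set.
- by move=> x y Tx Ty; apply: sM; exact: mem_set.
exists g; split; first by move=> x Kx; rewrite hg; [exact: (sK x (mem_set Kx))|exact: KT].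
apply/funext => x; rewrite /res_gal; case: ifPn => [/set_mem Tx|nTx].
  by rewrite hg.
exact: sout.
Qed.

Lemma gal_group_res K T sigma : F `<=` K -> galois_ext K T ->
  gal_group T K sigma <-> exists g, fixes K g /\ sigma = res_gal T g.
Proof.
move=> FK gal; have [hK _ _ _] := gal.
have [hT KT _ Tst] := (galois_extP Falg T hK FK).1 gal.
split; first exact: gal_extend.
by move=> [g [gK ->]]; exact: res_gal_gal.
Qed.

Lemma finite_orbit K x : F `<=` K -> exists s : seq Omega, x \in s /\
  forall g, fixes K g -> g x \in s.
Proof.
move=> FK; have [q [q0 qF qx]] := Falg x.
have [r qr] := closed_field_poly_normal q.
have rP y : (y \in r) = root q y.
  by rewrite qr rootZ ?lead_coef_eq0 // root_prod_XsubC.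
exists r; split=> [|g gK]; first by rewrite rP.
rewrite rP -(_ : map_poly g q = q) ?fmorph_root //.
by apply/polyP => i; rewrite coef_map; apply/gK/FK.
Qed.

(** One implication suffices, as [g] and [h] may be exchanged: membership among the automorphisms
    over [K] depends only on the values on a finite list. *)
Definition locally_constant K (U : set {rmorphism Omega -> Omega}) : Prop :=
  exists s : seq Omega, forall g h, fixes K g -> fixes K h ->
    {in s, g =1 h} -> U g -> U h.

(* Compactness of the absolute Galois group of K, as an ultrafilter limit:
   each x has finitely many conjugates, so g x has a constant value on a
   member of the ultrafilter. *)
Lemma auto_compact K (I : Type) (D : set I)
    (U : I -> set {rmorphism Omega -> Omega}) : F `<=` K ->
  (forall i, D i -> locally_constant K (U i)) ->
  (forall l : seq I, (forall i, List.In i l -> D i) ->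
     exists g, fixes K g /\ forall i, List.In i l -> U i g) ->
  exists g, fixes K g /\ forall i, D i -> U i g.
Proof.
move=> FK Uloc fip.
pose Phi : set_system {rmorphism Omega -> Omega} := [set A |
  exists2 l : seq I, (forall i, List.In i l -> D i) &
  forall g, fixes K g -> (forall i, List.In i l -> U i g) -> A g].
have PhiP : ProperFilter Phi.
  apply: Build_ProperFilter_ex.
    by move=> A [l lD lA]; have [g [gK gU]] := fip l lD; exists g; exact: lA.
  split.
  - by exists [::].
  - move=> A B [l lD lA] [l' lD' lB]; exists (l ++ l').
      by move=> i /List.in_app_iff [/lD|/lD'].
    move=> g gK gU; split; [apply: lA|apply: lB] => // i hi; apply: gU;
      apply/List.in_app_iff; [by left|by right].
  - by move=> A B AB [l lD lA]; exists l => // g gK gU; apply/AB/lA.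
have [G [GU GPhi]] := ultraFilterLemma PhiP.
have GK : G [set g | fixes K g] by apply: GPhi; exists [::].
have lim x : exists y, G [set g : {rmorphism Omega -> Omega} | g x = y].
  have [s [_ xs]] := finite_orbit x FK.
  apply: contrapT => no.
  have : G [set g : {rmorphism Omega -> Omega} | g x \notin s].
    elim: s {xs} => [|y s IH]; first by apply: filterS filterT.
    have ny : G (~` [set g : {rmorphism Omega -> Omega} | g x = y]).
      by case: (in_ultra_setVsetC [set g : {rmorphism Omega -> Omega} | g x = y] GU) => // h;
         case: no; exists y.
    apply: filterS2 ny IH => g /= ny; rewrite inE negb_or => ->; rewrite andbT.
    exact/eqP.
  move=> h; have [g [gK /=]] := filter_ex (filterI GK h).
  by rewrite xs.
have [f hf] := choice lim.
have pick A : G A -> exists2 g : {rmorphism Omega -> Omega}, fixes K g & A g.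
  by move=> GA; have [g [gK Ag]] := filter_ex (filterI GK GA); exists g.
have [|||g fg] := rmorphism_of (f := f) _ _ _.
- by have [g _ /= <-] := pick _ (hf 1); rewrite rmorph1.
- move=> x y; have [g _ [[/= <- <-] <-]] :=
    pick _ (filterI (filterI (hf (x - y)) (hf x)) (hf y)).
  by rewrite rmorphB.
- move=> x y; have [g _ [[/= <- <-] <-]] :=
    pick _ (filterI (filterI (hf (x * y)) (hf x)) (hf y)).
  by rewrite rmorphM.
have gK : fixes K g.
  by move=> x Kx; rewrite -fg; have [h hK /= <-] := pick _ (hf x); rewrite hK.
exists g; split=> // i Di.
have [s hs] := Uloc i Di.
have GUi : G (U i).
  by apply: GPhi; exists [:: i] => [j [<-|] //|h hK]; apply; left.
have Gs : G [set h : {rmorphism Omega -> Omega} | {in s, h =1 g}].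
  elim: s {hs} => [|x s IH]; first by apply: filterS filterT.
  apply: filterS2 (hf x) IH => h /= hx hs y; rewrite inE => /orP [/eqP ->|/hs //].
  by rewrite hx fg.
have [h hK [Uh hg]] := pick _ (filterI GUi Gs).
exact: (hs h g).
Qed.

End Base.
End Galois.

(** * Finite Galois extensions *)

Section Artin.
Variable Omega : closedFieldType.
Implicit Types (K T X : set Omega) (g h : {rmorphism Omega -> Omega}).

(** Dedekind's argument: in a relation with two nonzero coefficients, substitute [y * x] for [x] and
    subtract [g i0 y] times the relation, where [y] separates two of the maps; fewer coefficients
    remain. *)
Lemma char_independence T d (g : 'I_d -> {rmorphism Omega -> Omega}) :
  is_subfield T ->
  (forall i j, (forall x, T x -> g i x = g j x) -> i = j) ->
  forall c : 'I_d -> Omega, (forall x, T x -> \sum_i c i * g i x = 0) ->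
  forall i, c i = 0.
Proof.
move=> hT ginj c.
have [n] := ubnP #|[pred i | c i != 0]|; elim: n c => // n IH c cn h i0.
apply/eqP; apply: contraT => ci0.
have [[i1 [i10 ci1]]|no] := pselect (exists i1, i1 != i0 /\ c i1 != 0).
  have [y [Ty gy]] : exists y, T y /\ g i1 y != g i0 y.
    apply: contrapT => no; move/eqP: i10; apply; apply: ginj => x Tx.
    by apply/eqP; apply: contraT => ne; case: no; exists x.
  suff /eqP : c i1 * (g i1 y - g i0 y) = 0.
    by rewrite mulf_eq0 (negPf ci1) subr_eq0 (negPf gy).
  apply: (IH (fun i => c i * (g i y - g i0 y))).
    rewrite -ltnS; apply: leq_trans cn; rewrite ltnS; apply: proper_card.
    apply/properP; split.
      by apply/fintype.subsetP => i; rewrite !inE mulf_eq0 negb_or => /andP [].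
    by exists i0; rewrite !inE // subrr mulr0 eqxx.
  move=> x Tx; rewrite (eq_bigr (fun i =>
      c i * g i (y * x) - g i0 y * (c i * g i x))) => [|i _]; last first.
    by rewrite rmorphM; ring.
  rewrite sumrB -mulr_sumr !h ?mulr0 ?subr0 //; exact: sfM.
have := h 1 (sf1 hT); rewrite (bigD1 i0) //= big1 => [|i ii0].
  by rewrite addr0 rmorph1 mulr1 => /eqP; rewrite (negPf ci0).
by have [->|ci] := eqVneq (c i) 0; [rewrite mul0r|case: no; exists i].
Qed.

(** Greedy choice: fewer than [d] rows all annihilate some nonzero column [c]; a row [f v] not
    annihilating [c] is independent of them. *)
Lemma exists_row_free d (V : set Omega) (f : Omega -> 'rV[Omega]_d) :
  (forall c : 'cV[Omega]_d, (forall v, V v -> f v *m c = 0) -> c = 0) ->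
  forall k, (k <= d)%N -> exists e : 'I_k -> Omega, (forall i, V (e i)) /\
    row_free (\matrix_i f (e i)).
Proof.
move=> hV; elim=> [|k IH] kd.
  exists (fun i => 0); split=> [[]//|].
  by apply: inj_row_free => v _; exact: thinmx0.
have [e [eV efree]] := IH (ltnW kd).
set M := \matrix_i f (e i) in efree.
have [c [c0 Mc]] : exists c : 'cV[Omega]_d, c != 0 /\ M *m c = 0.
  have : cokermx M != 0.
    by rewrite -mxrank_eq0 mxrank_coker (eqP efree) subn_eq0 -ltnNge.
  move=> /matrix0Pn [i [j hij]]; exists (col j (cokermx M)); split.
    by apply/matrix0Pn; exists i, 0; rewrite mxE.
  by rewrite colE mulmxA mulmx_coker mul0mx.
have [v [Vv vc]] : exists v, V v /\ f v *m c != 0.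
  apply: contrapT => no; move/eqP: c0; apply; apply: hV => v Vv.
  by apply/eqP; apply: contraT => ne; case: no; exists v.
exists (fun i => if unlift ord0 i is Some j then e j else v); split.
  by move=> i; case: unliftP => [j _|_].
rewrite (_ : \matrix_i _ = col_mx (f v) M :> 'M_(1 + k, d)); last first.
  apply/row_matrixP => i; rewrite rowK -[i](@splitK 1 k).
  case: (@fintype.split 1 k i) => j /=.
    rewrite rowKu ord1 (_ : lshift k (0 : 'I_1) = ord0 :> 'I_k.+1); last exact: val_inj.
    by rewrite unlift_none row_id.
  rewrite rowKd (_ : rshift 1 j = lift ord0 j :> 'I_k.+1); last exact: val_inj.
  by rewrite liftK rowK.
apply: (@inj_row_free _ (1 + k)) => u; rewrite -[u]hsubmxK mul_row_col => hu.
have a0 : lsubmx u = 0.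
  have : (lsubmx u *m f v + rsubmx u *m M) *m c = 0 by rewrite hu mul0mx.
  rewrite mulmxDl -!mulmxA Mc mulmx0 addr0 => /matrixP /(_ 0 0).
  rewrite [lsubmx u]mx11_scalar mul_scalar_mx !mxE => /eqP.
  rewrite mulf_eq0 => /orP [/eqP ->|/eqP fvc].
    by rewrite raddf0.
  case/eqP: vc; apply/matrixP => i j; rewrite !ord1 [RHS]mxE -fvc.
  by rewrite !mxE.
rewrite a0 mul0mx add0r in hu.
rewrite a0 (row_free_inj efree (x1 := rsubmx u) (x2 := 0)) ?row_mx0 // hu mul0mx //.
Qed.

(** Independence of characters gives elements [e i] whose matrix M = (g_j(e_i)) is invertible; the
    coordinates of [x] are the row (g_j(x)) times the inverse of M. Each [g l] permutes the columns
    of both, so it fixes the coordinates, which therefore lie in [K]. *)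
Lemma artin K T d (g : 'I_d -> {rmorphism Omega -> Omega}) :
  is_subfield T -> K `<=` T ->
  (forall i, fixes K (g i)) -> (forall i x, T x -> T (g i x)) ->
  (forall i j, (forall x, T x -> g i x = g j x) -> i = j) ->
  (exists i, forall x, T x -> g i x = x) ->
  (forall i j, exists k, forall x, T x -> g i (g j x) = g k x) ->
  (forall x, T x -> (forall i, g i x = x) -> K x) ->
  ext_degree K T d.
Proof.
move=> hT KT gK gT ginj [i0 gi0] gM gfix.
pose row_of x : 'rV[Omega]_d := \row_j g j x.
have [|e [eT efree]] := @exists_row_free d T row_of _ d (leqnn d).
  move=> c hc; apply/matrixP => i j; rewrite ord1 [RHS]mxE.
  apply: (char_independence hT ginj (c := fun i => c i 0)) => x Tx.
  have /matrixP /(_ 0 0) := hc x Tx; rewrite mxE [RHS]mxE => e0; rewrite -[RHS]e0.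
  by apply: eq_bigr => k _; rewrite mxE mulrC.
set M := \matrix_i row_of (e i) in efree.
have Mu : M \in unitmx by rewrite -row_free_unit.
have ME i j : M i j = g j (e i) by rewrite !mxE.
have coord x (a : 'I_d -> Omega) : (forall i, K (a i)) -> x = \sum_i a i * e i ->
    \row_i a i = row_of x *m invmx M.
  move=> aK xe; rewrite -[LHS](mulmxK Mu); congr (_ *m _).
  apply/rowP => j; rewrite !mxE xe rmorph_sum; apply: eq_bigr => i _.
  by rewrite rmorphM (gK j _ (aK i)) mxE ME.
exists e; first by move=> i; apply/mem_set.
move=> x /set_mem Tx.
pose a := row_of x *m invmx M.
have aM : a *m M = row_of x by rewrite /a mulmxKV.
have aT i : T (a 0 i).
  have [M' hM'] : exists M' : 'M[sf_type hT]_d, map_mx (@sf_val _ _ hT) M' = M.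
    have h (ij : 'I_d * 'I_d) : exists y', @sf_val _ _ hT y' = M ij.1 ij.2.
      by apply: sf_val_surj; rewrite ME; exact: gT.
    have [f hf] := choice h; exists (\matrix_(i, j) f (i, j)).
    by apply/matrixP => k l; rewrite !mxE hf ?mxE.
  have [X' hX'] : exists X' : 'rV[sf_type hT]_d, map_mx (@sf_val _ _ hT) X' = row_of x.
    have h (j : 'I_d) : exists y', @sf_val _ _ hT y' = g j x.
      by apply: sf_val_surj; exact: gT.
    have [f hf] := choice h; exists (\row_j f j).
    by apply/matrixP => k l; rewrite !mxE hf.
  rewrite /a -hM' -hX' -map_invmx -map_mxM mxE; exact: sf_valP.
have afix l i : g l (a 0 i) = a 0 i.
  have [f hf] := choice (gM l).
  have finj : injective f.
    move=> j j' ff; apply: ginj => y Ty; apply: (fmorph_inj (g l)).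
    by rewrite !hf // ff.
  have [f' ff' f'f] := injF_bij finj.
  have : map_mx (g l) a *m M = row_of x.
    apply/rowP => k; rewrite -[k]f'f !mxE -hf // /row_of.
    have /rowP /(_ (f' k)) := aM; rewrite [RHS]mxE => <-.
    rewrite [in RHS]mxE rmorph_sum; apply: eq_bigr => j _.
    by rewrite !mxE rmorphM -hf.
  move=> h; have := congr1 (fun B => B *m invmx M) h; rewrite mulmxK //.
  by move=> /rowP /(_ i); rewrite mxE.
have aK i : K (a 0 i) by apply: gfix.
exists [ffun i => a 0 i]; split.
  split; first by move=> i; rewrite ffunE; apply/mem_set.
  have /rowP /(_ i0) := aM; rewrite mxE [in RHS]mxE gi0 // => <-.
  by apply: eq_bigr => i _; rewrite ffunE ME gi0.
move=> b [bK xb]; apply/ffunP => i; rewrite ffunE.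
have := coord x b _ xb => /(_ (fun i => set_mem (bK i))) /rowP /(_ i).
by rewrite mxE => ->.
Qed.

Lemma ext_degree_le K T d d' : is_subfield K -> ext_degree K T d ->
  ext_degree K T d' -> (d <= d')%N.
Proof.
move=> hK [e eT eP] [e' eT' eP'].
have hA i : exists a : {ffun 'I_d' -> Omega},
    (forall j, K (a j)) /\ e i = \sum_j a j * e' j.
  have [a [[aK ea] _]] := eP' _ (eT i); exists a; split=> // j.
  exact: set_mem (aK j).
have hB j : exists b : {ffun 'I_d -> Omega},
    (forall i, K (b i)) /\ e' j = \sum_i b i * e i.
  have [b [[bK eb] _]] := eP _ (eT' j); exists b; split=> // i.
  exact: set_mem (bK i).
have [A hA'] := choice hA; have [B hB'] := choice hB.
pose MA := \matrix_(i, j) A i j; pose MB := \matrix_(j, i) B j i.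
suff AB : MA *m MB = 1%:M.
  exact: mulmx1_min AB.
apply/matrixP => i k; rewrite !mxE.
have [a [_ au]] := eP _ (eT i).
have h1 : a = [ffun k => \sum_j A i j * B j k].
  apply: au; split.
    move=> l; rewrite ffunE; apply/mem_set/(sf_sum hK) => j _.
    by apply: (sfM hK); [exact: (hA' i).1|exact: (hB' j).1].
  rewrite {1}(hA' i).2 (eq_bigr (fun j => \sum_l A i j * B j l * e l)).
    rewrite exchange_big; apply: eq_bigr => l _; rewrite ffunE mulr_suml //.
  move=> j _; rewrite {1}(hB' j).2 mulr_sumr; apply: eq_bigr => l _.
  by rewrite mulrA.
have h2 : a = [ffun k => (i == k)%:R].
  apply: au; split.
    by move=> l; rewrite ffunE; apply/mem_set; case: eqP => _;
      [exact: sf1|exact: sf0].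
  rewrite (bigD1 i) //= ffunE eqxx mul1r big1 ?addr0 // => l li.
  by rewrite ffunE eq_sym (negPf li) mul0r.
have := congr1 (fun f : {ffun 'I_d -> Omega} => f k) h2.
by rewrite h1 !ffunE => <-; apply: eq_bigr => j _; rewrite !mxE.
Qed.

Lemma ext_degree_uniq K T d d' : is_subfield K -> ext_degree K T d ->
  ext_degree K T d' -> d = d'.
Proof.
move=> hK hd hd'; apply/eqP; rewrite eqn_leq.
by rewrite (ext_degree_le hK hd hd') (ext_degree_le hK hd' hd).
Qed.

End Artin.

Section FiniteGalois.
Variable Omega : closedFieldType.
Implicit Types (K T X : set Omega) (g h : {rmorphism Omega -> Omega}).

Lemma iter_period (f : Omega -> Omega) k l x :
  iter k f x = x -> iter (k * l) f x = x.
Proof.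
by move=> h; rewrite mulnC iterM; elim: l => //= l ->; rewrite h.
Qed.

Lemma iter_p_add (f : Omega -> Omega) p j k x :
  iter (p ^ j) f x = x -> iter (p ^ (j + k)) f x = x.
Proof. by rewrite expnD; exact: iter_period. Qed.

Section Base.
Variable F : set Omega.
Hypothesis Falg : forall x, exists q : {poly Omega},
  [/\ q != 0, forall i, F q`_i & root q x].

Section Group.
Variables (K T : set Omega) (s : seq Omega).
Hypotheses (FK : F `<=` K) (gal : galois_ext K T) (sT : forall a, a \in s -> T a)
  (s_stable : forall g a, fixes K g -> a \in s -> g a \in s)
  (s_gen : forall g h, fixes K g -> fixes K h -> {in s, g =1 h} ->
    forall x, T x -> g x = h x).

(** The Galois group of [T] over [K], realized on a finite stable list so that Lagrange and Cauchy
    apply. As [permM] composes from left to right, products correspond to compositions in reversed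
    order. *)
Definition root_perms : {set {perm seq_sub s}} :=
  [set pi : {perm seq_sub s} | `[< exists g : {rmorphism Omega -> Omega},
    fixes K g /\ forall a, g (ssval a) = ssval (pi a) >]].

Lemma root_permsP (pi : {perm seq_sub s}) : reflect (exists g : {rmorphism Omega -> Omega},
    fixes K g /\ forall a, g (ssval a) = ssval (pi a)) (pi \in root_perms).
Proof. by rewrite finset.in_set; exact: asboolP. Qed.

Lemma root_perms_group : group_set root_perms.
Proof.
apply/group_setP; split.
  by apply/root_permsP; exists idfun; split=> // a; rewrite perm1.
move=> pi pi' /root_permsP [g [gK gpi]] /root_permsP [h [hK hpi]].
apply/root_permsP; exists (h \o g); split; first exact: fixes_comp.
by move=> a; rewrite /= gpi hpi permM.
Qed.
Canonical root_perms_groupType := Group root_perms_group.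

Lemma root_perm_exists g : fixes K g ->
  exists2 pi, pi \in root_perms & forall a, g (ssval a) = ssval (pi a).
Proof.
move=> gK.
have h (a : seq_sub s) : g (ssval a) \in s by apply: s_stable => //; exact: ssvalP.
have finj : injective (fun a => SeqSub (h a)).
  by move=> a b [] /fmorph_inj; exact: val_inj.
exists (perm finj); last by move=> a; rewrite permE.
by apply/root_permsP; exists g; split=> // a; rewrite permE.
Qed.

Lemma root_perm_iter g (pi : {perm seq_sub s}) k a :
  (forall a, g (ssval a) = ssval (pi a)) ->
  iter k g (ssval a) = ssval ((pi ^+ k)%g a).
Proof.
move=> gpi; elim: k => [|k IH]; first by rewrite expg0 perm1.
by rewrite iterS IH gpi expgSr permM.
Qed.

Lemma finite_galois_degree : ext_degree K T #|root_perms|.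
Proof.
have [hK hT KT _] := gal.
have [_ _ Tsep Tst] := (galois_extP Falg T hK FK).1 gal.
have hrep (i : 'I_#|root_perms|) : exists g : {rmorphism Omega -> Omega},
    fixes K g /\ forall a, g (ssval a) = ssval ((enum_val i : {perm _}) a).
  by have /root_permsP := enum_valP i.
have [g hg] := choice hrep.
have find h : fixes K h -> exists i, forall x, T x -> h x = g i x.
  move=> hfK; have [pi piG hpi] := root_perm_exists hfK.
  exists (enum_rank_in piG pi) => x Tx; apply: s_gen => //; first exact: (hg _).1.
  by move=> a sa; rewrite -[a]/(ssval (SeqSub sa)) hpi (hg _).2 enum_rankK_in.
apply: (artin (g := g)) => //.
- by move=> i; exact: (hg i).1.
- by move=> i x Tx; exact: (Tst _ (hg i).1).
- move=> i j gij; apply: enum_val_inj; apply/permP => a; apply: val_inj.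
  by rewrite /= -(hg i).2 -(hg j).2 gij //; apply: sT; exact: ssvalP.
- have [i hi] := find idfun (fun x _ => erefl); exists i => x Tx.
  by rewrite -hi.
- move=> i j; have [k hk] := find (g i \o g j) (fixes_comp (hg i).1 (hg j).1).
  by exists k => x Tx; rewrite -hk.
- move=> x Tx gx; apply: (separable_fix Falg hK FK (Tsep _ Tx)) => h hfK.
  by have [i hi] := find h hfK; rewrite hi.
Qed.
End Group.

(** The conjugates of a basis carry a permutation group whose order is the degree, by uniqueness of
    the degree; Lagrange's theorem then gives the period. *)
Lemma galois_p_degree_period K T p k g x : F `<=` K -> galois_ext K T ->
  ext_degree K T (p ^ k) -> fixes K g -> T x -> iter (p ^ k) g x = x.
Proof.
move=> FK gal deg gK Tx; have [hK hT KT hs] := gal.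
have [e eT eP] := deg.
have hr i : exists s : seq Omega, [/\ forall j, K (\prod_(a <- s) ('X - a%:P))`_j,
    forall a, a \in s -> T a & e i \in s].
  have [s [/(polyOver_set hK) sK us sT es]] := hs _ (eT i).
  by exists s; split=> // a /sT; rewrite inE.
have [r hr'] := choice hr.
pose s := undup (flatten [seq r i | i <- enum 'I_(p ^ k)]).
have sP a : a \in s <-> exists i, a \in r i.
  rewrite mem_undup; split.
    by move=> /flatten_mapP [i _ ai]; exists i.
  by move=> [i ai]; apply/flatten_mapP; exists i; rewrite ?mem_enum.
have sT a : a \in s -> T a by move=> /sP [i]; case: (hr' i) => _ h _; exact: h.
have sst h a : fixes K h -> a \in s -> h a \in s.
  move=> hfK /sP [i ai]; apply/sP; exists i.
  by case: (hr' i) => h1 _ _; exact: root_conj h1 hfK ai.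
have sgen h h' : fixes K h -> fixes K h' -> {in s, h =1 h'} ->
    forall y, T y -> h y = h' y.
  move=> hfK hfK' hh y /mem_set Ty; have [a [[aK ->] _]] := eP _ Ty.
  rewrite !rmorph_sum; apply: eq_bigr => i _; rewrite !rmorphM.
  have aKi := set_mem (aK i).
  by rewrite hfK // hfK' // hh //; apply/sP; exists i; case: (hr' i).
have cardG := ext_degree_uniq hK (finite_galois_degree FK gal sT sst sgen) deg.
have [pi piG hpi] := root_perm_exists sst gK.
have pi1 : (pi ^+ (p ^ k) = 1)%g.
  rewrite -cardG; exact: (expg_cardG (G := root_perms_groupType K s)).
rewrite -auto_iterE -[RHS](erefl : idfun x = x).
apply: (sgen (auto_iter g (p ^ k)) idfun) => //.
  by rewrite auto_iterE; exact: fixes_iter.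
move=> a sa; rewrite auto_iterE -[a]/(ssval (SeqSub sa)).
by rewrite (root_perm_iter _ _ hpi) pi1 perm1.
Qed.

(** The periods at [x] pass to its conjugates by conjugating automorphisms, so every permutation has
    [p]-power order. By Cauchy's theorem no prime other than [p] divides the order of the group. *)
Lemma p_period_degree K x p : prime p -> is_subfield K -> F `<=` K ->
  separable_over K x ->
  (forall g, fixes K g -> exists j, iter (p ^ j) g x = x) ->
  exists T, [/\ galois_ext K T, exists k, ext_degree K T (p ^ k) & x \in T].
Proof.
move=> p_pr hK FK xsep xper.
have [s [sK us xs hs]] := separable_orbit Falg hK FK xsep.
have sst g a : fixes K g -> a \in s -> g a \in s.
  by move=> gK; exact: root_conj sK gK.
set T := gen_field (K `|` [set` s]).
have gal : galois_ext K T.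
  apply: (galois_gen Falg) => //.
    by move=> a /= sa; exists s.
  by move=> g gK a /=; exact: sst.
have sT a : a \in s -> T a.
  by move=> sa; rewrite /T; apply: mem_gen_field; right.
have sgen g h : fixes K g -> fixes K h -> {in s, g =1 h} ->
    forall y, T y -> g y = h y.
  move=> gK hfK gh y Ty; have [h' [hK' hh' h'h]] := auto_inv Falg FK hfK.
  suff e : (h' \o g) y = y by rewrite -[in RHS]e /= h'h.
  apply: (fixes_gen (X := K `|` [set` s]) (g := h' \o g)) => // z [Kz|sz] /=.
    by rewrite gK // hK'.
  by rewrite gh // hh'.
exists T; split=> //; last by apply: mem_set; exact: sT.
have deg := finite_galois_degree FK gal sT sst sgen.
suff : p.-nat #|root_perms K s|.
  by move=> /p_natP [k ek]; exists k; rewrite -ek.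
apply/pnatP => [|r r_pr rG].
  exact: (cardG_gt0 (root_perms_groupType K s)).
have [pi piG opi] := Cauchy (G := root_perms_groupType K s) r_pr rG.
have /root_permsP [g [gK gpi]] := piG.
have per a : a \in s -> exists j, iter (p ^ j) g a = a.
  move=> /hs [h hfK ->]; have [h' [hK' hh' h'h]] := auto_inv Falg FK hfK.
  have [|j hj] := xper (h' \o (g \o h)); first by apply: fixes_comp => //; exact: fixes_comp.
  have e m : iter m g (h x) = h (iter m (h' \o (g \o h)) x).
    by elim: m => //= m ->; rewrite h'h.
  by exists j; rewrite e hj.
have [J hJ] : exists J, forall a, a \in s -> iter (p ^ J) g a = a.
  elim: (s) per => [|a l IH] per; first by exists 0%N.
  have [|J hJ] := IH; first by move=> b bl; apply: per; rewrite inE bl orbT.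
  have [j hj] := per a (mem_head _ _).
  exists (j + J)%N => b; rewrite inE => /orP [/eqP ->|bl].
    exact: iter_p_add.
  by rewrite addnC; apply: iter_p_add; exact: hJ.
have : (#[pi]%g %| p ^ J)%N.
  rewrite order_dvdn; apply/eqP/permP => a; apply: val_inj.
  by rewrite /= -(root_perm_iter _ _ gpi) hJ ?perm1 //; exact: ssvalP.
rewrite opi Euclid_dvdX // dvdn_prime2 // => /andP [/eqP -> _].
by rewrite !inE.
Qed.

(** Replaces the compositum by a condition on single elements. Field operations preserve it because
    two [p]-power periods have a common [p]-power multiple. *)
Lemma max_p_extP K p x : prime p -> is_subfield K -> F `<=` K ->
  max_p_ext p K x <-> separable_over K x /\
    forall g, fixes K g -> exists j, iter (p ^ j) g x = x.
Proof.
move=> p_pr hK FK; split; last first.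
  move=> [xsep xper]; apply: mem_gen_field; right => /=.
  exact: (p_period_degree p_pr hK FK xsep xper).
pose Y := [set y | forall g, fixes K g -> exists j, iter (p ^ j) g y = y].
have hY : is_subfield Y.
  have key (op : Omega -> Omega -> Omega) :
      (forall g, {morph g : x y / op x y}) ->
      forall x y, Y x -> Y y -> Y (op x y).
    move=> gop y z hy hz g gK; have [j hj] := hy g gK; have [k hk] := hz g gK.
    exists (j + k)%N; rewrite -auto_iterE gop auto_iterE iter_p_add //.
    by rewrite addnC iter_p_add.
  apply/subfieldP; split.
  - by move=> g _; exists 0%N; rewrite expn0 /= rmorph1.
  - by apply: (key (fun x y => x - y)) => g y z; rewrite rmorphB.
  - by apply: (key (fun x y => x / y)) => g y z; rewrite fmorph_div.
have hYs := subfieldI (separable_subfield Falg hK FK) hY.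
apply: (gen_min hYs) => y [Ky|[T [gal [k deg] /set_mem Ty]]].
  split; first exact: separable_self.
  by move=> g gK; exists 0%N; rewrite expn0 /= gK.
split; last first.
  by move=> g gK; exists k; exact: (galois_p_degree_period FK gal deg gK Ty).
by have [_ _ Tsep _] := (galois_extP Falg T hK FK).1 gal; exact: Tsep.
Qed.

End Base.
End FiniteGalois.

(** * Roots of unity and cocycles *)

Section Geometric.
Implicit Types (p a m k : nat).

(** Kept as a sum rather than as (a^m - 1)/(a - 1), so that [a = 1] is no exception. *)
Definition geo a m := (\sum_(i < m) a ^ i)%N.

Lemma geoD a m k : geo a (m + k) = (geo a m + a ^ m * geo a k)%N.
Proof.
rewrite /geo big_split_ord big_distrr /=; congr (_ + _)%N.
by apply: eq_bigr => i _; rewrite expnD.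
Qed.

Lemma geoS a m : geo a m.+1 = (a * geo a m).+1.
Proof. by rewrite -add1n geoD expn1 [geo a 1]big_ord1 expn0 add1n. Qed.

Lemma geoM a m k : geo a (m * k) = (geo a m * geo (a ^ m) k)%N.
Proof.
elim: k => [|k IH]; first by rewrite /geo muln0 !big_ord0 muln0.
rewrite mulnS addnC geoD IH [geo _ k.+1]big_ord_recr /= mulnDr -expnM.
by rewrite [(_ * geo a m)%N]mulnC.
Qed.

Lemma modn_exp1 p a k : a = 1 %[mod p] -> (a ^ k = 1 %[mod p])%N.
Proof. by move=> h; rewrite -modnXm h modnXm exp1n. Qed.

Lemma geo_mod p a m : a = 1 %[mod p] -> geo a m = m %[mod p].
Proof.
move=> h; elim: m => [|m IH]; first by rewrite /geo big_ord0.
rewrite [geo _ _]big_ord_recr /= -modnDm IH (modn_exp1 m h) modnDm.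
by rewrite addn1.
Qed.

(** For a = 1 + p b the sum is p + p b C(p,2) modulo p^2, and [p] divides C(p,2) because it is odd.
    For p = 2 and a = 3 the sum is 4, of valuation 2. *)
Lemma logn_geo_prime p a : prime p -> odd p -> a = 1 %[mod p] ->
  logn p (geo a p) = 1%N.
Proof.
move=> p_pr p_odd h; have p1 := prime_gt1 p_pr.
have [b ab] : exists b, a = (1 + p * b)%N.
  exists (a %/ p)%N; rewrite {1}(divn_eq a p) h (modn_small p1).
  by rewrite mulnC addnC.
have pw i : exists t, (a ^ i = 1 + i * (p * b) + p ^ 2 * t)%N.
  elim: i => [|i [t IH]]; first by exists 0%N; rewrite expn0; lia.
  exists (i * b * b + t * (1 + p * b))%N.
  by rewrite expnS IH ab -mulnn; ring.
have [t ht] := choice pw.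
have e : geo a p = (p + p * b * 'C(p, 2) + p ^ 2 * \sum_(i < p) t i)%N.
  rewrite /geo (eq_bigr (fun i : 'I_p => 1 + i * (p * b) + p ^ 2 * t i)%N); last first.
    by move=> i _; exact: ht.
  rewrite !big_split /= -big_distrl /=.
  rewrite sum_nat_const card_ord muln1 -big_distrr /=.
  by rewrite -(big_mkord xpredT id) bin2_sum; lia.
have /dvdnP [u hu] : (p %| 'C(p, 2))%N.
  by apply: prime_dvd_bin => //; case: (p) p_pr p_odd => [|[|[|]]].
have -> : geo a p = (p * (1 + p * (b * u + \sum_(i < p) t i)))%N.
  by rewrite e hu -mulnn; ring.
have p0 := prime_gt0 p_pr.
rewrite lognM // -{2}[p]expn1 pfactorK // [X in (_ + X)%N]lognE.
case: ifP => //; case/and3P => _ _.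
by rewrite dvdn_addl ?dvdn_mulr // dvdn1; move: p1; case: (p) => [|[|]].
Qed.

Lemma geo_gt0 a m : (0 < m)%N -> (0 < geo a m)%N.
Proof. by case: m => // m _; rewrite /geo big_ord_recl expn0. Qed.

(** Lifting the exponent: [geoM] splits off one factor [p] of [m] at a time, replacing [a] by a^p;
    when [m] is prime to [p], the sum is [m] modulo [p]. *)
Lemma logn_geo p a m : prime p -> odd p -> a = 1 %[mod p] -> (0 < m)%N ->
  logn p (geo a m) = logn p m.
Proof.
move=> p_pr p_odd; have [k] := ubnP m; elim: k m a => // k IH m a mk h m0.
have [/dvdnP [u mu]|nd] := boolP (p %| m)%N; last first.
  rewrite [RHS]lognE m0 (negPf nd) andbF lognE.
  by rewrite /dvdn (geo_mod m h) -/(p %| m)%N (negPf nd) !andbF.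
have u0 : (0 < u)%N by move: m0; rewrite mu; case: (u).
have p1 := prime_gt1 p_pr.
have p0 := prime_gt0 p_pr.
rewrite mu [(u * p)%N]mulnC geoM (lognM _ (geo_gt0 a p0) (geo_gt0 _ u0)).
rewrite (lognM _ p0 u0) (logn_geo_prime p_pr p_odd h) IH //.
- by rewrite -[in RHS](expn1 p) pfactorK.
- by rewrite -ltnS; apply: leq_trans mk; rewrite ltnS mu; nia.
- exact: modn_exp1.
Qed.

Lemma geo_dvd p a m e : prime p -> odd p -> a = 1 %[mod p] ->
  (p ^ e %| geo a m)%N = (p ^ e %| m)%N.
Proof.
move=> p_pr p_odd h; case: (posnP m) => [->|m0].
  by rewrite /geo big_ord0 !dvdn0.
by rewrite !pfactor_dvdn ?geo_gt0 // logn_geo.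
Qed.

(** For i <= k the two sums differ by a^i times a sum of k - i terms, which p^e divides only if it
    divides k - i. So the map is injective, hence bijective, on p^e residues. *)
Lemma geo_surj p a e : prime p -> odd p -> a = 1 %[mod p] ->
  forall j, exists i, geo a i = j %[mod p ^ e].
Proof.
move=> p_pr p_odd h j.
have q0 : (0 < p ^ e)%N by rewrite expn_gt0 prime_gt0.
pose f (i : 'I_(p ^ e)) : 'I_(p ^ e) := Ordinal (ltn_pmod (geo a i) q0).
have ca i : coprime (p ^ e) (a ^ i).
  apply: coprimeXl; apply: coprimeXr; rewrite prime_coprime //.
  by rewrite /dvdn h modn_small ?prime_gt1.
have key (i k : 'I_(p ^ e)) : (i <= k)%N -> f i = f k -> i = k.
  move=> ik /(congr1 val) /= /eqP; rewrite eq_sym eqn_mod_dvd; last first.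
    by rewrite -(subnKC ik) geoD leq_addr.
  rewrite -{1}(subnKC ik) geoD addKn Gauss_dvdr // geo_dvd //.
  move=> hd; apply: val_inj => /=; case: (posnP (k - i)%N) => d0; first by lia.
  by have := dvdn_leq d0 hd; have := ltn_ord k; lia.
have finj : injective f.
  by move=> i k fik; case/orP: (leq_total i k) => ik; [|apply/esym]; exact: key.
have [f' _ f'f] := injF_bij finj.
pose j' : 'I_(p ^ e) := Ordinal (ltn_pmod j q0).
exists (f' j'); have /(congr1 val) := f'f j'; rewrite /= => ->.
by [].
Qed.

End Geometric.

Lemma exists_prim_root (Omega : closedFieldType) m : (0 < m)%N ->
  m%:R != 0 :> Omega -> exists z : Omega, m.-primitive_root z.
Proof.
move=> m0 mn0; have [r hr] := closed_field_poly_normal ('X^m - 1 : {poly Omega}).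
have lc : lead_coef ('X^m - 1 : {poly Omega}) = 1.
  by apply/eqP; rewrite -monicE monicXnsubC.
rewrite lc scale1r in hr.
have sz : size r = m.
  by apply: succn_inj; rewrite -(size_prod_XsubC r id) -hr size_XnsubC.
have /hasP [z _ hz] : has m.-primitive_root r.
  apply: has_prim_root => //; last by rewrite sz.
    by apply/allP => z; rewrite -root_prod_XsubC -hr unity_rootE => /rootP;
       rewrite !hornerE => /eqP; rewrite subr_eq0.
  rewrite -separable_prod_XsubC -hr; exact: cyclotomic.separable_Xn_sub_1.
by exists z.
Qed.

(** * The action of Aut(Omega/L) on [mu (p ^ n)] and its cocycles *)

Section Twisted.
Variable Omega : closedFieldType.
Implicit Types (K T X Y : set Omega) (g h : {rmorphism Omega -> Omega}).
Variables (L : set Omega) (p n : nat).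
Hypotheses (p_pr : prime p) (p_odd : odd p) (n_gt0 : (0 < n)%N)
  (p_neq0 : p%:R != 0 :> Omega) (muL : mu p `<=` L).

Let q := (p ^ n)%N.

Lemma mu1 m : mu m (1 : Omega).
Proof. by rewrite /mu /= expr1n. Qed.

Lemma muM m (v w : Omega) : mu m v -> mu m w -> mu m (v * w).
Proof. by rewrite /mu /= => hv hw; rewrite exprMn hv hw mulr1. Qed.

Lemma muX m (w : Omega) k : mu m w -> mu m (w ^+ k).
Proof. by rewrite /mu /= => hw; rewrite exprAC hw expr1n. Qed.

Lemma muV m (w : Omega) : mu m w -> mu m w^-1.
Proof. by rewrite /mu /= => hw; rewrite exprVn hw invr1. Qed.

Lemma mu_auto m g (w : Omega) : mu m w -> mu m (g w).
Proof. by rewrite /mu /= => hw; rewrite -rmorphXn hw rmorph1. Qed.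

Lemma mu_neq0 m (w : Omega) : (0 < m)%N -> mu m w -> w != 0.
Proof.
rewrite /mu /= => m0 hw; apply: contra_eqN hw => /eqP ->.
by rewrite expr0n; case: m m0 => //= m _; rewrite eq_sym oner_eq0.
Qed.

Lemma q_gt0 : (0 < q)%N.
Proof. by rewrite expn_gt0 prime_gt0. Qed.

Lemma exists_zeta : exists z : Omega, q.-primitive_root z.
Proof.
apply: exists_prim_root; first exact: q_gt0.
by rewrite natrX expf_neq0.
Qed.

Lemma mu_prim m (z w : Omega) : m.-primitive_root z -> mu m w ->
  exists i, w = z ^+ i.
Proof. by move=> hz hw; have [i ->] := prim_rootP hz hw; exists i. Qed.

Lemma mu_prim_root m (z : Omega) : m.-primitive_root z -> mu m z.
Proof. exact: prim_expr_order. Qed.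

(* t generates the image of Aut(Omega/L) in Aut(mu_q), which is cyclic of
   order p^e because p is odd and L contains mu_p. *)
Record cyclic_action (t : {rmorphism Omega -> Omega}) (a e : nat)
    (z w : Omega) : Prop := CyclicAction {
  ca_fix : fixes L t;
  ca_mod : a = 1 %[mod p];
  ca_zeta : q.-primitive_root z;
  ca_omega : (p ^ e).-primitive_root w;
  ca_pow : forall v, mu q v -> t v = v ^+ a;
  ca_tz : t z = z * w;
  ca_gen : forall g, fixes L g -> exists i, forall v, mu q v -> g v = iter i t v
}.

(** As mu_p lies in L, g(z)/z has order dividing p^(n-1). Choosing t with t(z)/z of greatest order
    makes every g(z)/z a power of it, and [geo_surj] turns the exponent of that power into a number
    of iterations of t. *)
Lemma exists_cyclic_action : exists t a e z w, cyclic_action t a e z w.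
Proof.
have [z hz] := exists_zeta; have z0 : z != 0.
  exact: (mu_neq0 q_gt0 (mu_prim_root hz)).
pose wt (g : {rmorphism Omega -> Omega}) := g z / z.
have ord g : fixes L g -> exists2 e, (p ^ e).-primitive_root (wt g) & (e < n)%N.
  move=> gL.
  have w1 : wt g ^+ (p ^ n.-1) = 1.
    rewrite /wt expr_div_n -rmorphXn gL ?divff ?expf_neq0 //.
    apply: muL; rewrite /mu /= -exprM -expnSr prednK //.
    exact: mu_prim_root.
  have pn0 : (0 < p ^ n.-1)%N by rewrite expn_gt0 prime_gt0.
  have [m hm md] := prim_order_exists pn0 w1.
  have /(dvdn_pfactor _ _ p_pr) [e en em] := md.
  by exists e; rewrite -?em //; lia.
have gz g : g z = z * wt g by rewrite /wt mulrC divfK.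
pose P e := `[< exists2 g : {rmorphism Omega -> Omega}, fixes L g &
  (p ^ e).-primitive_root (wt g) >].
have exP : exists e, P e.
  have [|e he _] := ord idfun; first by [].
  by exists e; apply/asboolP; exists idfun.
have ubP e : P e -> (e <= n)%N.
  move=> /asboolP [g gL he]; have [e' he' en] := ord g gL.
  have : (p ^ e %| p ^ e')%N.
    by rewrite (prim_order_dvd he) (prim_expr_order he').
  by rewrite dvdn_Pexp2l ?prime_gt1 // => h; apply: leq_trans h (ltnW en).
case: (ex_maxnP exP ubP) => e /asboolP [t tL hw] emax.
have {emax} wdiv g : fixes L g -> exists i, wt g = wt t ^+ i.
  move=> gL; have [e' he' en] := ord g gL.
  have ee' : (e' <= e)%N by apply: emax; apply/asboolP; exists g.
  apply: (mu_prim hw); rewrite /mu /= -(subnK ee') expnD mulnC exprM.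
  by rewrite (prim_expr_order he') expr1n.
have [a ha] : exists a, t z = z ^+ a.
  by apply: (mu_prim hz); apply: mu_auto; exact: mu_prim_root.
have pow v : mu q v -> t v = v ^+ a.
  by move=> /(mu_prim hz) [i ->]; rewrite rmorphXn ha exprAC.
have pn : (p ^ n = p ^ n.-1 * p)%N by rewrite -expnSr prednK.
have amod : a = 1 %[mod p].
  (* This primitive [p]-th root of unity lies in L, so t fixes it while raising it to the power [a];
     hence [a] is 1 modulo [p]. *)
  have hy : p.-primitive_root (z ^+ (p ^ n.-1)).
    have := exp_prim_root hz (p ^ n.-1).
    rewrite /q pn gcdnMr mulKn // expn_gt0 prime_gt0 //.
  apply/eqP; rewrite -(eq_prim_root_expr hy) expr1.
  have ym : mu p (z ^+ (p ^ n.-1)) by exact: mu_prim_root.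
  have yq : mu q (z ^+ (p ^ n.-1)) by apply: muX; exact: mu_prim_root.
  by rewrite -(pow _ yq) tL //; exact: muL.
exists t, a, e, z, (wt t); split=> // g gL.
have iz i : iter i t z = z * wt t ^+ geo a i.
  elim: i => [|i IH]; first by rewrite /geo big_ord0 mulr1.
  rewrite iterS IH rmorphM rmorphXn /= gz.
  have wq : mu q (wt t).
    by apply: muM; [apply: mu_auto|apply: muV]; exact: mu_prim_root.
  by rewrite (pow _ wq) -mulrA -exprM -exprS geoS.
have [j hj] := wdiv g gL; have [i hi] := geo_surj e p_pr p_odd amod j.
exists i => v /(mu_prim hz) [k ->].
rewrite -auto_iterE !rmorphXn; congr (_ ^+ _).
rewrite auto_iterE iz gz hj; congr (_ * _); apply/eqP.
by rewrite (eq_prim_root_expr hw) hi.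
Qed.

Section Action.
Variables (t : {rmorphism Omega -> Omega}) (a e : nat) (z w : Omega).
Hypothesis act : cyclic_action t a e z w.

Lemma ca_omega_q : mu q w.
Proof.
have hz := ca_zeta act; have z0 := mu_neq0 q_gt0 (mu_prim_root hz).
have -> : w = t z / z by rewrite (ca_tz act) mulrC mulKf.
by apply: muM; [apply: mu_auto|apply: muV]; exact: mu_prim_root.
Qed.

Lemma ca_iter_z i : iter i t z = z * w ^+ geo a i.
Proof.
elim: i => [|i IH]; first by rewrite /geo big_ord0 mulr1.
rewrite iterS IH rmorphM rmorphXn /= (ca_tz act) (ca_pow act ca_omega_q).
by rewrite -mulrA -exprM -exprS geoS.
Qed.

Lemma ca_iter_pow i v : mu q v -> iter i t v = v ^+ (a ^ i).
Proof.
move=> hv; elim: i => [|i IH]; first by rewrite expn0 expr1.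
by rewrite iterS IH (ca_pow act) ?expnSr ?exprM //; exact: muX.
Qed.

Lemma ca_iter_fix i : (forall v, mu q v -> iter i t v = v) <-> (p ^ e %| i)%N.
Proof.
have hz := ca_zeta act; have z0 := mu_neq0 q_gt0 (mu_prim_root hz).
rewrite -(geo_dvd _ _ p_pr p_odd (ca_mod act)) (prim_order_dvd (ca_omega act)).
split=> [h|/eqP h v].
  by rewrite -(inj_eq (mulfI z0)) mulr1 -ca_iter_z h //; exact: mu_prim_root.
move=> /(mu_prim hz) [k ->]; rewrite -auto_iterE rmorphXn auto_iterE.
by rewrite ca_iter_z h mulr1.
Qed.

End Action.

Definition fixesM g := fixes L g /\ fixes (mu q) g.

(* A class in H^1(G_F) is represented on Aut(Omega/L), which maps onto G_F and
   on which the twisted action is the natural one; Y stands for F(p). *)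
Definition cocycle Y (c : (Omega -> Omega) -> Omega) : Prop :=
  [/\ forall g, fixes L g -> mu q (c g),
      exists s : seq Omega, (forall a, a \in s -> Y a) /\
        forall g h, fixes L g -> fixes L h -> {in s, g =1 h} -> c g = c h &
      forall g h, fixes L g -> fixes L h -> c (g \o h) = c g * g (c h)].

Section Cocycles.
Variables (F Y : set Omega).
Hypothesis Falg : forall x, exists q : {poly Omega},
  [/\ q != 0, forall i, F q`_i & root q x].
Hypotheses (FL : F `<=` L).
Hypothesis muY : exists s : seq Omega, (forall a, a \in s -> Y a) /\
  forall g, fixes L g -> fixes [set` s] g -> fixes (mu q) g.

Lemma cocycle1 c : cocycle Y c -> c idfun = 1.
Proof.
move=> [cmu _ cM]; have := cM idfun idfun (fun _ _ => erefl) (fun _ _ => erefl).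
rewrite -[X in c X](_ : idfun = _) //= => /eqP.
have c0 := mu_neq0 q_gt0 (cmu idfun (fun _ _ => erefl)).
by rewrite -[X in X == _]mulr1 (inj_eq (mulfI c0)) => /eqP.
Qed.

Lemma cocycle_div c d : cocycle Y c -> cocycle Y d ->
  cocycle Y (fun phi => c phi / d phi).
Proof.
move=> [cmu [s [sY sc]] cM] [dmu [t [tY td]] dM]; split.
- by move=> g gL; apply: muM; [exact: cmu|apply: muV; exact: dmu].
- exists (s ++ t); split; first by move=> x; rewrite mem_cat => /orP [/sY|/tY].
  move=> g h gL hL gh; rewrite (sc g h) // ?(td g h) // => x xs; apply: gh;
    by rewrite mem_cat xs ?orbT.
- move=> g h gL hL; have := cM g h gL hL; have := dM g h gL hL.
  by rewrite /= => -> ->; rewrite invfM fmorph_div; ring.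
Qed.

Lemma cocycle_coboundary v : mu q v -> cocycle Y (fun phi => phi v / v).
Proof.
move=> hv; have v0 := mu_neq0 q_gt0 hv; have [s [sY hs]] := muY.
split.
- by move=> g gL; apply: muM; [exact: mu_auto|exact: muV].
- exists s; split=> // g h gL hL gh.
  have [k [kL hk kh]] := auto_inv Falg FL gL.
  have khM : fixes (mu q) (k \o h).
    by apply: hs; [exact: fixes_comp|move=> a sa; rewrite /= -gh ?hk].
  by rewrite -{1}(khM v hv) /= kh.
- move=> g h gL hL /=; have gv0 : g v != 0 by rewrite fmorph_eq0.
  by rewrite fmorph_div; field; rewrite v0 gv0.
Qed.

(** This is H^1(C, mu_q) = 0. As c(t^(p^e)) = 1, the power of c(t) with exponent 1 + a + ... +
    a^(p^e - 1) is 1. That exponent has the valuation of p^e, so c(t) is some w^j with w = t(z)/z,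
    and [c] is the coboundary of z^j. *)
Lemma cocycle_trivial c : cocycle Y c -> (forall g, fixesM g -> c g = 1) ->
  exists2 v, mu q v & forall g, fixes L g -> c g = g v / v.
Proof.
move=> hc cM1; have [cmu _ cM] := hc.
have [t [a [e [z [w act]]]]] := exists_cyclic_action.
have tL := ca_fix act; have tiL i : fixes L (auto_iter t i).
  by rewrite auto_iterE; exact: fixes_iter.
have ctq := cmu t tL.
have ci i : c (iter i t) = c t ^+ geo a i.
  elim: i => [|i IH]; first by rewrite /geo big_ord0 expr0; exact: (cocycle1 hc).
  have := cM (auto_iter t i) t (tiL i) tL; rewrite auto_iterE.
  have -> : iter i t \o t = iter i.+1 t by apply/funext => x; rewrite iterSr.
  move=> ->; rewrite IH (ca_iter_pow act _ ctq) -exprD.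
  by rewrite [in RHS]/geo big_ord_recr.
have : c t ^+ (p ^ e) = 1.
  have : c (iter (p ^ e) t) = 1.
    rewrite -auto_iterE; apply: cM1; split=> //; rewrite auto_iterE.
    by apply/(ca_iter_fix act).
  have : geo a (p ^ e) != 0%N by rewrite -lt0n geo_gt0 // expn_gt0 prime_gt0.
  rewrite ci => g0 h.
  have [j jq] := mu_prim (ca_zeta act) ctq.
  move: h; rewrite jq -!exprM => /eqP; rewrite -(prim_order_dvd (ca_zeta act)).
  move=> hd; apply/eqP; rewrite -(prim_order_dvd (ca_zeta act)).
  have [->|j0] := posnP j; first by rewrite mul0n dvdn0.
  have pe0 : (0 < p ^ e)%N by rewrite expn_gt0 prime_gt0.
  have ge0 := geo_gt0 a pe0.
  move: hd; rewrite /q !pfactor_dvdn ?muln_gt0 ?j0 //.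
  by rewrite !lognM // logn_geo //; exact: ca_mod act.
move=> cte; have [j cj] := mu_prim (ca_omega act) cte.
have zq := mu_prim_root (ca_zeta act).
exists (z ^+ j); first exact: muX.
move=> g gL; have [i gi] := ca_gen act gL.
have z0 := mu_neq0 q_gt0 zq.
have gM := cM. 
have [h' [hL' hh' h'h]] := auto_inv Falg FL (tiL i).
have gh : fixesM (h' \o g).
  split; first exact: fixes_comp.
  by move=> v hv; rewrite /= gi // -auto_iterE hh'.
(* [g] and t^i differ by an element of the kernel, where [c] is 1. *)
have -> : c g = c (iter i t).
  have gE : (g : Omega -> Omega) = auto_iter t i \o (h' \o g).
    by apply/funext => x /=; rewrite h'h.
  have e1 := cM (auto_iter t i) (h' \o g) (tiL i) gh.1.
  have e2 := cM1 _ gh; rewrite /= in e1 e2.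
  by rewrite {1}gE e1 e2 rmorph1 mulr1 auto_iterE.
rewrite ci gi; last exact: muX.
rewrite -auto_iterE rmorphXn auto_iterE (ca_iter_z act) exprMn.
by rewrite mulrC mulKf ?expf_neq0 // cj -!exprM mulnC.
Qed.


(* A homomorphism f on the kernel of the action extends to a cocycle: with
   t a generator of the image, c (h t^i) = f h * v ^ (1 + a + ... + a^(i-1)),
   where v solves v ^ (1 + a + ... + a^(p^e-1)) = f (t^(p^e)).  It is solvable
   since t fixes f (t^(p^e)). *)
Lemma cocycle_extension (f : (Omega -> Omega) -> Omega) :
  (forall h, fixesM h -> mu q (f h)) ->
  (exists s : seq Omega, (forall a, a \in s -> Y a) /\
     forall h, fixesM h -> fixes [set` s] h -> f h = 1) ->
  (forall g h, fixesM g -> fixesM h -> f (g \o h) = f g * f h) ->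
  (forall g h h', fixes L g -> fixesM h -> fixesM h' ->
     (forall x, g (h x) = h' (g x)) -> f h' = g (f h)) ->
  exists2 c, cocycle Y c & forall h, fixesM h -> c h = f h.
Proof.
move=> fmu [sf [sfY floc]] fM fconj.
have [t [a [e [z [w act]]]]] := exists_cyclic_action.
have tL := ca_fix act; have tiL i : fixes L (auto_iter t i).
  by rewrite auto_iterE; exact: fixes_iter.
have zP := ca_zeta act; have zq := mu_prim_root zP.
have teM : fixesM (auto_iter t (p ^ e)).
  by split=> //; rewrite auto_iterE; apply/(ca_iter_fix act).
have f1 : f idfun = 1.
  have h1 : fixesM idfun by [].
  have := fM _ _ h1 h1; rewrite /= -[X in f X](_ : idfun = _) // => /eqP.
  rewrite -[X in X == _]mulr1.
  by rewrite (inj_eq (mulfI (mu_neq0 q_gt0 (fmu _ h1)))) eq_sym => /eqP.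
(* Writing the left side as z^b, invariance under t gives w^b = 1, so p^e divides b. The exponent on
   the right is u p^e with u prime to [p], and u is inverted modulo q. *)
have [v vq fv] : exists2 v, mu q v & f (auto_iter t (p ^ e)) = v ^+ geo a (p ^ e).
  set z0 := f _; have z0q : mu q z0 by exact: fmu.
  have tz0 : t z0 = z0.
    apply/esym; apply: fconj => // x.
    by rewrite !auto_iterE -iterS iterSr.
  have [b zb] := mu_prim zP z0q.
  have : w ^+ b = 1.
    move: tz0; rewrite zb rmorphXn (ca_tz act) exprMn => /eqP.
    rewrite -[X in _ == X]mulr1.
    rewrite (inj_eq (mulfI _)) ?expf_neq0 ?(mu_neq0 q_gt0 zq) // => /eqP.
    by [].
  move=> /eqP; rewrite -(prim_order_dvd (ca_omega act)) => /dvdnP [b' bb'].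
  have pe0 : (0 < p ^ e)%N by rewrite expn_gt0 prime_gt0.
  have ge0 := geo_gt0 a pe0.
  have /dvdnP [u hu] : (p ^ e %| geo a (p ^ e))%N.
    by rewrite (geo_dvd _ _ p_pr p_odd (ca_mod act)).
  have cu : coprime u q.
    rewrite /q coprime_sym coprimeXl // prime_coprime //; apply/negP => pu.
    have : (p ^ e.+1 %| geo a (p ^ e))%N.
      by rewrite hu expnS; exact: dvdn_mul.
    rewrite (geo_dvd _ _ p_pr p_odd (ca_mod act)) dvdn_Pexp2l ?prime_gt1 //.
    by rewrite ltnn.
  have u0 : (0 < u)%N by move: ge0; rewrite hu muln_gt0 => /andP [].
  have [km kn hk _] := egcdnP q u0; rewrite (eqP cu) in hk.
  exists (z ^+ (b' * km)); first exact: muX.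
  rewrite zb bb' -exprM hu; apply/eqP; rewrite (eq_prim_root_expr zP).
  have -> : (b' * km * (u * p ^ e) = (km * u) * (b' * p ^ e))%N by ring.
  by rewrite hk mulnDl mul1n mulnAC modnMDl.
(* Compatibility on the overlap: an iterate of t lying in the kernel gets one value from [f] and one
   from the formula for [c], and these agree. *)
have fte k : f (auto_iter t (p ^ e * k)) = v ^+ geo a (p ^ e * k).
  have apow i (x : Omega) : mu q x -> x ^+ ((a ^ (p ^ e)) ^ i)%N = x.
    move=> xq; rewrite -expnM -(ca_iter_pow act _ xq).
    by apply: (proj2 (ca_iter_fix act _)) => //; exact: dvdn_mulr.
  rewrite geoM exprM -fv; set y := f (auto_iter t (p ^ e)).
  have yq : mu q y by exact: (fmu _ teM).
  have -> : y ^+ geo (a ^ (p ^ e)) k = y ^+ k.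
    elim: k => [|k IH]; first by rewrite /geo big_ord0.
    by rewrite [geo _ _]big_ord_recr /= exprD IH apow // exprSr.
  elim: k => [|k IH]; first by rewrite muln0 /= f1.
  rewrite exprS -IH mulnS -fM //; last first.
    by split=> //; rewrite auto_iterE; apply/(ca_iter_fix act); exact: dvdn_mulr.
  by congr f; apply/funext => x /=; rewrite !auto_iterE iterD.
have tdM d : (forall x : Omega, mu q x -> iter d t x = x) ->
    fixesM (auto_iter t d) /\ f (auto_iter t d) = v ^+ geo a d.
  move=> hd; split; first by split=> //; rewrite auto_iterE.
  by have /dvdnP [k ->] := (ca_iter_fix act d).1 hd; rewrite mulnC fte.
(* An element has many decompositions h t^i, so [c] is introduced through a relation; [half] shows
   that the value is the same for all of them. *)
pose R (phi : Omega -> Omega) x := exists (h : {rmorphism Omega -> Omega}) (i : nat),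
  [/\ fixesM h, phi = h \o iter i t & x = f h * v ^+ geo a i].
have half h h' i i' : (i <= i')%N -> fixesM h -> fixesM h' ->
    h \o iter i t = h' \o iter i' t :> (Omega -> Omega) ->
    f h * v ^+ geo a i = f h' * v ^+ geo a i'.
  move=> ii' hM hM' e'.
  pose d := (i' - i)%N.
  have hd : (h : Omega -> Omega) = h' \o auto_iter t d.
    apply/funext => x.
    have [k [_ _ hk]] := auto_inv Falg FL (tiL i).
    have := congr1 (fun phi => phi (k x)) e'.
    by rewrite /= -(subnK ii') iterD -[iter i t (k x)]/(_) -!auto_iterE !hk.
  have hdf (x : Omega) : mu q x -> iter d t x = x.
    move=> xq; apply: (fmorph_inj h'); rewrite [RHS]hM'.2 //.
    by have := congr1 (@^~ x) hd; rewrite /= auto_iterE hM.2.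
  have [dM fd] := tdM d hdf.
  have -> : f h = f h' * v ^+ geo a d by rewrite hd -fd -fM.
  rewrite -mulrA -exprD; congr (_ * _).
  rewrite -[in RHS](subnK ii') geoD !exprD; congr (_ * _).
  by rewrite exprM -(ca_iter_pow act _ vq) hdf.
have Rfun phi x y : R phi x -> R phi y -> x = y.
  move=> [h [i [hM -> ->]]] [h' [i' [hM' e' ->]]].
  case/orP: (leq_total i i') => ii'; first exact: half ii' hM hM' e'.
  by apply/esym; exact: half ii' hM' hM (esym e').
have Rtot g : fixes L g -> exists x, R g x.
  move=> gL; have [i gi] := ca_gen act gL.
  have [k [kL hk kh]] := auto_inv Falg FL (tiL i).
  exists (f (g \o k) * v ^+ geo a i), (g \o k), i; split=> //.
    split; first exact: fixes_comp.
    move=> x xq /=; rewrite gi; last exact: mu_auto.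
    by rewrite -auto_iterE kh.
  by apply/funext => x /=; rewrite -auto_iterE hk.
pose c phi := xget 1 [set x | R phi x].
have cR g : fixes L g -> R g (c g).
  by move=> gL; have [x Rx] := Rtot g gL; rewrite /c; case: xgetP => [y _ //|/(_ x)].
have cE g x : R g x -> c g = x.
  by move=> Rx; rewrite /c; case: xgetP => [y _ Ry|/(_ x)] //; exact: Rfun Ry Rx.
have cmu g : fixes L g -> mu q (c g).
  move=> /cR [h [i [hM _ ->]]]; apply: muM; first exact: fmu.
  exact: muX.
have cM g g' : fixes L g -> fixes L g' -> c (g \o g') = c g * g (c g').
  move=> gL gL'; have [h [i [hM gh ->]]] := cR g gL.
  have [h' [j [hM' gh' cg']]] := cR g' gL'.
  have gmu (x : Omega) : mu q x -> g x = iter i t x.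
    by move=> xq; rewrite gh /= hM.2 // -auto_iterE; exact: mu_auto.
  have [k [kL hk kh]] := auto_inv Falg FL (tiL i).
  pose h2 : {rmorphism Omega -> Omega} := auto_iter t i \o (h' \o k).
  have hM2 : fixesM h2.
    split; first by apply: fixes_comp => //; apply: fixes_comp => //; exact: hM'.1.
    by move=> x xq /=; rewrite hM'.2 ?kh //; exact: mu_auto.
  apply: cE; exists (h \o h2), (i + j)%N; split.
  - by split; apply: fixes_comp; [case: hM|case: hM2|case: hM|case: hM2].
  - apply/funext => x; rewrite /= gh gh' /= iterD -!auto_iterE.
    by rewrite hk.
  rewrite fM // (fconj _ _ _ (tiL i) hM' hM2); last by move=> x; rewrite /h2 /= hk.
  rewrite -!mulrA; congr (_ * _).
  rewrite gmu ?cg'; last by rewrite -cg'; exact: cmu.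
  rewrite -!auto_iterE rmorphM rmorphXn mulrCA; congr (_ * _).
  by rewrite auto_iterE (ca_iter_pow act _ vq) geoD exprD exprM.
have [sM [sMY hsM]] := muY.
exists c.
  split=> //; exists (sf ++ sM); split.
    by move=> x; rewrite mem_cat => /orP [/sfY|/sMY].
  move=> g g' gL gL' gg'.
  have [k [kL hk kh]] := auto_inv Falg FL gL.
  have ks : fixes [set` (sf ++ sM)] (k \o g') by move=> x xs; rewrite /= -gg' ?hk.
  have kgL : fixes L (k \o g') by exact: fixes_comp.
  have kM : fixesM (k \o g').
    split=> //; apply: hsM => // x xs; apply: ks.
    by rewrite /= mem_cat; apply/orP; right.
  have e' : (g' : Omega -> Omega) = g \o (k \o g') by apply/funext => x /=; rewrite kh.
  have e1 := cM g (k \o g') gL kgL.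
  have e2 : c (k \o g') = 1.
    have e3 : c (k \o g') = f (k \o g').
      apply: cE; exists (k \o g'), 0%N; split=> //.
      by rewrite /geo big_ord0 expr0 mulr1.
    rewrite e3; apply: floc => // x xs; apply: ks.
    by rewrite /= mem_cat; apply/orP; left.
  by rewrite [in RHS]e' e1 e2 rmorph1 mulr1.
move=> h hM; apply: cE; exists h, 0%N; split=> //.
by rewrite /geo big_ord0 expr0 mulr1.
Qed.

End Cocycles.
End Twisted.

(** The irreducible characters of an abelian group are linear and separate points. Their values are
    q-th roots of unity among the algebraic numbers, carried to [Omega] by matching exponents of a
    primitive root on each side. *)
Lemma character_separation (gT : finGroupType) (G : {group gT})
    (Omega : closedFieldType) (z : Omega) q x :
  abelian G -> (forall y, y \in G -> (y ^+ q = 1)%g) -> (0 < q)%N ->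
  q.-primitive_root z -> x \in G -> x != 1%g ->
  exists phi : gT -> Omega,
    [/\ {in G &, forall a b, phi (a * b)%g = phi a * phi b},
        {in G, forall a, phi a ^+ q = 1} & phi x <> 1].
Proof.
move=> abG Gq q0 hz xG x1.
have [i xi] : exists i : Iirr G, x \notin cfker 'chi_i.
  apply: contrapT => no; case/negP: x1; apply/eqP/set1gP.
  rewrite -(TI_cfker_irr G); apply/finset.bigcapP => i _.
  by apply: contraT => h; case: no; exists i.
have lin : 'chi_i \is a linear_char by apply/char_abelianP.
have [z0 hz0] := C_prim_root_exists q0.
have chiq a : a \in G -> 'chi_i a ^+ q = 1.
  by move=> aG; rewrite -lin_charX // Gq // lin_char1.
have hk a : exists k, a \in G -> 'chi_i a = z0 ^+ k.
  have [aG|] := boolP (a \in G); last by exists 0%N.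
  by have [k hk] := prim_rootP hz0 (chiq a aG); exists k.
have [k hk'] := choice hk.
exists (fun a => z ^+ k a); split.
- move=> a b aG bG; apply/eqP; rewrite -exprD (eq_prim_root_expr hz).
  rewrite -(eq_prim_root_expr hz0) exprD -!hk' ?groupM //.
  by rewrite lin_charM.
- by move=> a _; rewrite exprAC (prim_expr_order hz) expr1n.
- move=> /eqP; rewrite -(prim_order_dvd hz) (prim_order_dvd hz0) -hk' //.
  by move=> h; case/negP: xi; rewrite cfkerEchar ?irr_char // inE xG lin_char1.
Qed.

(** * Homomorphisms into [mu (p ^ n)] and finite combinations of them *)

Section Combination.
Variable Omega : closedFieldType.
Implicit Types (g h : {rmorphism Omega -> Omega})
  (H : set {rmorphism Omega -> Omega}) (c d f : (Omega -> Omega) -> Omega).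
Variables (p n : nat).
Hypotheses (p_pr : prime p).
Let q := (p ^ n)%N.

Definition submonoid H : Prop :=
  H idfun /\ forall g h, H g -> H h -> H (g \o h).

Definition hom_on H f : Prop :=
  (forall g, H g -> mu q (f g)) /\
  forall g h, H g -> H h -> f (g \o h) = f g * f h.

Lemma hom_on1 H f : submonoid H -> hom_on H f -> f idfun = 1.
Proof.
move=> [H1 HM] [fmu fM]; have := fM _ _ H1 H1.
rewrite /= -[X in f X](_ : idfun = _) // => /eqP.
have q0 : (0 < q)%N by rewrite expn_gt0 prime_gt0.
rewrite -[X in X == _]mulr1 (inj_eq (mulfI (mu_neq0 q0 (fmu _ H1)))).
by rewrite eq_sym => /eqP.
Qed.

Lemma hom_on_iter H f g k : submonoid H -> hom_on H f -> H g ->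
  H (auto_iter g k) /\ f (auto_iter g k) = f g ^+ k.
Proof.
move=> sH hf Hg; have [H1 HM] := sH; elim: k => [|k [IH1 IH2]].
  by split=> //; rewrite expr0; exact: hom_on1 sH hf.
by split; [exact: HM|rewrite exprS -IH2 -(proj2 hf)].
Qed.

(** The image of [c] consists of powers of one value c(g), chosen of maximal order p^e. Then f(g) is
    a p^e-th root of unity, so f(g) = c(g)^k, and the condition on kernels carries this relation to
    all of [H]. *)
Lemma hom_multiple H c f : submonoid H -> hom_on H c -> hom_on H f ->
  (forall h, H h -> c h = 1 -> f h = 1) ->
  exists k, forall h, H h -> f h = c h ^+ k.
Proof.
move=> sH hc hf ker; have [H1 HM] := sH.
have q0 : (0 < q)%N by rewrite expn_gt0 prime_gt0.
pose P e := `[< exists2 g : {rmorphism Omega -> Omega}, H g &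
  (p ^ e).-primitive_root (c g) >].
have ord g : H g -> exists2 e, (p ^ e).-primitive_root (c g) & (e <= n)%N.
  move=> Hg; have [m hm md] := prim_order_exists q0 (proj1 hc g Hg).
  have /(dvdn_pfactor _ _ p_pr) [e en em] := md.
  by exists e; rewrite -?em.
have exP : exists e, P e.
  have [e he _] := ord idfun H1.
  by exists e; apply/asboolP; exists idfun.
have ubP e : P e -> (e <= n)%N.
  move=> /asboolP [g Hg he]; have [e' he' en] := ord g Hg.
  have : (p ^ e %| p ^ e')%N.
    by rewrite (prim_order_dvd he) (prim_expr_order he').
  by rewrite dvdn_Pexp2l ?prime_gt1 // => h; apply: leq_trans h en.
case: (ex_maxnP exP ubP) => e /asboolP [g Hg hg] emax.
have pow h : H h -> exists i, c h = c g ^+ i.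
  move=> Hh; have [e' he' en] := ord h Hh.
  have ee' : (e' <= e)%N by apply: emax; apply/asboolP; exists h.
  apply: (mu_prim hg); rewrite /mu /= -(subnK ee') expnD mulnC exprM.
  by rewrite (prim_expr_order he') expr1n.
have itg i := hom_on_iter i sH hc Hg.
have itf i := hom_on_iter i sH hf Hg.
have fe : f g ^+ (p ^ e) = 1.
  rewrite -(itf _).2; apply: ker; first exact: (itf _).1.
  by rewrite (itg _).2 (prim_expr_order hg).
have [k fk] := mu_prim hg fe.
exists k => h Hh; have [i ci] := pow h Hh.
have pe0 : (0 < p ^ e)%N by rewrite expn_gt0 prime_gt0.
(* A natural number congruent to -i modulo p^e: g^j plays the role of g^-i. *)
pose j := (p ^ e * i - i)%N.
have ij : (i + j = p ^ e * i)%N by rewrite /j subnKC // leq_pmull.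
have : f (h \o auto_iter g j) = 1.
  apply: ker; first by apply: HM => //; exact: (itg _).1.
  rewrite (proj2 hc) // ?(itg _).2 ?ci -?exprD ?ij ?exprM ?(prim_expr_order hg) ?expr1n //.
  exact: (itg _).1.
rewrite (proj2 hf) //; last exact: (itg _).1.
rewrite (itf _).2 => e1; have : f g ^+ i * f g ^+ j = 1.
  by rewrite -exprD ij exprM fe expr1n.
rewrite -e1 => /mulIf e2; rewrite -e2; first by rewrite fk ci exprAC.
by rewrite expf_neq0 //; apply: (mu_neq0 q0); exact: (proj1 hf).
Qed.

(** Induction on the list: on the kernel of its head [c], [f] agrees with some [d] of [C]; then f/d
    is trivial wherever [c] is, hence a power of [c]. *)
Lemma hom_combination (C : set ((Omega -> Omega) -> Omega)) H l f :
  (forall c, C c -> hom_on H c) -> C (fun=> 1) ->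
  (forall c d, C c -> C d -> C (fun phi => c phi * d phi)) ->
  (forall c, List.In c l -> C c) -> submonoid H -> hom_on H f ->
  (forall h, H h -> (forall c, List.In c l -> c h = 1) -> f h = 1) ->
  exists2 d, C d & forall h, H h -> f h = d h.
Proof.
move=> + C1 CM; elim: l H f => [|c l IH] H f Chom lC sH hf ker.
  by exists (fun=> 1) => // h Hh; exact: ker.
pose H' := [set h : {rmorphism Omega -> Omega} | H h /\ c h = 1].
have hc : hom_on H c by apply: Chom; apply: lC; left.
have sub d : hom_on H d -> hom_on H' d.
  move=> [dmu dM]; split=> [g [Hg _]|g h [Hg _] [Hh _]]; first exact: dmu.
  exact: dM.
have sH' : submonoid H'.
  split; first by split; [case: sH|exact: hom_on1 sH hc].
  move=> g h [Hg cg] [Hh ch]; split; first by case: sH => _; apply.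
  by rewrite (proj2 hc) // cg ch mulr1.
have [|||||d Cd hd] := IH H' f.
- by move=> d Cd; exact: sub (Chom d Cd).
- by move=> d dl; apply: lC; right.
- by [].
- exact: sub.
- move=> h [Hh ch] hl; apply: ker => // d [<- //|dl]; exact: hl.
have hd' := Chom d Cd.
have q0 : (0 < q)%N by rewrite expn_gt0 prime_gt0.
have [||k hk] := @hom_multiple H c (fun phi => f phi / d phi) sH hc.
- split=> [g Hg|g h Hg Hh].
    apply: muM; [exact: (proj1 hf)|apply: muV; exact: (proj1 hd')].
  by rewrite (proj2 hf) // (proj2 hd') // invfM; ring.
- move=> h Hh ch; rewrite hd // divff //.
  by apply: (mu_neq0 q0); exact: (proj1 hd').
exists (fun phi => d phi * c phi ^+ k).
  apply: (CM d (fun phi => c phi ^+ k)) => //.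
  have Cc : C c by apply: lC; left.
  elim: (k) => [|i IHi]; first by [].
  by have := CM c (fun phi => c phi ^+ i) Cc IHi; under eq_fun do rewrite -exprS.
move=> h Hh; rewrite -hk // mulrC divfK //.
by apply: (mu_neq0 q0); exact: (proj1 hd').
Qed.
End Combination.

(** * Subgroups of cocycles and fields *)

Section Duality.
Variable Omega : closedFieldType.
Implicit Types (S T Z : set Omega) (g h k : {rmorphism Omega -> Omega})
  (c d : (Omega -> Omega) -> Omega) (P : set ((Omega -> Omega) -> Omega)).
Variables (F L Y X B K : set Omega) (p n : nat).
Variable chi : (Omega -> Omega) -> {unit 'Z_(p ^ n)}.
Hypothesis Falg : forall x, exists q : {poly Omega},
  [/\ q != 0, forall i, F q`_i & root q x].
Hypotheses (p_pr : prime p) (p_odd : odd p) (n_gt0 : (0 < n)%N)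
  (p_neq0 : p%:R != 0 :> Omega) (muL : mu p `<=` L).
Hypotheses (FB : F `<=` B) (BL : B `<=` L) (hB : is_subfield B)
  (galX : galois_ext B X) (hK : is_subfield K) (BK : B `<=` K) (KX : K `<=` X)
  (Kst : auto_stable B K) (YX : Y `<=` X).
Hypothesis Xfin : forall x, X x -> exists s : seq Omega,
  (forall a, a \in s -> Y a) /\
  forall g, fixes L g -> fixes [set` s] g -> g x = x.
Hypothesis muY : exists s : seq Omega, (forall a, a \in s -> Y a) /\
  forall g, fixes L g -> fixes [set` s] g -> fixes (mu (p ^ n)) g.
Hypothesis lift_X : forall g, fixes B g ->
  exists h, fixes L h /\ forall x, X x -> h x = g x.
Hypothesis KM : forall g, fixes L g -> fixes K g <-> fixes (mu (p ^ n)) g.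
Hypothesis chiP : forall g sigma, fixes L g -> gal_group K B sigma ->
  (forall x, K x -> g x = sigma x) ->
  forall w, mu (p ^ n) w -> g w = w ^+ val (chi sigma).

Let q := (p ^ n)%N.
Local Notation fixM := (fixesM L p n).
Local Notation cocy := (cocycle L p n Y).

(** The full preimage, among cocycles, of a subgroup of H^1. Cocycles are maps on all functions, and
    the last clause makes membership depend only on their values on Aut(Omega/L). *)
Definition cocycle_subgroup P : Prop :=
  [/\ P `<=` cocy,
      forall v, mu q v -> P (fun phi => phi v / v),
      forall c d, P c -> P d -> P (fun phi => c phi / d phi) &
      forall c d, P c -> cocy d -> (forall g, fixes L g -> c g = d g) -> P d].

Definition fixed_field P : set Omega := [set x | X x /\
  forall g, fixM g -> (forall c, P c -> c g = 1) -> g x = x].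

(** Common form of the two families of fields. In both instances [Y] is F(p), even when [X] is J:
    cocycles are always locally constant with respect to F(p). *)
Definition twisted_ext S : Prop :=
  [/\ abelian_ext q K S, galois_ext B S, S `<=` X & acts_via B K S chi].

Definition trivial_on S : set ((Omega -> Omega) -> Omega) :=
  [set c | cocy c /\ forall g, fixM g -> fixes S g -> c g = 1].

Let FL : F `<=` L. Proof. exact: subset_trans BL. Qed.
Let FK : F `<=` K. Proof. exact: subset_trans BK. Qed.
Let q0 : (0 < q)%N. Proof. by rewrite expn_gt0 prime_gt0. Qed.

Let hX : is_subfield X. Proof. by case: galX. Qed.
Let Xst : auto_stable B X.
Proof. by case: ((galois_extP Falg X hB FB).1 galX). Qed.
Let Xsep : X `<=` separable_over B.
Proof. by case: ((galois_extP Falg X hB FB).1 galX). Qed.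

Lemma galois_ext_sub B' S : galois_ext B' S -> F `<=` B' -> is_subfield B' ->
  forall K', is_subfield K' -> B' `<=` K' -> K' `<=` S -> galois_ext K' S.
Proof.
move=> galS FB' hB' K' hK' BK' KS.
have [hS BS Ssep Sst] := (galois_extP Falg S hB' FB').1 galS.
apply/(galois_extP Falg) => //; first exact: subset_trans BK'.
split=> //; first by move=> x /Ssep; exact: separable_sub.
by move=> g gK; apply: Sst; exact: fixes_sub gK.
Qed.

Let fixL_B g : fixes L g -> fixes B g.
Proof. exact: fixes_sub. Qed.

Let fixM_L g : fixM g -> fixes L g. Proof. by case. Qed.

Let fixM_K g : fixM g -> fixes K g.
Proof. by case=> gL gM; apply/(KM gL). Qed.

Let fixM_comp g h : fixM g -> fixM h -> fixM (g \o h).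
Proof. by move=> [? ?] [? ?]; split; exact: fixes_comp. Qed.

Let hom_cocycle c : cocy c -> hom_on p n fixM c.
Proof.
move=> [cmu _ cM]; split=> [g /fixM_L|g h gM hM]; first exact: cmu.
have gL := fixM_L gM; have hL := fixM_L hM.
by have := cM g h gL hL; rewrite gM.2 //; exact: cmu.
Qed.

Let fixM_submonoid : submonoid fixM.
Proof. by split; [|exact: fixM_comp]. Qed.

Let cocycle_neq0 c g : cocy c -> fixes L g -> c g != 0.
Proof. by move=> [cmu _ _] gL; apply: (mu_neq0 q0); exact: cmu. Qed.

Let cocycle_conj c g h h' : cocy c -> fixes L g -> fixM h -> fixM h' ->
  (forall x, g (h x) = h' (g x)) -> c h' = g (c h).
Proof.
move=> hc gL hM hM' e; have [cmu _ cM] := hc.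
have e1 := cM g h gL (fixM_L hM); have e2 := cM h' g (fixM_L hM') gL.
have e3 : g \o h = h' \o g :> (Omega -> Omega) by apply/funext => x; exact: e.
rewrite [h' _]hM'.2 in e2; last exact: cmu.
apply: (mulIf (cocycle_neq0 hc gL)).
by rewrite -e2 [RHS]mulrC -e1; congr c.
Qed.

Section FixedField.
Variable P : set ((Omega -> Omega) -> Omega).
Hypothesis hP : cocycle_subgroup P.

Let S := fixed_field P.
Let Pcoc c : P c -> cocy c. Proof. by case: hP => h _ _ _; exact: h. Qed.

Definition killed g : Prop := fixM g /\ forall c, P c -> c g = 1.

Let killed_fix g x : killed g -> S x -> g x = x.
Proof. by move=> [gM gP] [_ h]; exact: h. Qed.

Lemma fixed_subfield_P : is_subfield S.
Proof.
apply/subfieldP; split.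
- by split; [exact: sf1|move=> g _ _; exact: rmorph1].
- move=> x y [Xx hx] [Xy hy]; split; first exact: sfB.
  by move=> g gM gP; rewrite rmorphB hx ?hy.
- move=> x y [Xx hx] [Xy hy]; split; first exact: sf_div.
  by move=> g gM gP; rewrite fmorph_div hx ?hy.
Qed.

Lemma fixed_field_sup : K `<=` S.
Proof. by move=> x Kx; split; [exact: KX|move=> g gM _; exact: fixM_K gM x Kx]. Qed.

(** Cocycles are evaluated over L only, so [g] is replaced by a lift over L with the same effect on
    [X]. Equivariance then shows that conjugating by this lift preserves the automorphisms killed by
    [P]. *)
Lemma fixed_field_stable : auto_stable B S.
Proof.
move=> g gB x Sx; have [Xx _] := Sx; have [h [hL hg]] := lift_X gB.
rewrite -hg //; split; first by apply: Xst Xx; exact: fixL_B.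
move=> k kM kP; have [h' [hL' hh' h'h]] := auto_inv Falg FL hL.
pose m : {rmorphism Omega -> Omega} := h' \o (k \o h).
have mM : fixM m.
  split; first by do 2![apply: fixes_comp => //]; exact: fixM_L.
  by move=> w hw; rewrite /= kM.2 ?hh' //; exact: mu_auto.
have mE y : h (m y) = k (h y) by rewrite /m /= h'h.
have mk : killed m.
  split=> // c Pc; apply: (fmorph_inj h); rewrite rmorph1 -(kP c Pc).
  by rewrite (cocycle_conj (Pcoc Pc) hL mM kM mE).
by rewrite -mE (killed_fix mk Sx).
Qed.

Lemma fixed_field_galois : galois_ext B S.
Proof.
apply/(galois_extP Falg) => //; split.
- exact: fixed_subfield_P.
- by apply: subset_trans fixed_field_sup.
- by move=> x [Xx _]; exact: Xsep.
- exact: fixed_field_stable.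
Qed.

End FixedField.

Lemma lift_fixM S sigma : galois_ext B S -> K `<=` S -> S `<=` X ->
  gal_group S K sigma -> exists g, fixM g /\ sigma = res_gal S g.
Proof.
move=> galS KS SX; have galKS := galois_ext_sub galS FB hB hK BK KS.
move=> /(gal_group_res Falg _ FK galKS) [g [gK ->]].
have [h [hL hg]] := lift_X (fixes_sub BK gK).
exists h; split; last by apply: res_gal_eq => x Sx; rewrite hg //; exact: SX.
by split=> //; apply/(KM hL) => x Kx; rewrite hg ?gK //; exact: KX.
Qed.

Lemma fixed_field_ext P : cocycle_subgroup P -> twisted_ext (fixed_field P).
Proof.
move=> hP; set S := fixed_field P.
have Pcoc c : P c -> cocy c by case: hP => h _ _ _; exact: h.
have galS : galois_ext B S by exact: fixed_field_galois.
have KS : K `<=` S by exact: fixed_field_sup.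
have SX : S `<=` X by move=> x [].
have Sst : auto_stable B S by exact: fixed_field_stable.
have SstL g : fixes L g -> forall x, S x -> S (g x).
  by move=> gL; apply: Sst; exact: fixL_B.
have galKS := galois_ext_sub galS FB hB hK BK KS.
have lift sigma : gal_group S K sigma ->
    exists g, fixM g /\ sigma = res_gal S g by exact: lift_fixM.
(* Turns equality on the field into equality of roots of unity: commutativity, exponent q and the
   action through [chi] are then computed on cocycle values. *)
have agree g h : fixes L g -> fixes L h ->
    (forall w, mu q w -> g w = h w) -> (forall c, P c -> c g = c h) ->
    forall x, S x -> g x = h x.
  move=> gL hL gh cgh x Sx; have [h' [hL' hh' h'h]] := auto_inv Falg FL hL.
  suff e : (h' \o g) x = x by rewrite -[in RHS]e /= h'h.
  have kM : fixM (h' \o g).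
    split; first exact: fixes_comp.
    by move=> w hw; rewrite /= gh // hh'.
  case: Sx => _; apply=> // c Pc.
  have [_ _ cM] := Pcoc c Pc.
  have := cM h (h' \o g) hL (fixM_L kM).
  have -> : h \o (h' \o g) = g :> (Omega -> Omega).
    by apply/funext => y /=; rewrite h'h.
  rewrite cgh // -[X in X = _]mulr1.
  by move=> /(mulfI (cocycle_neq0 (Pcoc c Pc) hL)) /esym /eqP; rewrite fmorph_eq1 => /eqP.
split=> //.
  split=> //.
    move=> _ _ /lift [g [gM ->]] /lift [h [hM ->]].
    have gL := fixM_L gM; have hL := fixM_L hM.
    rewrite -!res_gal_comp; [|exact: SstL|exact: SstL].
    apply: res_gal_eq; apply: (agree (g \o h) (h \o g)).
    - exact: fixes_comp.
    - exact: fixes_comp.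
    - by move=> w hw /=; rewrite hM.2 ?gM.2 // hM.2.
    - move=> c /Pcoc /hom_cocycle [_ cM].
      by have := cM _ _ gM hM; have := cM _ _ hM gM; rewrite /= => -> ->; rewrite mulrC.
  move=> _ /lift [g [gM ->]]; have gL := fixM_L gM.
  rewrite -res_gal_iter; last exact: SstL.
  rewrite (_ : res_gal S (iter q g) = res_gal S idfun).
    by apply/funext => x; rewrite /res_gal; case: ifP.
  apply: res_gal_eq => x Sx; rewrite -auto_iterE.
  apply: (agree (auto_iter g q) idfun) => //.
  - by rewrite auto_iterE; exact: fixes_iter.
  - by move=> w hw; rewrite auto_iterE; apply: fixes_iter hw; case: gM.
  - move=> c Pc; have hc := hom_cocycle (Pcoc c Pc).
    rewrite (hom_on_iter p_pr q fixM_submonoid hc gM).2 /=.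
    by rewrite (hom_on1 p_pr fixM_submonoid hc); exact: (proj1 hc).
move=> g h sigma hg hh hgh /lift [k [kM ->]]; have kL := fixM_L kM.
have [hS BS _ _] := (galois_extP Falg S hB FB).1 galS.
have [h0 [h0B hE]] := (gal_group_res Falg _ FB galS).1 hh.
have [e [eL eE]] := lift_X h0B.
have {h0 h0B eE} hE : h = res_gal S e.
  by rewrite hE; apply: res_gal_eq => x /SX Xx; rewrite eE.
have eg x : K x -> e x = g x.
  by move=> Kx; rewrite -hgh ?hE ?res_galE //; [exact: KS|exact: mem_set].
set i := val (chi g).
have epow w : mu q w -> e w = w ^+ i by exact: chiP.
rewrite hE -res_gal_iter -?res_gal_comp; try exact: SstL.
apply: res_gal_eq; rewrite -auto_iterE.
have kiL : fixes L (auto_iter k i) by rewrite auto_iterE; exact: fixes_iter.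
have kiM : fixM (auto_iter k i).
  by split=> //; rewrite auto_iterE; apply: fixes_iter; case: kM.
apply: (agree (e \o k) (auto_iter k i \o e)).
- exact: fixes_comp.
- exact: fixes_comp.
- by move=> w hw /=; rewrite kM.2 // kiM.2 //; exact: mu_auto.
- move=> c Pc; have hc := Pcoc c Pc; have [cmu _ cM] := hc.
  have := cM e k eL kL; rewrite /= => ->.
  have := cM (auto_iter k i) e kiL eL; rewrite /= => ->.
  rewrite kiM.2; last exact: cmu.
  rewrite epow; last exact: cmu.
  rewrite mulrC; congr (_ * _).
  by rewrite (hom_on_iter p_pr i fixM_submonoid (hom_cocycle hc) kM).2.
Qed.

Lemma stable_finite x : X x -> exists s : seq Omega,
  [/\ x \in s, forall a, a \in s -> X a &
      forall g a, fixes B g -> a \in s -> g a \in s].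
Proof.
move=> Xx; have [s [sB _ xs hs]] := separable_orbit Falg hB FB (Xsep Xx).
exists s; split=> //.
  by move=> a /hs [g gB ->]; exact: (Xst gB).
by move=> g a; exact: root_conj sB.
Qed.

Lemma stable_finite_seq (l : seq Omega) : (forall a, a \in l -> X a) ->
  exists s : seq Omega, [/\ {subset l <= s}, forall a, a \in s -> X a &
      forall g a, fixes B g -> a \in s -> g a \in s].
Proof.
elim: l => [|x l IH] lX; first by exists [::].
have [|s [ls sX sst]] := IH; first by move=> a al; apply: lX; rewrite inE al orbT.
have [t [xt tX tst]] := stable_finite (lX x (mem_head _ _)).
exists (t ++ s); split.
- by move=> a; rewrite inE mem_cat => /orP [/eqP ->|/ls ->]; rewrite ?xt ?orbT.
- by move=> a; rewrite mem_cat => /orP [/tX|/sX].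
- by move=> g a gB; rewrite !mem_cat => /orP [/(tst g a gB) ->|/(sst g a gB) ->];
    rewrite ?orbT.
Qed.

(** A [c] in [P] is trivial on all that [P'] kills. By compactness finitely many members of [P']
    already force this, so on the kernel of the action [c] equals some [d] in [P']; then c/d is a
    coboundary, which [P'] contains. *)
Lemma fixed_field_inj P P' : cocycle_subgroup P -> cocycle_subgroup P' ->
  fixed_field P = fixed_field P' -> P `<=` P'.
Proof.
move=> hP hP' PP' c Pc.
have Pcoc d : P d -> cocy d by case: hP => h _ _ _; exact: h.
have Pcoc' d : P' d -> cocy d by case: hP' => h _ _ _; exact: h.
have hc := Pcoc c Pc; have [cmu [s0 [s0Y s0c]] cM] := hc.
(* Otherwise [h] agrees on a finite list with nothing killed by [P], so it moves an element of the
   fixed field of [P]; but [h] fixes that of [P'], which is the same field. *)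
have kill h : killed P' h -> c h = 1.
  move=> [hM hP'h]; apply: contrapT => ch.
  have [s [s0s sX sst]] := stable_finite_seq (fun a sa => YX (s0Y a sa)).
  have [||||x [Xx xfix hx]] := @moved_fixed_point _ (killed P) X s h hX sX.
  - split=> // d Pd.
    exact: (hom_on1 p_pr fixM_submonoid (hom_cocycle (Pcoc d Pd))).
  - move=> g k [gM gP] [kM kP]; split; first exact: fixM_comp.
    move=> d Pd; have [_ dM] := hom_cocycle (Pcoc d Pd).
    by have := dM _ _ gM kM; rewrite /= => ->; rewrite gP // kP // mulr1.
  - by move=> g a [gM _]; apply: sst; apply: fixL_B; exact: fixM_L.
  - move=> g [gM gP] hg; apply: ch; rewrite -(gP c Pc).
    by apply: s0c; [exact: fixM_L|exact: fixM_L|move=> a /s0s; exact: hg].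
  - apply: hx; have : fixed_field P x by split=> // g gM gP; exact: xfix.
    by rewrite PP' => -[_]; exact.
have P1 : P' (fun=> 1).
  have [_ h1 _ hext] := hP'; apply: (hext _ _ (h1 1 (mu1 _ _))).
    split=> [g _||g h _ _]; [exact: mu1|by exists [::]|by rewrite rmorph1 mulr1].
  by move=> g _; rewrite rmorph1 divr1.
have PM d d' : P' d -> P' d' -> P' (fun phi => d phi * d' phi).
  move=> Pd Pd'; have [_ _ hdiv _] := hP'.
  have := hdiv _ _ Pd (hdiv _ _ P1 Pd').
  by under eq_fun do rewrite div1r invrK.
have [l [lP hl]] : exists l, (forall d, List.In d l -> P' d) /\
    forall g, fixM g -> (forall d, List.In d l -> d g = 1) -> c g = 1.
  apply: contrapT => no.
  pose LM := L `|` mu q.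
  have LM_M g : fixes LM g <-> fixM g.
    split=> [h|[hL hM] x [/hL|/hM] //].
    by split=> x hx; apply: h; [left|right].
  have FLM : F `<=` LM by move=> x /FL ?; left.
  (* If no finite list sufficed, compactness would give one [g] on which every member of [P'] is 1
     and [c] is not, against [kill]. *)
  have [||g [/LM_M gM gU]] := @auto_compact _ F Falg LM _ P'
    (fun d => [set g : {rmorphism Omega -> Omega} | d g = 1 /\ c g <> 1]) FLM.
  - move=> d /Pcoc' [_ [s [_ sd]] _]; exists (s ++ s0) => g h gLM hLM gh.
    have gL : fixes L g by move=> x Lx; apply: gLM; left.
    have hL : fixes L h by move=> x Lx; apply: hLM; left.
    rewrite /= (sd g h) // ?(s0c g h) //.
      by move=> a sa; apply: gh; rewrite mem_cat sa orbT.
    by move=> a sa; apply: gh; rewrite mem_cat sa.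
  - move=> l lP; apply: contrapT => nog; apply: no; exists l; split=> // g gM gl.
    apply: contrapT => cg; apply: nog; exists g; split; first exact/LM_M.
    by move=> d dl; split=> //; exact: gl.
  - have [_ cg] := gU _ P1; apply: cg; apply: kill; split=> // d Pd.
    by case: (gU d Pd).
have [d Pd hd] := @hom_combination _ p n p_pr P' fixM l c
  (fun d Pd => hom_cocycle (Pcoc' d Pd)) P1 PM lP fixM_submonoid (hom_cocycle hc) hl.
have hd' := Pcoc' d Pd; have [dmu [s1 [s1Y s1d]] dM] := hd'.
have hcd := cocycle_div hc hd'.
have [|v vq hv] := cocycle_trivial p_pr p_odd n_gt0 p_neq0 muL Falg FL hcd.
  by move=> g gM; rewrite hd // divff //; apply: cocycle_neq0 => //; exact: fixM_L.
have [_ h1 _ hext] := hP'.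
apply: (hext _ _ (PM _ _ Pd (h1 v vq))) => // g gL.
by rewrite /= -hv // mulrC divfK //; exact: cocycle_neq0.
Qed.

Lemma trivial_on_subgroup S : cocycle_subgroup (trivial_on S).
Proof.
split.
- by move=> c [].
- move=> v vq; split; first exact: (cocycle_coboundary p_pr Falg FL muY).
  by move=> g gM _; rewrite gM.2 // divff // (mu_neq0 q0 vq).
- move=> c d [hc hcS] [hd hdS]; split; first exact: cocycle_div.
  by move=> g gM gS; rewrite hcS ?hdS ?divr1.
- move=> c d [hc hcS] hd cd; split=> // g gM gS.
  by rewrite -cd ?hcS //; exact: fixM_L.
Qed.

(** The hard inclusion: if [g] is killed but moves some [x] of [S], a character of the finite
    abelian group permuting the conjugates of [x] is nontrivial at [g]. It is equivariant, hence
    extends to a cocycle trivial on [S], a contradiction. *)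
Lemma fixed_field_surj S : twisted_ext S -> fixed_field (trivial_on S) = S.
Proof.
move=> [abS galS SX act].
have [hS BS Ssep Sst] := (galois_extP Falg S hB FB).1 galS.
have [galKS comm expo] := abS; have [_ _ KS _] := galKS.
apply/seteqP; split=> [x [Xx hx]|x Sx].
  have FS : F `<=` S by exact: subset_trans BS.
  apply: (separable_fix Falg hS FS).
    by apply: separable_sub BS _; exact: Xsep.
  move=> g gS; have [h [hL hg]] := lift_X (fixes_sub BS gS).
  have hfS : fixes S h by move=> y Sy; rewrite hg ?gS //; exact: SX.
  rewrite -hg //; apply: hx.
    by split=> //; apply/(KM hL); exact: fixes_sub hfS.
  by move=> c [hc]; apply=> //; split=> //; apply/(KM hL); exact: fixes_sub hfS.
split; first exact: SX.
move=> g gM gS; apply: contrapT => gx.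
have [s [sB us xs hs]] := separable_orbit Falg hB FB (Ssep x Sx).
have sS a : a \in s -> S a by move=> /hs [h hfB ->]; exact: (Sst h hfB).
have sst h a : fixes K h -> a \in s -> h a \in s.
  by move=> hfK; apply: root_conj sB _; exact: fixes_sub hfK.
pose G := root_perms_groupType K s.
have permK h : fixes K h -> exists2 pi : {perm seq_sub s}, pi \in G &
    forall a, h (ssval a) = ssval (pi a).
  exact: root_perm_exists.
have perm_uniq (phi : Omega -> Omega) (pi pi' : {perm seq_sub s}) :
    (forall a, phi (ssval a) = ssval (pi a)) ->
    (forall a, phi (ssval a) = ssval (pi' a)) -> pi = pi'.
  by move=> h h'; apply/permP => a; apply: val_inj; rewrite /= -h h'.
have res_gal_K h : fixes K h -> gal_group S K (res_gal S h).
  by move=> hfK; apply/(gal_group_res Falg _ FK galKS); exists h.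
have SstK h : fixes K h -> forall y, S y -> S (h y).
  by move=> hfK; apply: Sst; exact: fixes_sub hfK.
have commS h k y : fixes K h -> fixes K k -> S y -> h (k y) = k (h y).
  move=> hfK kfK Sy.
  have := comm _ _ (res_gal_K h hfK) (res_gal_K k kfK).
  rewrite -!res_gal_comp; [|exact: SstK|exact: SstK].
  by move=> /res_gal_inj /(_ y Sy).
have expS h y : fixes K h -> S y -> iter q h y = y.
  move=> hfK Sy; have := expo _ (res_gal_K h hfK).
  rewrite -res_gal_iter; last exact: SstK.
  by move=> /(congr1 (@^~ y)) /=; rewrite res_galE.
have sval_S (a : seq_sub s) : S (ssval a) by apply: sS; exact: ssvalP.
have abG : abelian G.
  apply/centsP => pi /root_permsP [h [hfK hpi]] pi' /root_permsP [k [kfK hpi']].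
  apply/permP => a; apply: val_inj; rewrite !permM /=.
  by rewrite -hpi -hpi' -hpi' -hpi commS.
have expG pi : pi \in G -> (pi ^+ q = 1)%g.
  move=> /root_permsP [h [hfK hpi]]; apply/permP => a; apply: val_inj.
  by rewrite /= -(root_perm_iter _ _ hpi) expS // perm1.
have gK := fixM_K gM.
have [pig pigG gpi] := permK g gK.
have pig1 : pig != 1%g.
  apply/eqP => e; apply: gx.
  by have := gpi (SeqSub xs); rewrite e perm1.
have [z hz] := exists_zeta n p_pr p_neq0.
have [phi [phiM phiq phig]] := character_separation abG expG q0 hz pigG pig1.
pose f (psi : Omega -> Omega) := xget 1 [set y | exists2 pi : {perm seq_sub s},
  (forall a, psi (ssval a) = ssval (pi a)) & y = phi pi].
have fE (psi : Omega -> Omega) (pi : {perm seq_sub s}) :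
    (forall a, psi (ssval a) = ssval (pi a)) -> f psi = phi pi.
  move=> hpi; rewrite /f; case: xgetP => [y _ [pi' hpi' ->]|/(_ (phi pi))].
    by rewrite (perm_uniq _ _ _ hpi hpi').
  by case; exists pi.
have G1 : (1%g : {perm seq_sub s}) \in G by exact: group1.
have phi1 : phi 1%g = 1.
  have := phiM _ _ G1 G1; rewrite mulg1 => /eqP.
  rewrite -[X in X == _]mulr1 (inj_eq (mulfI _)) => [/eqP //|].
  by apply: (mu_neq0 q0); exact: phiq.
have [||||c hc cf] := cocycle_extension p_pr p_odd n_gt0 p_neq0 muL Falg FL muY (f := f).
- move=> h hM; have [pi piG hpi] := permK h (fixM_K hM).
  by rewrite (fE h pi hpi); exact: phiq.
- have [s' [s'Y s'h]] : exists s' : seq Omega, (forall a, a \in s' -> Y a) /\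
      forall h, fixes L h -> fixes [set` s'] h -> forall a, a \in s -> h a = a.
    elim: (s) sS => [|a l IH] lS; first by exists [::].
    have [|s1 [s1Y h1]] := IH; first by move=> b bl; apply: lS; rewrite inE bl orbT.
    have [s2 [s2Y h2]] := Xfin (SX _ (lS a (mem_head _ _))).
    exists (s1 ++ s2); split; first by move=> b; rewrite mem_cat => /orP [/s1Y|/s2Y].
    move=> h hL hs12 b; rewrite inE => /orP [/eqP ->|bl].
      by apply: h2 => // y ys; apply: hs12; rewrite /= mem_cat; apply/orP; right.
    by apply: h1 => // y ys; apply: hs12; rewrite /= mem_cat; apply/orP; left.
  exists s'; split=> // h hM hs'; rewrite (fE h 1%g) // => a.
  by rewrite perm1 s'h //; [exact: fixM_L|exact: ssvalP].
- move=> h k hM kM; have [pi piG hpi] := permK h (fixM_K hM).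
  have [pi' piG' hpi'] := permK k (fixM_K kM).
  rewrite (fE h pi) // (fE k pi') // (fE (h \o k) (pi' * pi)%g).
    by rewrite phiM // mulrC.
  by move=> a; rewrite /= hpi' hpi permM.
(* Equivariance: conjugation by [r] raises the permutation of [h] to the power given by [chi], and
   [r] raises the roots of unity to the same power. *)
- move=> r h h' rL hM hM' e.
  have rB := fixL_B rL.
  have [pi piG hpi] := permK h (fixM_K hM).
  have hrK : gal_group K B (res_gal K r) by exact: res_gal_gal.
  have hrS : gal_group S B (res_gal S r) by exact: res_gal_gal.
  have := act (res_gal K r) (res_gal S r) (res_gal S h) hrK hrS.
  set i := val _ => key.
  have h'E y : S y -> h' y = iter i h y.
    move=> Sy; have [r' [rL' rr' r'r]] := auto_inv Falg FL rL.
    have Sr'y : S (r' y) by apply: Sst Sy; exact: fixL_B.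
    have SstL k : fixes L k -> forall y0, S y0 -> S (k y0).
      by move=> kL; apply: Sst; exact: fixL_B.
    have hL := fixM_L hM.
    have rK : {in K, res_gal S r =1 res_gal K r}.
      by move=> u /set_mem Ku; rewrite !res_galE //; exact: KS.
    have := key rK (res_gal_K h (fixM_K hM)).
    rewrite -res_gal_iter; last exact: SstL.
    rewrite -!res_gal_comp; [|exact: SstL|exact: SstL].
    move=> /res_gal_inj /(_ (r' y) Sr'y) /=.
    by rewrite e r'r.
  rewrite (fE h pi) // (fE h' (pi ^+ i)%g); last first.
    by move=> a; rewrite h'E // (root_perm_iter _ _ hpi).
  have phiX j : phi (pi ^+ j)%g = phi pi ^+ j.
    elim: j => [|j IH]; first by rewrite expg0 expr0.
    by rewrite expgS exprS phiM ?groupX // IH.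
  rewrite phiX; apply/esym; apply: chiP => //; last exact: phiq.
  by move=> u Ku; rewrite res_galE.
have cS : trivial_on S c.
  split=> // h hM hfS; rewrite cf // (fE h 1%g) // => a.
  by rewrite perm1 hfS.
by apply: phig; rewrite -(fE g pig gpi) -cf // gS.
Qed.

End Duality.

(** * The tower over F *)

Lemma expr_Zp_unitM (Omega : closedFieldType) m (w : Omega) (a b : {unit 'Z_m}) :
  (1 < m)%N -> mu m w -> w ^+ val (a * b)%g = (w ^+ val a) ^+ val b.
Proof.
move=> m1 hw; rewrite -exprM -[RHS](expr_mod _ hw); congr (_ ^+ _).
by rewrite /=; congr (modn _ _); exact: Zp_cast.
Qed.

Lemma expr_Zp_unit1 (Omega : closedFieldType) m (w : Omega) :
  (1 < m)%N -> mu m w -> w ^+ val (1%g : {unit 'Z_m}) = w.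
Proof.
move=> m1 hw; rewrite -[RHS]expr1 -[RHS](expr_mod _ hw); congr (_ ^+ _).
by rewrite modn_small.
Qed.

(** [g] raises a primitive root to a power coprime to [m], so the default value in [cyclo] is not
    reached. The map [phi] is typically a restriction of [g]. *)
Lemma cycloP (Omega : closedFieldType) m (z : Omega) (phi : Omega -> Omega)
    (g : {rmorphism Omega -> Omega}) : (1 < m)%N -> m.-primitive_root z ->
  (forall w, mu m w -> phi w = g w) ->
  forall w, mu m w -> g w = w ^+ val (cyclo m phi).
Proof.
move=> m1 hz hphi.
have [k gk] := mu_prim hz (mu_auto g (mu_prim_root hz)).
have ck : coprime k m.
  by rewrite -(prim_root_exp_coprime k hz) -gk fmorph_primitive_root.
have uk : (k%:R : 'Z_m) \is a GRing.unit by rewrite unitZpE // coprime_sym.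
rewrite /cyclo; case: xgetP => [a _ ha w hw|/(_ (FinRing.unit 'Z_m uk)) []].
  by rewrite -hphi // ha.
move=> w hw; rewrite hphi //= val_Zp_nat // (expr_mod _ hw).
by have [i ->] := mu_prim hz hw; rewrite rmorphXn gk exprAC.
Qed.

Lemma iter_coprime (T : Type) (f : T -> T) a b x : (0 < a)%N -> coprime a b ->
  iter a f x = x -> iter b f x = x -> f x = x.
Proof.
move=> a0 cab ha hb; have [u v huv _] := egcdnP b a0.
have it k m : iter k f x = x -> iter (m * k) f x = x.
  by move=> h; rewrite iterM; elim: m => //= m ->.
have := it a u ha; rewrite huv (eqP cab) addn1 iterS.
by rewrite (it b v hb).
Qed.

Section Tower.
Variable Omega : closedFieldType.
Implicit Types (S T K : set Omega) (g h : {rmorphism Omega -> Omega}).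
Variables (F : set Omega) (p n : nat).
Hypothesis Falg : forall x, exists q : {poly Omega},
  [/\ q != 0, forall i, F q`_i & root q x].
Hypotheses (hF : is_subfield F) (p_pr : prime p) (p_odd : odd p)
  (n_gt0 : (0 < n)%N) (p_neq0 : p%:R != 0 :> Omega).

Local Notation q := (p ^ n)%N.
Local Notation Fp := (max_p_ext p F).
Local Notation L := (fieldL p F).
Local Notation M := (fieldM p n F).
Local Notation E := (fieldE p n F).
Local Notation J := (fieldJ p F).
Local Notation Lp := (max_p_ext p L).

Lemma mu_seq m : (0 < m)%N -> m%:R != 0 :> Omega -> exists s : seq Omega,
  uniq s /\ ((forall x, x \in s <-> mu m x) /\
             forall i, F (\prod_(a <- s) ('X - a%:P))`_i).
Proof.
move=> m0 mn0; have [s hs] := closed_field_poly_normal ('X^m - 1 : {poly Omega}).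
have lc : lead_coef ('X^m - 1 : {poly Omega}) = 1.
  by apply/eqP; rewrite -monicE monicXnsubC.
rewrite lc scale1r in hs; exists s; split.
  by rewrite -separable_prod_XsubC -hs; exact: cyclotomic.separable_Xn_sub_1.
split=> [x|i].
  rewrite -root_prod_XsubC -hs /root !hornerE subr_eq0.
  by split=> /eqP.
rewrite -hs coefB coefXn coef1; apply: (sfB hF).
  by case: eqP => _; [exact: sf1|exact: sf0].
by case: eqP => _; [exact: sf1|exact: sf0].
Qed.

Lemma mu_seq_p k : exists s : seq Omega, [/\ uniq s, forall x, x \in s <-> mu (p ^ k) x,
  forall x, x \in s -> separable_over F x &
  forall g x, x \in s -> g x \in s].
Proof.
have [||s [us [sP sF]]] := @mu_seq (p ^ k).
- by rewrite expn_gt0 prime_gt0.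
- by rewrite natrX expf_neq0.
exists s; split=> // [x xs|g x /sP hx]; first by exists s.
by apply/sP; exact: mu_auto.
Qed.

Let p1 : (1 < p)%N. Proof. exact: prime_gt1. Qed.
Let q1 : (1 < q)%N. Proof. by rewrite -(exp1n n) ltn_exp2r. Qed.

Lemma galois_mu k : galois_ext F (gen_field (F `|` mu (p ^ k))).
Proof.
have [s [us sP ssep sst]] := mu_seq_p k.
apply: (galois_gen Falg) => // [x /sP|g _ x]; [exact: ssep|exact: mu_auto].
Qed.

Lemma galois_L : galois_ext F L.
Proof. by have := galois_mu 1; rewrite expn1. Qed.

Let sfL : is_subfield L. Proof. exact: gen_subfield. Qed.
Let hM : is_subfield M. Proof. exact: gen_subfield. Qed.
Let sfFp : is_subfield Fp. Proof. exact: gen_subfield. Qed.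
Let hLp : is_subfield Lp. Proof. exact: gen_subfield. Qed.
Let hJ : is_subfield J. Proof. exact: gen_subfield. Qed.
Lemma subfieldE : is_subfield E. Proof. exact: subfieldI. Qed.

Let FL : F `<=` L. Proof. by move=> x Fx; apply: mem_gen_field; left. Qed.
Let FM : F `<=` M. Proof. by move=> x Fx; apply: mem_gen_field; left. Qed.
Let FFp : F `<=` Fp. Proof. by move=> x Fx; apply: mem_gen_field; left. Qed.
Let LLp : L `<=` Lp. Proof. by move=> x Lx; apply: mem_gen_field; left. Qed.
Let FE : F `<=` E. Proof. by move=> x Fx; split; [exact: FM|exact: FFp]. Qed.
Let FpJ : Fp `<=` J. Proof. by move=> x Lx; apply: mem_gen_field; left. Qed.

Lemma muL : mu p `<=` L. Proof. by move=> x hx; apply: mem_gen_field; right. Qed.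
Lemma mu_M : mu q `<=` M. Proof. by move=> x hx; apply: mem_gen_field; right. Qed.
Let muJ : mu p `<=` J. Proof. by move=> x hx; apply: mem_gen_field; right. Qed.

Lemma mu_p_q : mu p `<=` (mu q : set Omega).
Proof.
by move=> x; rewrite /mu /= -(prednK n_gt0) expnS exprM => ->; rewrite expr1n.
Qed.

Lemma L_sub_M : L `<=` M.
Proof.
apply: gen_min hM _ => x [Fx|hx]; first exact: FM.
by apply: mu_M; exact: mu_p_q.
Qed.

Let LJ : L `<=` J.
Proof. by apply: gen_min hJ _ => x [/FFp /FpJ|/muJ]. Qed.

(** Conjugation by [g] carries the periods at [x] to those at [g x]. Here [g] preserves [K] without
    having to fix it, as is needed for the action of Aut(Omega/F) on L(p). *)
Lemma max_p_ext_auto K g g' x : is_subfield K -> F `<=` K -> cancel g g' ->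
  cancel g' g -> (forall y, K y -> K (g y)) ->
  max_p_ext p K x -> max_p_ext p K (g x).
Proof.
move=> hK FK gg' g'g Kg /(max_p_extP Falg x p_pr hK FK) [[s [sK us xs]] xper].
apply/(max_p_extP Falg _ p_pr hK FK); split.
  exists (map g s); split; last exact: map_f.
    have -> : \prod_(a <- map g s) ('X - a%:P) = map_poly g (\prod_(a <- s) ('X - a%:P)).
      rewrite big_map rmorph_prod; apply: eq_bigr => a _.
      by rewrite rmorphB /= map_polyX map_polyC.
    by move=> i; rewrite coef_map; exact: Kg.
  by rewrite map_inj_uniq //; exact: fmorph_inj.
move=> h hK'; have [|j hj] := xper (g' \o (h \o g)).
  by move=> y Ky /=; rewrite hK' ?gg' //; exact: Kg.
have e m : iter m h (g x) = g (iter m (g' \o (h \o g)) x).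
  by elim: m => //= m ->; rewrite g'g.
by exists j; rewrite e hj.
Qed.

Lemma Fp_stable : auto_stable F Fp.
Proof.
move=> g gF x; have [h [hF' gh hg]] := auto_inv Falg (@subset_refl _ F) gF.
by apply: max_p_ext_auto gh hg _ => // y Fy; rewrite gF.
Qed.

Lemma L_stable : auto_stable F L.
Proof. by case: ((galois_extP Falg L hF (@subset_refl _ F)).1 galois_L). Qed.

Lemma M_stable : auto_stable F M.
Proof. by case: ((galois_extP Falg M hF (@subset_refl _ F)).1 (galois_mu n)). Qed.

Lemma E_stable : auto_stable F E.
Proof. by move=> g gF x [Mx Fpx]; split; [exact: M_stable|exact: Fp_stable]. Qed.

Lemma Lp_stable : auto_stable F Lp.
Proof.
move=> g gF x; have [h [hF' gh hg]] := auto_inv Falg (@subset_refl _ F) gF.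
by apply: max_p_ext_auto gh hg _ => // y Ly; exact: (L_stable gF).
Qed.

Lemma Fp_sep : Fp `<=` separable_over F.
Proof. by move=> x /(max_p_extP Falg x p_pr hF (@subset_refl _ F)) []. Qed.

Lemma galois_Fp : galois_ext F Fp.
Proof.
apply/(galois_extP Falg) => //; split=> //; [exact: Fp_sep|exact: Fp_stable].
Qed.

Lemma J_sep : J `<=` separable_over F.
Proof.
apply: gen_min; first exact: (separable_subfield Falg).
have [s [us sP ssep sst]] := mu_seq_p 1; rewrite expn1 in sP.
by move=> x [/Fp_sep //|/sP]; exact: ssep.
Qed.

Lemma J_stable : auto_stable F J.
Proof.
move=> g gF; apply: gen_stable => x [Fpx|hx]; apply: mem_gen_field.
  by left; exact: Fp_stable.
by right; exact: mu_auto.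
Qed.

Lemma galois_J : galois_ext F J.
Proof.
apply/(galois_extP Falg) => //; split=> //.
- by apply: subset_trans FpJ.
- exact: J_sep.
- exact: J_stable.
Qed.

Lemma galois_J_L : galois_ext L J.
Proof. exact: (galois_ext_sub Falg galois_J). Qed.

(** On mu_q every automorphism over L is an iterate of the generator, of order p^e. This places mu_q
    inside L(p), where [alpha] reads off the action. *)
Lemma mu_q_period : exists e, forall g, fixes L g -> forall w, mu q w ->
  iter (p ^ e) g w = w.
Proof.
have [t [a [e [z [w act]]]]] := exists_cyclic_action p_pr p_odd n_gt0 p_neq0 muL.
exists e => g gL v hv; have [i gi] := ca_gen act gL.
have key k : iter k g v = iter (i * k) t v.
  elim: k => [|k IH]; first by rewrite muln0.
  rewrite iterS IH gi; first by rewrite mulnS iterD.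
  by rewrite -auto_iterE; exact: mu_auto.
rewrite key; apply: (proj2 (ca_iter_fix p_pr p_odd act _)) => //.
exact: dvdn_mull.
Qed.

Let Fp_Lp : Fp `<=` Lp.
Proof.
move=> x /(max_p_extP Falg x p_pr hF (@subset_refl _ F)) [xsep xper].
apply/(max_p_extP Falg x p_pr sfL FL); split; first exact: separable_sub xsep.
by move=> g gL; apply: xper; exact: fixes_sub gL.
Qed.

Let mu_Lp : mu q `<=` Lp.
Proof.
move=> w hw; apply/(max_p_extP Falg w p_pr sfL FL); split.
  have [s [us sP ssep sst]] := mu_seq_p n.
  by apply: separable_sub FL _; apply/ssep/sP.
by move=> g gL; have [e he] := mu_q_period; exists e; exact: he.
Qed.

(** At [x] an automorphism over [F] has a [p]-power period because [x] is in F(p), and the period p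
    - 1 because it acts on mu_p as a power prime to [p]. The two periods are coprime. *)
Lemma Fp_cap_L x : Fp x -> L x -> F x.
Proof.
move=> Fpx Lx; have [xsep xper] := (max_p_extP Falg x p_pr hF (@subset_refl _ F)).1 Fpx.
apply: (separable_fix Falg hF _ xsep) => // g gF.
have [j hj] := xper g gF.
suff hx : iter p.-1 g x = x.
  apply: (iter_coprime (a := p ^ j) (b := p.-1)) => //.
    by rewrite expn_gt0 prime_gt0.
  by rewrite coprimeXl // prime_coprime // gtnNdvd //; lia.
rewrite -auto_iterE; apply: (fixes_gen (X := F `|` mu p)) Lx => y [Fy|hy].
  by rewrite auto_iterE; exact: fixes_iter gF y Fy.
have [z hz] := exists_prim_root (prime_gt0 p_pr) p_neq0.
have [k gk] := mu_prim hz (mu_auto g (mu_prim_root hz)).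
have ck : coprime k p.
  by rewrite -(prim_root_exp_coprime k hz) -gk fmorph_primitive_root.
have gy u : mu p u -> g u = u ^+ k.
  by move=> /(mu_prim hz) [i ->]; rewrite rmorphXn gk exprAC.
have it i : iter i g y = y ^+ (k ^ i).
  elim: i => [|i IH]; first by rewrite expn0 expr1.
  by rewrite iterS IH gy ?expnSr ?exprM //; exact: muX.
rewrite auto_iterE it -[RHS]expr1 -[LHS](expr_mod _ hy) -[RHS](expr_mod _ hy).
by congr (_ ^+ _); rewrite -totient_prime //; exact: Euler_exp_totient.
Qed.

(** If [g] agreed on these roots of unity with no automorphism over F(p), it would move an element
    of [K] fixed by all of those; such an element lies in F(p), where [g] is trivial by
    assumption. *)
Lemma factor_Fp g K k : fixes F g -> K = gen_field (F `|` mu (p ^ k)) ->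
  (forall x, K x -> Fp x -> g x = x) ->
  exists h, fixes Fp h /\ forall x, mu (p ^ k) x -> h x = g x.
Proof.
move=> gF -> gfix; have [s [us sP ssep sst]] := mu_seq_p k.
apply: contrapT => no.
have [||||||x [Kx xfix gx]] := @moved_fixed_point _
  [set h : {rmorphism Omega -> Omega} | fixes Fp h]
  (gen_field (F `|` mu (p ^ k))) s g.
- exact: gen_subfield.
- by move=> a /sP ha; apply: mem_gen_field; right.
- by [].
- by move=> h h' hh hh'; exact: fixes_comp.
- by move=> h a _; exact: sst.
- move=> h hFp e; apply: no; exists h; split=> // x /sP xs; rewrite e //.
apply: gx; apply: gfix => //; apply: (separable_fix Falg sfFp FFp).
  have [_ _ Ksep _] := (galois_extP Falg _ hF (@subset_refl _ F)).1 (galois_mu k).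
  by apply: separable_sub FFp _; exact: Ksep.
exact: xfix.
Qed.

(** On mu_p, [g] agrees with an automorphism over F(p), since L and F(p) meet in [F]. Composing [g]
    with its inverse fixes L and changes nothing on F(p). *)
Lemma lift_Fp g : fixes F g ->
  exists h, fixes L h /\ forall x, Fp x -> h x = g x.
Proof.
move=> gF.
have [||h [hFp hg]] := @factor_Fp g L 1 gF.
- by rewrite expn1.
- by move=> x Lx Fpx; apply: gF; exact: Fp_cap_L.
rewrite expn1 in hg.
have [h' [hFp' hh' h'h]] := auto_inv Falg FFp hFp.
exists (h' \o g); split.
  apply: fixes_gen => x [Fx|hx] /=; first by rewrite gF // hFp' //; exact: FFp.
  by rewrite -hg // hh'.
by move=> x Fpx /=; rewrite hFp' //; exact: (Fp_stable gF).
Qed.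

(** * The character [theta], the twisted action and the stabilizers of E and M *)

Section Theta.
Variable theta : (Omega -> Omega) -> {unit 'Z_q}.
Hypothesis theta_char : is_theta F theta.

Let zeta : exists z : Omega, q.-primitive_root z.
Proof. exact: exists_zeta. Qed.

Lemma alpha_res T g w : mu q `<=` T -> mu q w -> g w = w ^+ val (alpha p n (res_gal T g)).
Proof.
move=> muT; have [z hz] := zeta; move: w; apply: (cycloP q1 hz) => w hw.
by rewrite res_galE //; exact: muT.
Qed.

Let calG_res g : fixes F g -> calG p F (res_gal Lp g).
Proof.
move=> gF; apply: (res_gal_gal Falg) => //; first exact: Lp_stable.
exact: subset_trans LLp.
Qed.

Let groupN_res g : fixes Fp g -> groupN p F (res_gal Lp g).
Proof.
move=> gFp; apply: (res_gal_gal Falg) => //.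
by move=> h hFp; apply: Lp_stable; exact: fixes_sub hFp.
Qed.

Let groupGL_res g : fixes L g -> groupGL p F (res_gal Lp g).
Proof.
move=> gL; apply: (res_gal_gal Falg) => //.
by move=> h hL'; apply: Lp_stable; exact: fixes_sub hL'.
Qed.

(** The restriction of [g] to L(p) lies in both [groupN] and [groupGL], so [theta] takes there the
    value of [alpha] as well as 1. *)
Lemma mu_q_fixed_J g : fixes Fp g -> fixes (mu p) g -> fixes (mu q) g.
Proof.
move=> gFp gmu w hw; have [_ tN tL] := theta_char.
have gL : fixes L g.
  by apply: fixes_gen => x [Fx|hx]; [apply: gFp; exact: FFp|exact: gmu].
rewrite (alpha_res g mu_Lp hw) -(tN _ (groupN_res gFp)) (tL _ (groupGL_res gL)).
exact: expr_Zp_unit1.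
Qed.

Lemma mu_q_J : mu q `<=` J.
Proof.
move=> w hw; have FJ : F `<=` J by exact: subset_trans FpJ.
apply: (separable_fix Falg hJ FJ).
  have [s [us sP ssep sst]] := mu_seq_p n.
  by apply: separable_sub FJ _; apply/ssep/sP.
move=> g gJ; apply: mu_q_fixed_J => //; exact: fixes_sub gJ.
Qed.

Lemma M_sub_J : M `<=` J.
Proof. by apply: gen_min hJ _ => x [/FFp /FpJ|/mu_q_J]. Qed.

Lemma fixes_M_mu g : fixes L g -> fixes M g <-> fixes (mu q) g.
Proof.
move=> gL; split; first by apply: fixes_sub; exact: mu_M.
move=> gmu; apply: fixes_gen => x [Fx|]; [apply: gL; exact: FL|exact: gmu].
Qed.

(** If [g] fixes E, then by [factor_Fp] it agrees on mu_q with an automorphism over F(p). The latter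
    fixes mu_p because [g] does, hence mu_q. *)
Lemma fixes_E_mu g : fixes L g -> fixes E g <-> fixes (mu q) g.
Proof.
move=> gL; split; last first.
  by move=> /(fixes_M_mu gL) gM x [Mx _]; exact: gM.
move=> gE; have gF := fixes_sub FL gL.
have [||h [hFp hg]] := @factor_Fp g M n gF.
- by [].
- by move=> x Mx Fpx; apply: gE.
move=> w hw; rewrite -hg //; apply: mu_q_fixed_J => // x hx.
by rewrite hg; [apply: gL; exact: muL|exact: mu_p_q].
Qed.

(** Write g = k h with [k] over F(p). As [theta] is 1 at [h] and equals [alpha] at [k], the twist
    cancels exactly the effect of [k] on mu_q. *)
Lemma theta_lift g h w : fixes F g -> fixes L h ->
  (forall x, Fp x -> h x = g x) -> mu q w ->
  (g w) ^+ val (theta (res_gal Lp g))^-1%g = h w.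
Proof.
move=> gF hL' hg hw; have [tM tN tL] := theta_char.
have [h' [hL'' hh' h'h]] := auto_inv Falg FL hL'.
pose k : {rmorphism Omega -> Omega} := g \o h'.
have kFp : fixes Fp k.
  move=> x Fpx; rewrite /= -hg ?h'h //; apply: Fp_stable => //.
  exact: fixes_sub hL''.
have gE : res_gal Lp g = res_gal Lp k \o res_gal Lp h.
  rewrite -res_gal_comp; last by apply: Lp_stable; exact: fixes_sub hL'.
  by apply: res_gal_eq => x _; rewrite /= hh'.
have tg : theta (res_gal Lp g) = theta (res_gal Lp k).
  rewrite gE tM; first by rewrite (tL _ (groupGL_res hL')) mulg1.
    by apply: calG_res; exact: fixes_sub kFp.
  by apply: calG_res; exact: fixes_sub hL'.
have gw : g w = k (h w) by rewrite /= hh'.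
have hwq : mu q (h w) by exact: mu_auto.
rewrite gw (alpha_res k mu_Lp hwq) -(tN _ (groupN_res kFp)) tg.
by rewrite -expr_Zp_unitM // mulgV expr_Zp_unit1.
Qed.

Lemma to_calG_lift K sigma g : fixes F g -> (forall x, K x -> g x = sigma x) ->
  K `<=` Lp -> exists h, [/\ fixes F h, to_calG p F K sigma = res_gal Lp h &
    forall x, K x -> h x = sigma x].
Proof.
move=> gF gs KLp; rewrite /to_calG /lift_gal.
case: xgetP => [tau _ [htau ts]|/(_ (res_gal Lp g)) []]; last first.
  split; first exact: calG_res.
  by move=> x /set_mem Kx; rewrite res_galE ?gs //; exact: KLp.
have FLp : F `<=` Lp by exact: subset_trans LLp.
have [h [hF' hE]] := gal_extend Falg (@subset_refl _ F) FLp hF hLp htau.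
exists h; split=> // x Kx; rewrite -ts; last exact: mem_set.
by rewrite hE res_galE //; exact: KLp.
Qed.

Lemma twisted_actE g w : fixes L g -> mu q w ->
  twisted_act F theta (res_gal Fp g) w = g w.
Proof.
move=> gL hw; have gF := fixes_sub FL gL.
have [h [hF' hE hg]] := @to_calG_lift Fp (res_gal Fp g) g gF
  (fun x Fpx => esym (res_galE g Fpx)) Fp_Lp.
rewrite /twisted_act hE res_galE; last exact: mu_Lp.
by apply: theta_lift => // x Fpx; rewrite hg // res_galE.
Qed.

(** The chosen lift of [sigma] is immaterial: its twisted action is that of an automorphism over L,
    and two of these agreeing on E agree on mu_q. *)
Lemma alpha_theta_invE g sigma w : fixes L g -> gal_group E F sigma ->
  (forall x, E x -> g x = sigma x) -> mu q w ->
  g w = w ^+ val (alpha_theta_inv F theta sigma).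
Proof.
move=> gL hsigma gs hw; have gF := fixes_sub FL gL.
have ELp : E `<=` Lp by move=> x [_ /Fp_Lp].
have [h [hF' hE hg]] := to_calG_lift gF gs ELp.
have [k [kL kh]] := lift_Fp hF'.
rewrite /alpha_theta_inv hE expr_Zp_unitM // -alpha_res //.
rewrite (theta_lift hF' kL kh hw).
have [k' [kL' kk' k'k]] := auto_inv Falg FL kL.
have : fixes (mu q) (k' \o g).
  apply/fixes_E_mu; first exact: fixes_comp.
  by move=> x Ex; rewrite /= gs // -hg // -kh ?kk' //; case: Ex.
by move=> /(_ w hw) /= e; rewrite -[in RHS]e k'k.
Qed.

(** J is generated by mu_p, which L contains, and F(p), of which each element of J involves only
    finitely many members. This transfers continuity from J to F(p). *)
Lemma J_finite x : J x -> exists s : seq Omega, (forall a, a \in s -> Fp a) /\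
  forall g, fixes L g -> fixes [set` s] g -> g x = x.
Proof.
pose Z := [set x | exists s : seq Omega, (forall a, a \in s -> Fp a) /\
  forall g, fixes L g -> fixes [set` s] g -> g x = x].
have key (op : Omega -> Omega -> Omega) :
    (forall g, {morph g : x y / op x y}) ->
    forall x y, Z x -> Z y -> Z (op x y).
  move=> gop y z [s [sFp hs]] [t [tFp ht]]; exists (s ++ t).
  split; first by move=> a; rewrite mem_cat => /orP [/sFp|/tFp].
  move=> g gL gst; rewrite gop (hs g gL) ?(ht g gL) // => a ha; apply: gst;
    by rewrite /= mem_cat; apply/orP; by [left|right].
apply: (@gen_min _ Z).
  apply/subfieldP; split.
  - by exists [::]; split=> // g _ _; rewrite rmorph1.
  - by apply: (key (fun x y => x - y)) => g y z; rewrite rmorphB.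
  - by apply: (key (fun x y => x / y)) => g y z; rewrite fmorph_div.
move=> y [Fpy|hy].
  exists [:: y]; split=> [a|g gL gy]; first by rewrite inE => /eqP ->.
  by apply: gy; rewrite /= mem_head.
by exists [::]; split=> // g gL _; apply: gL; exact: muL.
Qed.

Lemma mu_q_finite : exists s : seq Omega, (forall a, a \in s -> Fp a) /\
  forall g, fixes L g -> fixes [set` s] g -> fixes (mu q) g.
Proof.
have [z hz] := zeta; have zJ := mu_q_J (mu_prim_root hz).
have [s [sFp hs]] := J_finite zJ; exists s; split=> // g gL gs w.
by move=> /(mu_prim hz) [i ->]; rewrite rmorphXn hs.
Qed.

(** * Cohomology classes *)

Local Notation V := (mu q : set Omega).
Local Notation act := (twisted_act F theta).
Local Notation Z1F := (Z1 (GF p F) V act).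
Local Notation classF := (H1_class (GF p F) V act).
Local Notation cocy := (cocycle L p n Fp).
Implicit Types (A : set (set ((Omega -> Omega) -> Omega)))
  (P : set ((Omega -> Omega) -> Omega)) (c d : (Omega -> Omega) -> Omega).

Let q_gt0 : (0 < q)%N. Proof. by rewrite expn_gt0 prime_gt0. Qed.

Let FpL_stable g : fixes L g -> forall x, Fp x -> Fp (g x).
Proof. by move=> gL; apply: Fp_stable; exact: fixes_sub gL. Qed.

Lemma GF_res (sigma : Omega -> Omega) :
  GF p F sigma <-> exists g, fixes L g /\ sigma = res_gal Fp g.
Proof.
split.
  move=> /(gal_group_res Falg _ (@subset_refl _ F) galois_Fp) [g [gF ->]].
  have [h [hL' hg]] := lift_Fp gF; exists h; split=> //.
  by apply: res_gal_eq => x Fpx; rewrite hg.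
move=> [g [gL ->]]; apply/(gal_group_res Falg _ (@subset_refl _ F) galois_Fp).
by exists g; split=> //; exact: fixes_sub gL.
Qed.

Let GF_resL g : fixes L g -> GF p F (res_gal Fp g).
Proof. by move=> gL; apply/GF_res; exists g. Qed.

Let res_comp g h : fixes L h ->
  res_gal Fp (g \o h) = res_gal Fp g \o res_gal Fp h.
Proof. by move=> hL; apply: res_gal_comp; exact: FpL_stable. Qed.

Lemma Z1_cocycle c : Z1F c -> cocy (fun phi => c (res_gal Fp phi)).
Proof.
move=> [cV cK cM].
have cmu g : fixes L g -> mu q (c (res_gal Fp g)).
  by move=> gL; apply: cV; exact: GF_resL.
have cM' g h : fixes L g -> fixes L h ->
    c (res_gal Fp (g \o h)) = c (res_gal Fp g) * g (c (res_gal Fp h)).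
  move=> gL hL; rewrite res_comp // cM; [|exact: GF_resL|exact: GF_resL].
  by rewrite twisted_actE //; exact: cmu.
split=> //.
have idL : fixes L idfun by [].
have c1 : c (res_gal Fp idfun) = 1.
  have := cM' _ _ idL idL; rewrite /= -[X in res_gal Fp X](_ : idfun = _) //.
  have c0 := mu_neq0 q_gt0 (cmu _ idL); rewrite /= in c0 *.
  by move=> /eqP; rewrite -[X in X == _]mulr1 (inj_eq (mulfI c0)) eq_sym => /eqP.
(* Continuity at the identity gives one list valid everywhere, by translation with the cocycle
   relation. Points outside F(p) are dropped, since restrictions are the identity there. *)
have [s hs] := cK _ (GF_resL idL).
exists [seq x <- s | x \in Fp]; split.
  by move=> a; rewrite mem_filter => /andP [/set_mem].
move=> g h gL hL gh; have [g' [gL' gg' g'g]] := auto_inv Falg FL gL.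
have kL : fixes L (g' \o h) by exact: fixes_comp.
have hE : (h : Omega -> Omega) = g \o (g' \o h) by apply/funext => x /=; rewrite g'g.
have := cM' g (g' \o h) gL kL; rewrite /= -hE => ->.
rewrite (hs (res_gal Fp (g' \o h))); last 2 first.
- exact: GF_resL kL.
- move=> x xs; have [Fpx|nFpx] := pselect (Fp x).
    by rewrite !res_galE //= -gh ?gg' // mem_filter xs mem_set.
  by rewrite !res_gal_out.
by rewrite c1 rmorph1 mulr1.
Qed.

Lemma cocycle_Z1 c : cocy c -> exists2 c0, Z1F c0 &
  forall g, fixes L g -> c g = c0 (res_gal Fp g).
Proof.
move=> [cmu [s [sFp sc]] cM].
pose R (psi : Omega -> Omega) := [set y | exists g : {rmorphism Omega -> Omega},
  [/\ fixes L g, psi = res_gal Fp g & y = c g]].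
pose c0 psi := xget 1 (R psi).
have cE g : fixes L g -> c g = c0 (res_gal Fp g).
  move=> gL; rewrite /c0; case: xgetP => [y _ [h [hL e ->]]|/(_ (c g)) []].
    by apply: sc => // a /sFp; exact: (res_gal_inj e).
  by exists g.
exists c0 => //; split.
- by move=> _ /GF_res [g [gL ->]]; rewrite -cE //; exact: cmu.
- move=> _ /GF_res [g [gL ->]]; exists s => _ /GF_res [h [hL ->]] e.
  rewrite -!cE //; apply: sc => // a sa; have := e a sa.
  by rewrite !res_galE //; exact: sFp.
- move=> _ _ /GF_res [g [gL ->]] /GF_res [h [hL ->]].
  have ghL : fixes L (g \o h) by exact: fixes_comp.
  have := cE _ ghL; rewrite /= => cgh; rewrite -res_comp // -cgh -!cE // [LHS]cM //.
  by rewrite twisted_actE //; exact: cmu.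
Qed.

Lemma B1_res (b : (Omega -> Omega) -> Omega) :
  B1 (GF p F) V act b <->
  exists2 v, mu q v & forall g, fixes L g -> b (res_gal Fp g) = g v / v.
Proof.
split=> [[v hv hb]|[v hv hb]]; exists v => //.
  by move=> g gL; rewrite hb ?twisted_actE //; exact: GF_resL.
by move=> _ /GF_res [g [gL ->]]; rewrite hb // twisted_actE.
Qed.

Let V_neq0 c g : Z1F c -> fixes L g -> c (res_gal Fp g) != 0.
Proof.
by move=> [cV _ _] gL; apply: (mu_neq0 q_gt0); apply: cV; exact: GF_resL.
Qed.

Lemma class_self c : Z1F c -> classF c c.
Proof.
move=> hc; split=> //; apply/B1_res; exists 1; first exact: mu1.
by move=> g gL; rewrite rmorph1 !divff ?oner_eq0 //; exact: V_neq0.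
Qed.

Lemma class_eq c d : Z1F c -> Z1F d ->
  classF c d -> classF c = classF d.
Proof.
move=> hc hd [_ /B1_res [v hv cd]]; have v0 := mu_neq0 q_gt0 hv.
apply/seteqP; split=> x [hx /B1_res [u hu cx]]; split=> //; apply/B1_res.
  exists (u / v); first by apply: muM => //; exact: muV.
  move=> g gL; have c0 := V_neq0 hc gL; have d0 := V_neq0 hd gL.
  have gv0 : g v != 0 by rewrite fmorph_eq0.
  have u0 := mu_neq0 q_gt0 hu.
  have dE : d (res_gal Fp g) = g v / v * c (res_gal Fp g) by rewrite -cd // divfK.
  have xE : x (res_gal Fp g) = g u / u * c (res_gal Fp g) by rewrite -cx // divfK.
  by rewrite dE xE fmorph_div; field; rewrite c0 gv0 u0 v0.
exists (u * v); first exact: muM.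
move=> g gL; have c0 := V_neq0 hc gL; have d0 := V_neq0 hd gL.
have gv0 : g v != 0 by rewrite fmorph_eq0.
have u0 := mu_neq0 q_gt0 hu.
have dE : d (res_gal Fp g) = g v / v * c (res_gal Fp g) by rewrite -cd // divfK.
have xE : x (res_gal Fp g) = g u / u * d (res_gal Fp g) by rewrite -cx // divfK.
by rewrite xE dE rmorphM; field; rewrite c0 u0 v0.
Qed.

Lemma class_eq_res c d : Z1F c -> Z1F d ->
  (forall g, fixes L g -> c (res_gal Fp g) = d (res_gal Fp g)) ->
  classF c = classF d.
Proof.
move=> hc hd cd; apply: class_eq => //; split=> //; apply/B1_res; exists 1.
  exact: mu1.
by move=> g gL; rewrite cd // rmorph1 !divff ?oner_eq0 //; exact: V_neq0.
Qed.

Lemma Z1_div c d : Z1F c -> Z1F d -> Z1F (fun psi => c psi / d psi).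
Proof.
move=> [cV cK cM] [dV dK dM]; split.
- by move=> g hg; apply: muM; [exact: cV|apply: muV; exact: dV].
- move=> g hg; have [s hs] := cK g hg; have [t ht] := dK g hg.
  exists (s ++ t) => h hh gh; rewrite hs ?ht // => a ha; apply: gh;
    by rewrite mem_cat ha ?orbT.
- move=> g h hg hh; rewrite cM // dM //.
  have cVh := cV h hh; have dVh := dV h hh.
  move: hg hh cVh dVh => /GF_res [g' [gL ->]] _ cVh dVh.
  have cdV : mu q (c h / d h) by apply: muM => //; exact: muV.
  rewrite !twisted_actE // fmorph_div invfM.
  by rewrite -!mulrA; congr (_ * _); rewrite mulrCA.
Qed.

(** With [classes_of], translates between subgroups of H^1 over G_F and sets of cocycles over
    Aut(Omega/L). Agreement is asked on Aut(Omega/L) only, because values elsewhere carry no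
    meaning. *)
Definition cocycles_of A : set ((Omega -> Omega) -> Omega) :=
  [set c | cocy c /\ exists c0, [/\ Z1F c0, A (classF c0) &
    forall g, fixes L g -> c g = c0 (res_gal Fp g)]].

Definition classes_of P : set (set ((Omega -> Omega) -> Omega)) :=
  [set C | exists c0, [/\ Z1F c0, C = classF c0 &
    P (fun phi => c0 (res_gal Fp phi))]].

Local Notation csub := (cocycle_subgroup L Fp p n).

Lemma cocycles_of_res A c : Z1F c -> A (classF c) ->
  cocycles_of A (fun phi => c (res_gal Fp phi)).
Proof. by move=> hc Ac; split; [exact: Z1_cocycle|exists c]. Qed.

Lemma cocycles_of_subgroup A : H1_subgroup (GF p F) V act A -> csub (cocycles_of A).
Proof.
move=> [AH A1 Adiv]; split.
- by move=> c [].
- move=> v hv; have hc := cocycle_coboundary p_pr Falg FL mu_q_finite hv; split=> //.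
  have [c0 hc0 c0E] := cocycle_Z1 hc; exists c0; split=> //.
  have Z11 : Z1F (fun=> 1).
    split=> [g _|g _|_ h /GF_res [g [gL ->]] _]; first exact: mu1.
      by exists [::].
    by rewrite twisted_actE ?rmorph1 ?mulr1 //; exact: mu1.
  rewrite -(@class_eq (fun=> 1) c0) //; split=> //; apply/B1_res; exists v => //.
  by move=> g gL; rewrite divr1 -c0E.
- move=> c d [hc [c0 [hc0 Ac0 cE]]] [hd [d0 [hd0 Ad0 dE]]].
  have h0 := Z1_div hc0 hd0; have := cocycles_of_res h0 (Adiv _ _ hc0 hd0 Ac0 Ad0).
  move=> [[emu [s [sFp es]] eM] _].
  have cdE g : fixes L g -> c g / d g = c0 (res_gal Fp g) / d0 (res_gal Fp g).
    by move=> gL; rewrite cE ?dE.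
  split.
    split.
    + by move=> g gL; rewrite cdE //; exact: emu.
    + by exists s; split=> // g h gL hL gh; rewrite !cdE //; exact: es.
    + move=> g h gL hL; have ghL : fixes L (g \o h) by exact: fixes_comp.
      have := cdE _ ghL; rewrite /= => ->; rewrite !cdE //; exact: eM.
  exists (fun psi => c0 psi / d0 psi); split=> //; exact: Adiv.
- move=> c d [hc [c0 [hc0 Ac0 cE]]] hd cd; split=> //.
  by exists c0; split=> // g gL; rewrite -cd ?cE.
Qed.

Lemma classes_of_class P c : csub P -> Z1F c -> classes_of P (classF c) ->
  P (fun phi => c (res_gal Fp phi)).
Proof.
move=> hP hc [d [hd cd Pd]]; have [Pcoc P1 Pdiv Pext] := hP.
have : classF d c by rewrite -cd; exact: class_self.
move=> [_ /B1_res [v hv e]].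
have Pv := P1 v^-1 (muV hv).
apply: (Pext _ _ (Pdiv _ _ Pd Pv)); first exact: Z1_cocycle.
move=> g gL; have d0 := V_neq0 hd gL; have v0 := mu_neq0 q_gt0 hv.
have gv0 : g v != 0 by rewrite fmorph_eq0.
have -> : c (res_gal Fp g) = g v / v * d (res_gal Fp g) by rewrite -e // divfK.
by rewrite /= fmorphV invfM !invrK mulrC.
Qed.

Lemma classes_of_subgroup P : csub P -> H1_subgroup (GF p F) V act (classes_of P).
Proof.
move=> hP; have [Pcoc P1 Pdiv Pext] := hP; split.
- by move=> _ [c [hc -> _]]; exists c.
- exists (fun=> 1); split=> //.
    split=> [g _|g _|_ h /GF_res [g [gL ->]] _]; first exact: mu1.
      by exists [::].
    by rewrite twisted_actE ?rmorph1 ?mulr1 //; exact: mu1.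
  apply: (Pext _ _ (P1 1 (mu1 _ _))).
    split=> [g _||g h _ _]; [exact: mu1|by exists [::]|by rewrite rmorph1 mulr1].
  by move=> g _; rewrite rmorph1 divr1.
- move=> c d hc hd Pc Pd; exists (fun psi => c psi / d psi); split=> //.
    exact: Z1_div.
  exact: Pdiv (classes_of_class hP hc Pc) (classes_of_class hP hd Pd).
Qed.

Lemma classes_ofK P : csub P -> cocycles_of (classes_of P) = P.
Proof.
move=> hP; have [Pcoc _ _ Pext] := hP; apply/seteqP; split=> c.
  move=> [hc [c0 [hc0 Pc0 cE]]].
  by apply: (Pext _ _ (classes_of_class hP hc0 Pc0)) => // g gL; rewrite cE.
move=> Pc; have hc := Pcoc c Pc; split=> //.
have [c0 hc0 cE] := cocycle_Z1 hc; exists c0; split=> //.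
exists c0; split=> //; apply: (Pext _ _ Pc) => //; exact: Z1_cocycle.
Qed.

Lemma cocycles_of_inj A A' : H1_subgroup (GF p F) V act A ->
  H1_subgroup (GF p F) V act A' -> cocycles_of A `<=` cocycles_of A' -> A `<=` A'.
Proof.
move=> [AH _ _] _ sub C hAC; have [c hc cC] := AH C hAC.
rewrite -cC in hAC *; have [_ [d [hd Ad dE]]] := sub _ (cocycles_of_res hc hAC).
by rewrite (class_eq_res hc hd dE).
Qed.

Lemma killed_cocycles A g : H1_subgroup (GF p F) V act A -> fixes L g ->
  (forall C c, A C -> C c -> c (res_gal Fp g) = 1) <->
  (forall c, cocycles_of A c -> c g = 1).
Proof.
move=> [AH _ _] gL; split=> [h c [hc [c0 [hc0 Ac0 cE]]]|h C c hAC Cc].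
  by rewrite cE //; apply: h Ac0 _; exact: class_self.
have [c0 hc0 cC] := AH C hAC; rewrite -cC in hAC Cc; have [hc _] := Cc.
apply: (h (fun phi => c (res_gal Fp phi))); apply: cocycles_of_res => //.
by rewrite -(class_eq hc0 hc Cc).
Qed.

Let E_Fp : E `<=` Fp. Proof. by move=> x []. Qed.

Lemma field_over_E_fixed A : H1_subgroup (GF p F) V act A ->
  field_over_E p n F A = fixed_field L Fp p n (cocycles_of A).
Proof.
move=> hA; have galE : galois_ext E Fp.
  exact: (galois_ext_sub Falg galois_Fp _ _ subfieldE).
apply/seteqP; split=> [x [/set_mem Fpx hx]|x [Fpx hx]].
  split=> // g gM gP; have gL := gM.1.
  have gE : fixes E g by apply/(fixes_E_mu gL); exact: gM.2.
  rewrite -(res_galE g Fpx); apply: hx.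
    by apply/(gal_group_res Falg _ FE galE); exists g.
  by move=> C c hAC Cc; apply: (killed_cocycles hA gL).2 hAC Cc.
split; first exact: mem_set.
move=> _ /(gal_group_res Falg _ FE galE) [h [hE ->]] gP.
have [k [kL kh]] := lift_Fp (fixes_sub FE hE).
have kres : res_gal Fp h = res_gal Fp k by apply: res_gal_eq => y Fpy; rewrite kh.
rewrite kres in gP *; rewrite res_galE //; apply: hx.
  split=> //; apply/(fixes_E_mu kL) => y Ey; rewrite kh ?hE //; exact: E_Fp.
exact/(killed_cocycles hA kL).
Qed.

Lemma field_over_M_fixed A : H1_subgroup (GF p F) V act A ->
  field_over_M p n F A = fixed_field L J p n (cocycles_of A).
Proof.
move=> hA; have galM : galois_ext M J.
  exact: (galois_ext_sub Falg galois_J _ _ hM FM M_sub_J).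
have rr (phi : Omega -> Omega) : res_gal Fp (res_gal J phi) = res_gal Fp phi.
  by apply: res_gal_eq => y Fpy; rewrite res_galE //; exact: FpJ.
apply/seteqP; split=> [x [/set_mem Jx hx]|x [Jx hx]].
  split=> // g gM gP; have gL := gM.1.
  have gfM : fixes M g by apply/(fixes_M_mu gL); exact: gM.2.
  rewrite -(res_galE g Jx); apply: hx.
    by apply/(gal_group_res Falg _ FM galM); exists g.
  by move=> C c hAC Cc; rewrite rr; apply: (killed_cocycles hA gL).2 hAC Cc.
split; first exact: mem_set.
move=> _ /(gal_group_res Falg _ FM galM) [h [hfM ->]]; rewrite rr => gP.
have kL := fixes_sub L_sub_M hfM.
rewrite res_galE //; apply: hx.
  by split=> //; apply/(fixes_M_mu kL).
exact/(killed_cocycles hA kL).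
Qed.

(** A lift over L shows that the p^e-th iterate of any automorphism over [F] fixes E; a further
    p^n-th iterate is trivial on [S]. So every element of [S] has period p^(n+e). *)
Lemma extension_of_E_sub S : extensions_of_E F theta S -> S `<=` Fp.
Proof.
move=> [[galES _ expo] galS _] x Sx.
have [hS FS Ssep Sst] := (galois_extP Falg S hF (@subset_refl _ F)).1 galS.
have [hE _ ES _] := galES.
apply/(max_p_extP Falg x p_pr hF (@subset_refl _ F)); split; first exact: Ssep.
move=> g gF; have [e he] := mu_q_period; exists (n + e)%N.
have [h [hL hg]] := lift_Fp gF.
have gE : fixes E (auto_iter g (p ^ e)).
  move=> y Ey; rewrite auto_iterE.
  have : fixes E (auto_iter h (p ^ e)).
    apply/fixes_E_mu; first by rewrite auto_iterE; exact: fixes_iter.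
    by rewrite auto_iterE; exact: he.
  move=> /(_ y Ey); rewrite auto_iterE => {2}<-.
  elim: (p ^ e)%N => //= m ->.
  rewrite -hg // -auto_iterE; apply: FpL_stable; last exact: E_Fp.
  by rewrite auto_iterE; exact: fixes_iter.
have hr : gal_group S E (res_gal S (auto_iter g (p ^ e))).
  by apply/(gal_group_res Falg _ FE galES); exists (auto_iter g (p ^ e)).
have := expo _ hr; rewrite -res_gal_iter; last first.
  by apply: Sst; exact: fixes_sub gE.
move=> /(congr1 (@^~ x)) /=; rewrite res_galE // => e1.
rewrite expnD iterM; rewrite -[RHS]e1; apply: eq_iter => y.
by rewrite auto_iterE.
Qed.

(** An automorphism over [F] is one over L followed by one over F(p). The first preserves [T]; the
    second commutes on J with every automorphism over L, so it preserves [T], the fixed field of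
    some of these. *)
Lemma galois_L_F T : galois_ext L T -> T `<=` J -> galois_ext F T.
Proof.
move=> galT TJ; have [hT LT Tsep Tst] := (galois_extP Falg T sfL FL).1 galT.
have FT : F `<=` T by exact: subset_trans LT.
apply/(galois_extP Falg) => //; split=> //; first by move=> x /TJ /J_sep.
move=> g gF x Tx; have [h [hL hg]] := lift_Fp gF.
have [h' [hL' hh' h'h]] := auto_inv Falg FL hL.
have [k kE] : exists k : {rmorphism Omega -> Omega}, forall y, k y = g (h' y).
  by exists (g \o h').
have kFp : fixes Fp k by move=> y Fpy; rewrite kE -hg ?h'h //; exact: FpL_stable.
have -> : g x = k (h x) by rewrite kE hh'.
have {Tx} := Tst h hL x Tx; set y := h x => Ty.
have kF : fixes F k := fixes_sub FFp kFp.
have Jky : J (k y) by apply: J_stable => //; exact: TJ.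
apply: (separable_fix Falg hT FT); first by apply: separable_sub FT _; exact: J_sep.
move=> r rT; have rL := fixes_sub LT rT.
have [r' [rL' rr' r'r]] := auto_inv Falg FL rL.
have [k' [kFp' kk' k'k]] := auto_inv Falg FFp kFp.
(* Checked on the generators of J: [k] fixes F(p), which [r] preserves, and [r] fixes mu_p, which
   [k] preserves. *)
have comm : fixes J (k' \o (r' \o (k \o r))).
  apply: fixes_gen => z Jz.
  rewrite /=; suff -> : k (r z) = r (k z) by rewrite rr' kk'.
  case: Jz => [Fpz|hz]; first by rewrite (kFp z) // (kFp (r z)) //; exact: FpL_stable.
  rewrite (rL z); last exact: muL.
  by rewrite (rL (k z)) //; apply: muL; exact: mu_auto.
have e : k' (r' (k (r y))) = y := comm y (TJ y Ty).
have e2 : k y = r' (k y) by rewrite -{1}e k'k (rT y Ty).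
by rewrite {1}e2 r'r.
Qed.

Lemma twisted_ext_E S :
  twisted_ext Fp F E (alpha_theta_inv F theta) S <-> extensions_of_E F theta S.
Proof.
split=> [[abS galS _ aS] //|hS]; have [abS galS aS] := hS.
by split=> //; exact: extension_of_E_sub.
Qed.

Lemma twisted_ext_M T :
  twisted_ext J L M (alpha p n) T <-> extensions_of_M p n F T.
Proof.
split=> [[abT galT TJ aT]|[abT galT TJ aT]]; split=> //.
  exact: galois_L_F.
apply: (galois_ext_sub Falg galT) => //.
by have [[_ _ MT _] _ _] := abT; exact: subset_trans L_sub_M MT.
Qed.

(** * The two correspondences as instances of one bijection *)

Section Bijection.
Variables (X B K : set Omega) (chi : (Omega -> Omega) -> {unit 'Z_q}).
Hypotheses (FB : F `<=` B) (BL : B `<=` L) (hB : is_subfield B)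
  (galX : galois_ext B X) (hK : is_subfield K) (BK : B `<=` K) (KX : K `<=` X)
  (Kst : auto_stable B K) (FpX : Fp `<=` X) (XJ : X `<=` J).
Hypothesis lift_X : forall g, fixes B g ->
  exists h, fixes L h /\ forall x, X x -> h x = g x.
Hypothesis KM : forall g, fixes L g -> fixes K g <-> fixes (mu q) g.
Hypothesis chiP : forall g sigma, fixes L g -> gal_group K B sigma ->
  (forall x, K x -> g x = sigma x) ->
  forall w, mu q w -> g w = w ^+ val (chi sigma).
Variable field_of : set (set ((Omega -> Omega) -> Omega)) -> set Omega.
Hypothesis field_of_fixed : forall A, H1_subgroup (GF p F) V act A ->
  field_of A = fixed_field L X p n (cocycles_of A).

Lemma twisted_bij : set_bij (H1_subgroup (GF p F) V act)
  (twisted_ext X B K chi) field_of.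
Proof.
have Xfin x : X x -> exists s : seq Omega, (forall a, a \in s -> Fp a) /\
    forall g, fixes L g -> fixes [set` s] g -> g x = x.
  by move=> /XJ; exact: J_finite.
split.
- move=> A hA; rewrite field_of_fixed //.
  apply: (fixed_field_ext Falg (Y := Fp)) => //; exact: cocycles_of_subgroup.
- have inj A A' : H1_subgroup (GF p F) V act A -> H1_subgroup (GF p F) V act A' ->
      field_of A = field_of A' -> A `<=` A'.
    move=> hA hA'; rewrite !field_of_fixed // => e.
    apply: cocycles_of_inj => //.
    exact: (fixed_field_inj Falg p_pr p_odd n_gt0 p_neq0 muL FB BL hB galX FpX
      (cocycles_of_subgroup hA) (cocycles_of_subgroup hA') e).
  move=> A A' /set_mem hA /set_mem hA' e.
  by apply/seteqP; split; apply: inj.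
- move=> S hS.
  have hP : csub (trivial_on L Fp p n S).
    exact: (trivial_on_subgroup Falg p_pr FB BL mu_q_finite S).
  have hA := classes_of_subgroup hP.
  exists (classes_of (trivial_on L Fp p n S)) => //.
  rewrite field_of_fixed // classes_ofK //.
  exact: (fixed_field_surj Falg p_pr p_odd n_gt0 p_neq0 muL FB BL hB galX hK BK
    Kst Xfin mu_q_finite lift_X KM chiP).
Qed.
End Bijection.

Lemma twisted_bij_E : set_bij (H1_twisted_subgroup F theta)
  (extensions_of_E F theta) (field_over_E p n F).
Proof.
rewrite (_ : extensions_of_E F theta =
  twisted_ext Fp F E (alpha_theta_inv F theta)); last first.
  by apply/seteqP; split=> S /twisted_ext_E.
apply: twisted_bij => //.
- exact: galois_Fp.
- exact: subfieldE.
- exact: E_stable.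
- exact: lift_Fp.
- exact: fixes_E_mu.
- by move=> g sigma gL hs gs w; exact: alpha_theta_invE.
- exact: field_over_E_fixed.
Qed.

Lemma twisted_bij_M : set_bij (H1_twisted_subgroup F theta)
  (extensions_of_M p n F) (field_over_M p n F).
Proof.
rewrite (_ : extensions_of_M p n F = twisted_ext J L M (alpha p n)); last first.
  by apply/seteqP; split=> T /twisted_ext_M.
apply: twisted_bij => //.
- exact: galois_J_L.
- exact: L_sub_M.
- exact: M_sub_J.
- by move=> g gL; apply: M_stable; exact: fixes_sub gL.
- by move=> g gL; exists g.
- exact: fixes_M_mu.
- move=> g sigma gL hs gs w hw; have [z hz] := zeta.
  by apply: (cycloP q1 hz) hw => v hv; rewrite gs //; exact: mu_M.
- exact: field_over_M_fixed.
Qed.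


End Theta.
End Tower.

Lemma subfield_range (F : fieldType) (Omega : closedFieldType)
    (iota : {rmorphism F -> Omega}) : is_subfield (range iota).
Proof.
apply/subfieldP; split.
- by exists 1; rewrite ?rmorph1.
- by move=> _ _ [a _ <-] [b _ <-]; exists (a - b); rewrite ?rmorphB.
- by move=> _ _ [a _ <-] [b _ <-]; exists (a / b); rewrite ?fmorph_div.
Qed.

Unset Implicit Arguments.

Theorem theorem2p7 (F : fieldType) (Omega : closedFieldType)
    (iota : {rmorphism F -> Omega}) (p n : nat)
    (theta : (Omega -> Omega) -> {unit 'Z_(p ^ n)}) :
  integralRange iota ->
  prime p -> odd p -> (1 <= n)%N ->
  p \notin [pchar F] ->
  ~ (mu p `<=` range iota) ->
  is_theta (range iota) theta ->
  set_bij (H1_twisted_subgroup (range iota) theta)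
          (extensions_of_E (range iota) theta)
          (field_over_E p n (range iota))
  /\
  set_bij (H1_twisted_subgroup (range iota) theta)
          (extensions_of_M p n (range iota))
          (field_over_M p n (range iota)).
Proof.
move=> integral p_pr p_odd n_gt0 pF _ theta_char.
have Falg x : exists r : {poly Omega},
    [/\ r != 0, forall i, range iota r`_i & root r x].
  have [r r_mon rx] := integral x; exists (map_poly iota r); split=> //.
    by rewrite map_poly_eq0; exact: monic_neq0.
  by move=> i; exists r`_i; rewrite ?coef_map.
have hF := subfield_range iota.
have p_neq0 : p%:R != 0 :> Omega.
  by rewrite -(rmorph_nat iota) fmorph_eq0; move: pF; rewrite inE p_pr.
split; [exact: twisted_bij_E|exact: twisted_bij_M].
Qed.
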